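(* Let $A:L^2(\mathbb{R}_+)\rightarrow L^2(\mathbb{R}_+)$ be a bounded linear operator such that $A(\widetilde{\mathcal{M}})\subset\widetilde{\mathcal{M}}$. Then there exist a function $\psi\in H^2_{\mathbb{D}}$ with $\psi(z)\neq 0$ for every $z\in\mathbb{D}$, and an analytic function $\varphi:\mathbb{D}\rightarrow\mathbb{D}$, such that \[ A=\mathcal{H}^{-1}M_\psi C_\varphi\mathcal{H}. \]
   Context: $\mathbb{D}$ is the open unit disk, $\mathbb{R}_+$ the half line $[0,\infty)$; $L^2(\mathbb{R}_+)$ consists of complex-valued functions. $H^2_{\mathbb{D}}$ is the Hardy space of analytic functions on $\mathbb{D}$ with square summable Taylor coefficients. The map $\mathcal{H}:L^2(\mathbb{R}_+)\to H^2_{\mathbb{D}}$, $(\mathcal{H}f)(z)=\frac{\sqrt{2}}{1+z}\int_0^\infty f(t)\exp\!\left(\frac{t(z-1)}{z+1}\right)dt$, is a surjective isometry. A nonzero $G\in H^2_{\mathbb{D}}$ is outer if there is a scalar $\lambda$ with $|\lambda|=1$ such that $G(z)=\lambda\exp\!\left(\frac{1}{2\pi}\int_0^{2\pi}\frac{e^{i\theta}+z}{e^{i\theta}-z}\log|G(e^{i\theta})|\,d\theta\right)$ for all $z\in\mathbb{D}$, where $G(e^{i\theta})$ denotes the boundary function. A function $f\in L^2(\mathbb{R}_+)$ is minimum phase if $\mathcal{H}f$ is outer; $\mathcal{M}$ is the set of all minimum phase functions. For $\tau\ge 0$, $(T_\tau f)(t)=f(t-\tau)$ if $t\geq\tau$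 and $0$ if $t<\tau$. $\widetilde{\mathcal{M}}=\{T_\tau f : f\in\mathcal{M},\ \tau\geq 0\}$. For analytic $\psi$ on $\mathbb{D}$ and analytic $\varphi:\mathbb{D}\to\mathbb{D}$ (possibly constant), $(M_\psi F)(z)=\psi(z)F(z)$ and $(C_\varphi F)(z)=F(\varphi(z))$ for $F$ analytic on $\mathbb{D}$. *)

(* Defs.v *)
From HB Require Import structures.
From mathcomp Require Import all_boot all_order all_algebra.
From mathcomp Require Import all_classical all_reals all_analysis.
From mathcomp.real_closed Require Import complex.

Set Implicit Arguments.
Unset Strict Implicit.
Unset Printing Implicit Defensive.

Import Order.TTheory GRing.Theory Num.Theory.
Import numFieldNormedType.Exports.

Local Open Scope classical_set_scope.
Local Open Scope ring_scope.
Local Open Scope complex_scope.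

Section ComplexPreliminaries.
Variable R : realType.
Implicit Types (z : R[i]) (F : R[i] -> R[i]).

Definition cexp z : R[i] :=
  (expR (complex.Re z))%:C * (cos (complex.Im z) +i* sin (complex.Im z)).

Definition cis (theta : R) : R[i] := cos theta +i* sin theta.

Definition cintegral (D : set R) (g : R -> R[i]) : R[i] :=
  (\int[lebesgue_measure]_(t in D) complex.Re (g t))
  +i* (\int[lebesgue_measure]_(t in D) complex.Im (g t)).

Definition disk : set R[i] := [set z | `|z| < 1].

(* The topology on R[i] is the one that R[i]^o carries as a normed module over
   itself, so that derivability in the direction 1 is complex
   differentiability. *)
Definition analytic_on_disk F : Prop :=
  forall z, disk z -> derivable (F : R[i]^o -> R[i]^o) z 1.

(* Analytic functions on the disk with square summable Taylor coefficients.
   Functions on the disk are represented by total functions whose values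
   outside the disk are irrelevant. *)
Definition hardy2 : set (R[i] -> R[i]) := [set F |
  exists a : nat -> R[i],
    cvgn (series (fun n => Normc.normc (a n) ^+ 2)) /\
    forall z, disk z ->
      series (fun n => a n * z ^+ n : R[i]^o) @ \oo --> (F z : R[i]^o)].

Definition boundary F (theta : R) : R[i] :=
  lim ((F (r%:C * cis theta) : R[i]^o) @[r --> (1 : R)^'-]).

(* For a nonzero F in the Hardy space the radial limits exist and are nonzero
   almost everywhere and log |F| is integrable on the circle, so the junk values
   of lim, ln and the integral play no role. *)
Definition outer F : Prop :=
  [/\ hardy2 F,
      exists2 z, disk z & F z != 0 &
      exists2 lambda : R[i], `|lambda| = 1 &
        forall z, disk z ->
          F z = lambda * cexp ((2 * pi)^-1%:C *
            cintegral `[0, 2 * pi] (fun theta =>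
              (cis theta + z) / (cis theta - z)
              * (ln (Normc.normc (boundary F theta)))%:C))].

Definition mul_op (psi F : R[i] -> R[i]) : R[i] -> R[i] :=
  fun z => psi z * F z.

Definition comp_op (phi F : R[i] -> R[i]) : R[i] -> R[i] :=
  fun z => F (phi z).

End ComplexPreliminaries.

Section HalfLine.
Variable R : realType.
Implicit Types (f g : R -> R[i]) (A : (R -> R[i]) -> (R -> R[i])).

Definition Rplus : set R := `[0, +oo[.

Definition L2sq f : \bar R :=
  (\int[lebesgue_measure]_(t in Rplus) (Normc.normc (f t) ^+ 2)%:E)%E.

(* Elements of L^2(R_+) are represented by functions on R, of which only the
   restriction to R_+ up to almost everywhere equality matters. *)
Definition L2 : set (R -> R[i]) := [set f |
  [/\ measurable_fun Rplus (fun t => complex.Re (f t)),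
      measurable_fun Rplus (fun t => complex.Im (f t)) &
      (L2sq f < +oo)%E]].

Definition L2eq f g : Prop := ae_eq lebesgue_measure Rplus f g.

Definition L2norm f : R := Num.sqrt (fine (L2sq f)).

(* A bounded linear operator on L^2(R_+), given by its action on
   representatives. *)
Definition bounded_linear_L2 A : Prop :=
  [/\ forall f, L2 f -> L2 (A f),
      forall f g, L2 f -> L2 g -> L2eq f g -> L2eq (A f) (A g),
      forall (a : R[i]) f g, L2 f -> L2 g ->
        L2eq (A (fun t => a * f t + g t)) (fun t => a * A f t + A g t) &
      exists K : R, forall f, L2 f -> L2norm (A f) <= K * L2norm f].

Definition Hmap f : R[i] -> R[i] := fun z =>
  (Num.sqrt 2)%:C / (1 + z) *
  cintegral Rplus (fun t => f t * cexp (t%:C * (z - 1) / (z + 1))).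

(* A representative of the preimage of F under the bijection Hmap from
   L^2(R_+) to the Hardy space. *)
Definition Hinv (F : R[i] -> R[i]) : R -> R[i] :=
  xget (fun=> 0) [set f | L2 f /\ forall z, disk z -> Hmap f z = F z].

Definition min_phase : set (R -> R[i]) := [set f | L2 f /\ outer (Hmap f)].

Definition time_shift (tau : R) f : R -> R[i] :=
  fun t => if tau <= t then f (t - tau) else 0.

Definition shifted_min_phase : set (R -> R[i]) := [set g |
  L2 g /\ exists f tau, [/\ min_phase f, 0 <= tau & L2eq g (time_shift tau f)]].

End HalfLine.

(* Main.v *)
Require Import Defs.
From HB Require Import structures.
From mathcomp Require Import all_boot all_order all_algebra.
From mathcomp Require Import all_classical all_reals all_analysis.
From mathcomp.real_closed Require Import complex.
From mathcomp Require Import measurable_realfun ring lra.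

(** For z in the disk, Phi_z f = H(Af)(z) is a bounded linear functional on L2.
    It does not vanish on shifted minimum phase functions: an outer function is
    a unimodular constant times an exponential, and delaying by tau multiplies
    the transform by exp(tau (z-1)/(z+1)) ([shifted_min_phase_neq0]).

    The Laguerre functions [ell n] are orthonormal and H maps [ell n] to z^n
    ([integral_ellM], [Hmap_ell]), so a finite combination of them is sent to
    the polynomial with the same coefficients. A product of factors 1 - b z with
    |b| < 1 is outer: the Schwarz integral of log|1 - b e^(it)| is a logarithm
    of 1 - b z ([schwarz_log1sub], [outer_prod1sub]). Hence the linear functional
    on polynomials with moments m_k = Phi_z (ell k) vanishes on no product of
    such factors.

    As in the Gleason-Kahane-Zelazko theorem, such a functional is a multiple of
    an evaluation, m_k = m_0 w^k ([nonvanishing_powers]): the roots of the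
    polynomial x -> sum_k C(n,k) (-x)^k m_k, the value of the functional at
    (1 - xX)^n, all have modulus at least 1, and comparing the first two power
    sums of their inverses as n grows gives m_0 m_2 = m_1^2
    ([nonvanishing_square]). Applying this to p -> Phi_z ((1 - X/2) p) reaches
    the higher moments by induction. Boundedness of Phi_z forces |w| < 1
    ([phi_disk]).

    Put psi z = m_0 and phi z = m_1/m_0. The functionals f -> H(Af)(z) and
    f -> psi z * (Hf)(phi z) are bounded and agree on the Laguerre functions,
    which span a dense subspace ([L2_ell_ind]), so they are equal
    ([value_weighted]). Since psi = H(A(ell 0)) and phi = H(A(ell 1))/psi, the
    first is in the Hardy space and the second is analytic. Injectivity of H
    ([Hmap_inj], again by density) recovers Af from its transform. *)

Set Implicit Arguments.
Unset Strict Implicit.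
Unset Printing Implicit Defensive.

Import Order.TTheory GRing.Theory Num.Theory.
Import numFieldNormedType.Exports.

Local Open Scope classical_set_scope.
Local Open Scope ring_scope.
Local Open Scope complex_scope.

Local Notation normc := Normc.normc.
Local Notation Re := complex.Re.
Local Notation Im := complex.Im.

(** * Complex numbers *)
Section ComplexNumbers.
Variable R : realType.
Implicit Types (z w : R[i]) (x y : R).

Lemma normE z : `|z| = (normc z)%:C. Proof. by []. Qed.

Lemma diskE z : disk z <-> normc z < 1.
Proof. by rewrite /disk /= normE ltcR. Qed.

Lemma Re_add z w : Re (z + w) = Re z + Re w. Proof. by case: z; case: w. Qed.
Lemma Im_add z w : Im (z + w) = Im z + Im w. Proof. by case: z; case: w. Qed.
Lemma Re_opp z : Re (- z) = - Re z. Proof. by case: z. Qed.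
Lemma Im_opp z : Im (- z) = - Im z. Proof. by case: z. Qed.
Lemma Re_mul z w : Re (z * w) = Re z * Re w - Im z * Im w.
Proof. by case: z; case: w. Qed.
Lemma Im_mul z w : Im (z * w) = Re z * Im w + Im z * Re w.
Proof. by case: z; case: w. Qed.
Lemma Re_mulr x z : Re (x%:C * z) = x * Re z.
Proof. by rewrite Re_mul /= mul0r subr0. Qed.
Lemma Im_mulr x z : Im (x%:C * z) = x * Im z.
Proof. by rewrite Im_mul /= mul0r addr0. Qed.
Lemma Re_conj z : Re (conjc z) = Re z. Proof. by case: z. Qed.
Lemma Im_conj z : Im (conjc z) = - Im z. Proof. by case: z. Qed.
Lemma Re_sum I (s : seq I) (P : pred I) (F : I -> R[i]) :
  Re (\sum_(i <- s | P i) F i) = \sum_(i <- s | P i) Re (F i).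
Proof. by apply: (big_morph _ Re_add erefl). Qed.
Lemma Im_sum I (s : seq I) (P : pred I) (F : I -> R[i]) :
  Im (\sum_(i <- s | P i) F i) = \sum_(i <- s | P i) Im (F i).
Proof. by apply: (big_morph _ Im_add erefl). Qed.

Lemma complex_eqP z w : Re z = Re w -> Im z = Im w -> z = w.
Proof. by case: z => a b; case: w => c d /= -> ->. Qed.

Lemma complex_split z : z = (Re z)%:C + 'i%C * (Im z)%:C.
Proof. exact: complexE. Qed.

Lemma normc_ge0 z : 0 <= normc z.
Proof. by case: z => a b /=; exact: sqrtr_ge0. Qed.

Lemma sqr_normc_def z : normc z ^+ 2 = Re z ^+ 2 + Im z ^+ 2.
Proof. by case: z => a b /=; rewrite sqr_sqrtr// addr_ge0 ?sqr_ge0. Qed.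

Lemma normcR x : normc x%:C = `|x|.
Proof. by rewrite /= expr0n /= addr0 sqrtr_sqr. Qed.

Lemma normc_geRe z : `|Re z| <= normc z.
Proof. by rewrite -sqrtr_sqr; case: z => a b /=; apply: ler_wsqrtr; rewrite lerDl sqr_ge0. Qed.

Lemma normc_geIm z : `|Im z| <= normc z.
Proof. by rewrite -sqrtr_sqr; case: z => a b /=; apply: ler_wsqrtr; rewrite lerDr sqr_ge0. Qed.

Lemma normcD z w : normc (z + w) <= normc z + normc w.
Proof. exact: le_normcD. Qed.
Lemma normcNN z : normc (- z) = normc z. Proof. exact: normcN. Qed.
Lemma normc_leD z : normc z <= `|Re z| + `|Im z|.
Proof.
rewrite {1}(complex_split z); apply: le_trans (normcD _ _) _.
by rewrite Normc.normcM !normcR /= expr0n expr1n add0r sqrtr1 mul1r.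
Qed.
Lemma normc_conj z : normc (conjc z) = normc z.
Proof. by case: z => a b /=; rewrite sqrrN. Qed.
Lemma mulr_conj z : z * conjc z = (normc z ^+ 2)%:C.
Proof.
apply: complex_eqP; rewrite /= ?Re_mul ?Im_mul Re_conj Im_conj ?sqr_normc_def; first by ring.
by rewrite mulrN mulrC addNr.
Qed.
Lemma conjcM z w : conjc (z * w) = conjc z * conjc w. Proof. exact: rmorphM. Qed.
Lemma conjcX z n : conjc (z ^+ n) = conjc z ^+ n. Proof. exact: rmorphXn. Qed.
Lemma normcX z n : normc (z ^+ n) = normc z ^+ n.
Proof.
by elim: n => [|n IH]; rewrite ?expr0 ?Normc.normc1// !exprS Normc.normcM IH.
Qed.
Lemma normc_eq0 z : (normc z == 0) = (z == 0).
Proof. by apply/eqP/eqP => [/Normc.eq0_normc//|->]; rewrite Normc.normc0. Qed.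
Lemma normc_gt0 z : (0 < normc z) = (z != 0).
Proof. by rewrite lt_neqAle normc_ge0 andbT eq_sym normc_eq0. Qed.
Lemma normc_sum I (s : seq I) (P : pred I) (F : I -> R[i]) :
  normc (\sum_(i <- s | P i) F i) <= \sum_(i <- s | P i) normc (F i).
Proof.
elim/big_rec2: _ => [|i y1 y2 _ h]; first by rewrite Normc.normc0.
by apply: le_trans (normcD _ _) _; rewrite lerD2l.
Qed.
Lemma realCD x y : (x + y)%:C = x%:C + y%:C. Proof. exact: rmorphD. Qed.
Lemma realCM x y : (x * y)%:C = x%:C * y%:C. Proof. exact: rmorphM. Qed.
Lemma realCN x : (- x)%:C = - x%:C. Proof. exact: rmorphN. Qed.
Lemma realCX x n : (x ^+ n)%:C = x%:C ^+ n. Proof. exact: rmorphXn. Qed.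
Lemma realCV x : (x^-1)%:C = x%:C^-1.
Proof. exact: fmorphV. Qed.

Lemma normc_sqrD z w : normc (z + w) ^+ 2 <= 2 * normc z ^+ 2 + 2 * normc w ^+ 2.
Proof.
rewrite !sqr_normc_def Re_add Im_add -subr_ge0.
rewrite (_ : _ - _ = (Re z - Re w) ^+ 2 + (Im z - Im w) ^+ 2); last by ring.
by rewrite addr_ge0 ?sqr_ge0.
Qed.

Lemma disk0 : disk (0 : R[i]).
Proof. by apply/diskE; rewrite Normc.normc0. Qed.

Lemma disk_1D z : disk z -> 1 + z != 0.
Proof.
move=> /diskE z1; apply/eqP => /eqP; rewrite addr_eq0 => /eqP z1'.
by move: z1; rewrite -normcNN -z1' Normc.normc1 ltxx.
Qed.

End ComplexNumbers.

(** * Convergence of complex-valued functions *)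
Section ComplexConvergence.
Variable R : realType.

(** The norm of [R[i]] takes values in [R[i]] itself; this restates convergence
    with real radii. *)
Lemma cvgcP (T : Type) (F : set_system T) {FF : Filter F} (f : T -> R[i]) (l : R[i]) :
  ((f : T -> R[i]^o) @ F --> (l : R[i]^o)) <->
  (forall e : R, 0 < e -> \forall x \near F, normc (f x - l) < e).
Proof.
split.
  move=> /cvgrPdist_lt h e e0.
  have /h : (0 : R[i]) < e%:C by rewrite ltcR.
  by apply: filterS => x; rewrite -normrN opprB normE ltcR.
move=> h; apply/cvgrPdist_lt => e; rewrite ltcE => /andP[/eqP ime re].
have -> : e = (Re e)%:C by apply: complex_eqP => //=; rewrite -ime.
have := h _ re; apply: filterS => x.
by rewrite -normrN opprB normE ltcR.
Qed.

Lemma cvgc_ReIm (T : Type) (F : set_system T) {FF : Filter F} (f : T -> R[i]) (l : R[i]) :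
  ((fun t => Re (f t)) @ F --> Re l) -> ((fun t => Im (f t)) @ F --> Im l) ->
  ((f : T -> R[i]^o) @ F --> (l : R[i]^o)).
Proof.
move=> hr hi; apply/cvgcP => e e0.
have e2 : 0 < e / 2 by rewrite divr_gt0.
move/cvgrPdist_lt : hr => /(_ _ e2) hr; move/cvgrPdist_lt : hi => /(_ _ e2) hi.
near=> x.
apply: le_lt_trans (normc_leD _) _.
rewrite Re_add Im_add Re_opp Im_opp (splitr e) ltrD//.
  by rewrite distrC; near: x.
by rewrite distrC; near: x.
Unshelve. all: by end_near. Qed.

Lemma cvgc_Re (T : Type) (F : set_system T) {FF : Filter F} (f : T -> R[i]) (l : R[i]) :
  ((f : T -> R[i]^o) @ F --> (l : R[i]^o)) -> ((fun t => Re (f t)) @ F --> Re l).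
Proof.
move=> /cvgcP h; apply/cvgrPdist_lt => e /h; apply: filterS => x.
apply: le_lt_trans; rewrite -[X in _ <= X]normcNN opprB -Re_opp -Re_add.
exact: normc_geRe.
Qed.

Lemma cvgc_lin (T : Type) (F : set_system T) {FF : Filter F} (a : R[i])
    (u v : T -> R[i]) (l m : R[i]) :
  ((u : T -> R[i]^o) @ F --> (l : R[i]^o)) -> ((v : T -> R[i]^o) @ F --> (m : R[i]^o)) ->
  (((fun t => a * u t + v t) : T -> R[i]^o) @ F --> (a * l + m : R[i]^o)).
Proof.
move=> /cvgcP hu /cvgcP hv; apply/cvgcP => e e0.
have a0 : 0 < normc a + 1 by rewrite ltr_wpDl ?normc_ge0.
have e2 : 0 < e / 2 by rewrite divr_gt0.
have h1 := hu _ (divr_gt0 e2 a0); have h2 := hv _ e2.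
apply: filterS2 h1 h2 => x h1 h2.
rewrite (_ : _ - _ = a * (u x - l) + (v x - m)); last by ring.
apply: le_lt_trans (normcD _ _) _; rewrite (splitr e) ler_ltD// Normc.normcM.
move: h1; rewrite ltr_pdivlMr// => h1; apply: le_trans (ltW h1).
by rewrite mulrC ler_wpM2l ?normc_ge0// lerDl.
Qed.
End ComplexConvergence.

(** * Integration of complex-valued functions *)
Section ComplexIntegral.
Variable R : realType.
Notation mu := (@lebesgue_measure R).
Notation TR := (measurableTypeR R).
Implicit Types (D : set R) (g h : R -> R[i]).

Definition cmeasurable D g :=
  measurable_fun (D : set TR) (fun t => Re (g t)) /\ measurable_fun (D : set TR) (fun t => Im (g t)).

Definition cintegrable D g :=
  mu.-integrable D (EFin \o (fun t => Re (g t))) /\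
  mu.-integrable D (EFin \o (fun t => Im (g t))).

Lemma integrable_ext D (u v : R -> R) : measurable (D : set TR) -> (forall t, D t -> u t = v t) ->
  mu.-integrable D (EFin \o u) -> mu.-integrable D (EFin \o v).
Proof.
move=> mD uv iu; refine (@eq_integrable _ _ _ _ _ mD (EFin \o u) _ _ iu).
by move=> t; rewrite inE /= => /uv ->.
Qed.

Lemma integrableDr D (u v : R -> R) : measurable (D : set TR) ->
  mu.-integrable D (EFin \o u) -> mu.-integrable D (EFin \o v) ->
  mu.-integrable D (EFin \o (fun t => u t + v t)).
Proof. by move=> mD iu iv; exact: (integrableD mD iu iv). Qed.

Lemma integrableZr D (u : R -> R) (k : R) : measurable (D : set TR) ->
  mu.-integrable D (EFin \o u) -> mu.-integrable D (EFin \o (fun t => k * u t)).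
Proof. by move=> mD iu; exact: (integrableZl mD k iu). Qed.

Lemma integrable_measurable D (u : R -> R) :
  mu.-integrable D (EFin \o u) -> measurable_fun (D : set TR) u.
Proof. by move=> /measurable_int/measurable_EFinP. Qed.

Lemma integrable_le D (u v : R -> R) : measurable (D : set TR) -> measurable_fun (D : set TR) u ->
  (forall t, D t -> `|u t| <= v t) -> mu.-integrable D (EFin \o v) ->
  mu.-integrable D (EFin \o u).
Proof.
move=> mD mu_ uv; apply: le_integrable => //; first exact/measurable_EFinP.
by move=> t Dt /=; rewrite lee_fin (le_trans (uv t Dt))// ler_norm.
Qed.

Lemma cmeasurable_ext D g h : (forall t, D t -> g t = h t) ->
  cmeasurable D g -> cmeasurable D h.
Proof.
move=> gh [m1 m2]; split; [apply: eq_measurable_fun m1|apply: eq_measurable_fun m2];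
  by move=> t; rewrite inE => /gh ->.
Qed.

Lemma cintegrable_ext D g h : measurable (D : set TR) -> (forall t, D t -> g t = h t) ->
  cintegrable D g -> cintegrable D h.
Proof.
by move=> mD gh [m1 m2]; split; [apply: integrable_ext m1|apply: integrable_ext m2] => //;
  move=> t /gh ->.
Qed.

Lemma cintegral_ext D g h : (forall t, D t -> g t = h t) ->
  cintegral D g = cintegral D h.
Proof.
by move=> gh; congr (_ +i* _); apply: eq_Rintegral => t; rewrite inE => /gh ->.
Qed.

Lemma cmeasurableD D g h : measurable (D : set TR) -> cmeasurable D g -> cmeasurable D h ->
  cmeasurable D (fun t => g t + h t).
Proof.
move=> mD [g1 g2] [h1 h2]; split.
  by under eq_fun do rewrite Re_add; exact: measurable_funD.
by under eq_fun do rewrite Im_add; exact: measurable_funD.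
Qed.

Lemma cmeasurableM D g h : measurable (D : set TR) -> cmeasurable D g -> cmeasurable D h ->
  cmeasurable D (fun t => g t * h t).
Proof.
move=> mD [g1 g2] [h1 h2]; split.
  under eq_fun do rewrite Re_mul.
  by apply: measurable_funB; exact: measurable_funM.
under eq_fun do rewrite Im_mul.
by apply: measurable_funD; exact: measurable_funM.
Qed.

Lemma cmeasurable_cst D (a : R[i]) : measurable (D : set TR) -> cmeasurable D (fun=> a).
Proof. by split; exact: measurable_cst. Qed.

Lemma cmeasurableR D (u : R -> R) : measurable_fun (D : set TR) u ->
  cmeasurable D (fun t => (u t)%:C).
Proof. by split=> //=; exact: measurable_cst. Qed.

Lemma cmeasurable_conj D g : measurable (D : set TR) -> cmeasurable D g ->
  cmeasurable D (fun t => conjc (g t)).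
Proof.
move=> mD [g1 g2]; split; first by under eq_fun do rewrite Re_conj.
by under eq_fun do rewrite Im_conj; exact: (measurable_funN g2).
Qed.

Lemma measurable_sqr_normc D g : measurable (D : set TR) -> cmeasurable D g ->
  measurable_fun (D : set TR) (fun t => normc (g t) ^+ 2).
Proof.
move=> mD [g1 g2]; under eq_fun do rewrite sqr_normc_def.
by apply: measurable_funD; exact: measurable_funX.
Qed.

Lemma measurable_normc D g : measurable (D : set TR) -> cmeasurable D g ->
  measurable_fun (D : set TR) (fun t => normc (g t)).
Proof.
move=> mD mg; rewrite (_ : (fun t => _) = Num.sqrt \o (fun t => normc (g t) ^+ 2)).
  apply: measurableT_comp; last exact: measurable_sqr_normc.
  exact: (continuous_measurable_fun (@sqrt_continuous R)).
by apply/funext => t /=; rewrite sqrtr_sqr ger0_norm// normc_ge0.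
Qed.

Lemma cintegrable_measurable D g : cintegrable D g -> cmeasurable D g.
Proof. by move=> [/integrable_measurable ? /integrable_measurable ?]. Qed.

Lemma cintegrable_le D g (v : R -> R) : measurable (D : set TR) -> cmeasurable D g ->
  (forall t, D t -> normc (g t) <= v t) -> mu.-integrable D (EFin \o v) ->
  cintegrable D g.
Proof.
move=> mD [m1 m2] gv iv; split; apply: integrable_le iv => // t /gv;
  apply: le_trans; [exact: normc_geRe|exact: normc_geIm].
Qed.

Lemma integrable_normc D g : measurable (D : set TR) -> cintegrable D g ->
  mu.-integrable D (EFin \o (fun t => normc (g t))).
Proof.
move=> mD ig; have [i1 i2] := ig.
apply: (@integrable_le _ _ (fun t => `|Re (g t)| + `|Im (g t)|)) => //.
- by apply: measurable_normc => //; exact: cintegrable_measurable.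
- by move=> t _; rewrite ger0_norm ?normc_ge0//; exact: normc_leD.
- by apply: integrableDr => //; exact: integrable_norm.
Qed.

Lemma cintegrableD D g h : measurable (D : set TR) -> cintegrable D g -> cintegrable D h ->
  cintegrable D (fun t => g t + h t).
Proof.
move=> mD [g1 g2] [h1 h2]; split.
  apply: (@integrable_ext _ (fun t => Re (g t) + Re (h t))) => //; last exact: integrableDr.
  by move=> t _; rewrite Re_add.
apply: (@integrable_ext _ (fun t => Im (g t) + Im (h t))) => //; last exact: integrableDr.
by move=> t _; rewrite Im_add.
Qed.

Lemma cintegralD D g h : measurable (D : set TR) -> cintegrable D g -> cintegrable D h ->
  cintegral D (fun t => g t + h t) = cintegral D g + cintegral D h.
Proof.
move=> mD [g1 g2] [h1 h2]; apply: complex_eqP; rewrite ?Re_add ?Im_add /= -RintegralD//;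
  by apply: eq_Rintegral => t _; rewrite ?Re_add ?Im_add.
Qed.

Lemma cintegrableZ D g (a : R[i]) : measurable (D : set TR) -> cintegrable D g ->
  cintegrable D (fun t => a * g t).
Proof.
move=> mD [g1 g2]; split.
  apply: (@integrable_ext _ (fun t => Re a * Re (g t) + - Im a * Im (g t))) => //.
    by move=> t _; rewrite Re_mul mulNr.
  by apply: integrableDr => //; exact: integrableZr.
apply: (@integrable_ext _ (fun t => Re a * Im (g t) + Im a * Re (g t))) => //.
  by move=> t _; rewrite Im_mul.
by apply: integrableDr => //; exact: integrableZr.
Qed.

Lemma cintegralZ D g (a : R[i]) : measurable (D : set TR) -> cintegrable D g ->
  cintegral D (fun t => a * g t) = a * cintegral D g.
Proof.
move=> mD [g1 g2]; apply: complex_eqP; rewrite ?Re_mul ?Im_mul /=.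
  rewrite -!RintegralZl// -RintegralB//; [|exact: integrableZr..].
  by apply: eq_Rintegral => t _; rewrite Re_mul.
rewrite -!RintegralZl// -RintegralD//; [|exact: integrableZr..].
by apply: eq_Rintegral => t _; rewrite Im_mul.
Qed.

Lemma cintegrable0 D : measurable (D : set TR) -> cintegrable D (fun=> 0).
Proof. by move=> mD; split => /=; apply: integrable0. Qed.

Lemma cintegral0 D : cintegral D (fun=> 0 : R[i]) = 0.
Proof. by rewrite /cintegral /Rintegral /= integral0. Qed.

Lemma cintegrable_sum D I (s : seq I) (F : I -> R -> R[i]) : measurable (D : set TR) ->
  (forall i, cintegrable D (F i)) -> cintegrable D (fun t => \sum_(i <- s) F i t).
Proof.
move=> mD iF; elim: s => [|i s IH].
  by apply: cintegrable_ext (cintegrable0 mD) => // t _; rewrite big_nil.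
apply: cintegrable_ext (cintegrableD mD (iF i) IH) => // t _.
by rewrite big_cons.
Qed.

Lemma cintegral_sum D I (s : seq I) (F : I -> R -> R[i]) : measurable (D : set TR) ->
  (forall i, cintegrable D (F i)) ->
  cintegral D (fun t => \sum_(i <- s) F i t) = \sum_(i <- s) cintegral D (F i).
Proof.
move=> mD iF; elim: s => [|i s IH].
  rewrite big_nil -[RHS](cintegral0 D); apply: cintegral_ext => t _.
  by rewrite big_nil.
rewrite big_cons -IH -cintegralD//; last exact: cintegrable_sum.
by apply: cintegral_ext => t _; rewrite big_cons.
Qed.

Lemma cintegralB D g h : measurable (D : set TR) -> cintegrable D g -> cintegrable D h ->
  cintegral D (fun t => g t - h t) = cintegral D g - cintegral D h.
Proof.
move=> mD ig ih; rewrite -[- cintegral D h]mulN1r -cintegralZ// -cintegralD//.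
  by apply: cintegral_ext => t _; rewrite mulN1r.
exact: cintegrableZ.
Qed.

Lemma cintegralR D (u : R -> R) : cintegral D (fun t => (u t)%:C) = (\int[mu]_(t in D) u t)%:C.
Proof. by rewrite /cintegral /= /Rintegral /= integral0. Qed.

(** The integral is rotated onto the positive axis, where it is the integral of
    a real part. *)
Lemma normc_cintegral_le D g (v : R -> R) : measurable (D : set TR) -> cintegrable D g ->
  (forall t, D t -> normc (g t) <= v t) -> mu.-integrable D (EFin \o v) ->
  normc (cintegral D g) <= \int[mu]_(t in D) v t.
Proof.
move=> mD ig gv iv; set I := cintegral D g.
have v0 t : D t -> 0 <= v t by move=> /gv; apply: le_trans; exact: normc_ge0.
have [->|I0] := eqVneq I 0; first by rewrite Normc.normc0; exact: Rintegral_ge0.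
pose u := (normc I)%:C / I.
have nI : normc I != 0 by rewrite normc_eq0.
have nu : normc u = 1.
  by rewrite Normc.normcM Normc.normcV normcR ger0_norm ?normc_ge0// divff.
have -> : normc I = Re (cintegral D (fun t => u * g t)).
  by rewrite cintegralZ// -/I /u divfK.
have [ir ii] := cintegrableZ u mD ig.
apply: le_Rintegral => // t Dt.
apply: le_trans (gv t Dt); apply: le_trans (ler_norm _) _.
by apply: le_trans (normc_geRe _) _; rewrite Normc.normcM nu mul1r.
Qed.

Lemma cintegral_ae D g h : measurable (D : set TR) -> cmeasurable D g -> cmeasurable D h ->
  ae_eq mu D g h -> cintegral D g = cintegral D h.
Proof.
move=> mD [g1 g2] [h1 h2] gh; congr (_ +i* _); rewrite /Rintegral; congr fine;
  apply: ae_eq_integral => //; try exact/measurable_EFinP;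
  by apply: filterS gh => t /= /[apply] ->.
Qed.

End ComplexIntegral.

(** * The space of square integrable functions on the half line *)
Section SquareIntegrable.
Variable R : realType.
Notation mu := (@lebesgue_measure R).
Notation TR := (measurableTypeR R).
Notation Rp := (@Rplus R).
Implicit Types (f g h : R -> R[i]).

Lemma measurable_Rplus : measurable (Rp : set TR).
Proof. exact: measurable_itv. Qed.
Hint Resolve measurable_Rplus : core.

Lemma RplusE (t : R) : Rp t = (0 <= t) :> Prop.
Proof. by rewrite /Rplus /= in_itv /= andbT. Qed.

Definition N2 f : R := \int[mu]_(t in Rp) (normc (f t) ^+ 2).

Lemma L2normE f : L2norm f = Num.sqrt (N2 f). Proof. by []. Qed.

Lemma N2_ge0 f : 0 <= N2 f.
Proof. by apply: Rintegral_ge0 => t _; exact: sqr_ge0. Qed.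

Lemma L2P f : L2 f <-> cmeasurable Rp f /\
  mu.-integrable Rp (EFin \o (fun t => normc (f t) ^+ 2)).
Proof.
have E : (\int[mu]_(t in Rp) `|(normc (f t) ^+ 2)%:E| = L2sq f)%E.
  by apply: eq_integral => t _ /=; rewrite ger0_norm ?sqr_ge0.
split.
  move=> [m1 m2 l]; have mf : cmeasurable Rp f by split; [exact: m1|exact: m2].
  split=> //; apply/integrableP; rewrite E; split=> //.
  by apply/measurable_EFinP; exact: measurable_sqr_normc.
by move=> [[m1 m2] /integrableP[_]]; rewrite E => l; split; [exact: m1|exact: m2|].
Qed.

Lemma L2_meas f : L2 f -> cmeasurable Rp f. Proof. by move=> /L2P[]. Qed.

Lemma L2_int f : L2 f -> mu.-integrable Rp (EFin \o (fun t => normc (f t) ^+ 2)).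
Proof. by move=> /L2P[]. Qed.

Lemma L2_dom f (v : R -> R) : cmeasurable Rp f ->
  (forall t, 0 <= t -> normc (f t) <= v t) ->
  mu.-integrable Rp (EFin \o (fun t => v t ^+ 2)) -> L2 f.
Proof.
move=> mf fv iv; apply/L2P; split=> //; apply: integrable_le iv => //.
  exact: measurable_sqr_normc.
move=> t; rewrite RplusE => t0; rewrite ger0_norm ?sqr_ge0//.
by rewrite lerXn2r ?nnegrE ?normc_ge0 ?fv// (le_trans _ (fv _ t0))// normc_ge0.
Qed.

Lemma L2_ext f g : (forall t, 0 <= t -> f t = g t) -> L2 f -> L2 g.
Proof.
move=> fg /L2P[m1 i1]; apply/L2P; split.
  by apply: cmeasurable_ext m1 => t; rewrite RplusE => /fg.
by apply: integrable_ext i1 => // t; rewrite RplusE => /fg ->.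
Qed.

Lemma N2_ext f g : (forall t, 0 <= t -> f t = g t) -> N2 f = N2 g.
Proof.
by move=> fg; apply: eq_Rintegral => t; rewrite inE RplusE => /fg ->.
Qed.

Lemma L2D f g : L2 f -> L2 g -> L2 (fun t => f t + g t).
Proof.
move=> /L2P[mf jf] /L2P[mg jg]; apply/L2P; split; first exact: cmeasurableD.
apply: (@integrable_le _ _ _ (fun t => 2 * normc (f t) ^+ 2 + 2 * normc (g t) ^+ 2)) => //.
- by apply: measurable_sqr_normc => //; exact: cmeasurableD.
- by move=> t _; rewrite ger0_norm ?sqr_ge0//; exact: normc_sqrD.
- by apply: integrableDr => //; exact: integrableZr.
Qed.

Lemma L2Z (a : R[i]) f : L2 f -> L2 (fun t => a * f t).
Proof.
move=> /L2P[mf jf]; apply/L2P; split.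
  by apply: cmeasurableM => //; exact: cmeasurable_cst.
apply: (@integrable_ext _ _ (fun t => normc a ^+ 2 * normc (f t) ^+ 2)) => //.
  by move=> t _; rewrite Normc.normcM exprMn.
exact: integrableZr.
Qed.

Lemma L2_lin (a : R[i]) f g : L2 f -> L2 g -> L2 (fun t => a * f t + g t).
Proof. by move=> hf hg; apply: L2D => //; exact: L2Z. Qed.

Lemma L2_sub f g : L2 f -> L2 g -> L2 (fun t => f t - g t).
Proof.
move=> hf hg; apply: L2_ext (L2_lin (-1) hg hf) => t _.
by rewrite mulN1r addrC.
Qed.

Lemma L2_0 : L2 (fun=> 0 : R[i]).
Proof.
apply/L2P; split; first exact: cmeasurable_cst.
apply: (@integrable_ext _ _ (fun=> 0)) => //; last exact: integrable0.
by move=> t _; rewrite Normc.normc0 expr0n.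
Qed.

Lemma L2_conj f : L2 f -> L2 (fun t => conjc (f t)).
Proof.
move=> /L2P[mf jf]; apply/L2P; split; first exact: cmeasurable_conj.
by apply: integrable_ext jf => // t _; rewrite normc_conj.
Qed.

Lemma L2M_int f g : L2 f -> L2 g -> cintegrable Rp (fun t => f t * g t).
Proof.
move=> /L2P[mf jf] /L2P[mg jg].
apply: (@cintegrable_le _ _ _ (fun t => normc (f t) ^+ 2 + normc (g t) ^+ 2)) => //.
- exact: cmeasurableM.
- move=> t _; rewrite Normc.normcM.
  have := sqr_ge0 (normc (f t) - normc (g t)); have := sqr_ge0 (normc (f t) + normc (g t)).
  by nra.
- exact: integrableDr.
Qed.

(** The quadratic polynomial x -> N2 (x |f| - |g|) is nonnegative; it is
    evaluated at its minimum, or far out when it is affine. *)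
Lemma cauchy_schwarz_norm f g : L2 f -> L2 g ->
  (\int[mu]_(t in Rp) (normc (f t) * normc (g t))) ^+ 2 <= N2 f * N2 g.
Proof.
move=> hf hg; have jf := L2_int hf; have jg := L2_int hg.
have jfg : mu.-integrable Rp (EFin \o (fun t => normc (f t) * normc (g t))).
  apply: integrable_ext (integrable_normc _ (L2M_int hf hg)) => // t _.
  by rewrite Normc.normcM.
set c := Rintegral _ _ _.
have pos x : 0 <= x ^+ 2 * N2 f - 2 * x * c + N2 g.
  rewrite /N2 /c -!RintegralZl// -RintegralB//; [|exact: integrableZr..].
  rewrite -RintegralD//; last first.
    have := integrableDr measurable_Rplus (integrableZr (x ^+ 2) measurable_Rplus jf)
      (integrableZr (- (2 * x)) measurable_Rplus jfg).
    by apply: integrable_ext => // t _; rewrite mulNr.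
  apply: Rintegral_ge0 => t _.
  rewrite (_ : _ + _ = (x * normc (f t) - normc (g t)) ^+ 2) ?sqr_ge0//.
  by ring.
have a0 := N2_ge0 f; have b0 := N2_ge0 g.
move: a0; rewrite le_eqVlt => /predU1P[a0|a0].
  rewrite -a0 mul0r; have [->|c0] := eqVneq c 0; first by rewrite expr0n.
  have := pos ((N2 g + 1) / c); rewrite -a0 mulr0 add0r.
  by rewrite -mulrA (_ : _ / c * c = N2 g + 1) ?divfK//; lra.
have := pos (c / N2 f).
rewrite (_ : _ + _ = N2 g - c ^+ 2 / N2 f); last by field; rewrite gt_eqF.
by rewrite subr_ge0 ler_pdivrMr// mulrC.
Qed.

Lemma cauchy_schwarz f g : L2 f -> L2 g ->
  normc (cintegral Rp (fun t => f t * g t)) ^+ 2 <= N2 f * N2 g.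
Proof.
move=> hf hg; apply: le_trans (cauchy_schwarz_norm hf hg).
rewrite lerXn2r ?nnegrE ?normc_ge0//.
  by apply: Rintegral_ge0 => t _; rewrite mulr_ge0 ?normc_ge0.
apply: normc_cintegral_le => //; first exact: L2M_int.
  by move=> t _; rewrite Normc.normcM.
apply: integrable_ext (integrable_normc _ (L2M_int hf hg)) => // t _.
by rewrite Normc.normcM.
Qed.

(** Pointwise convergence under domination gives approximation in mean square,
    because |u - u_n|^2 <= 4 v^2. The density argument makes
    all its approximations in this way. *)
Lemma dominated_L2 (u_ : nat -> R -> R) (u v : R -> R) :
  (forall n, measurable_fun (Rp : set TR) (u_ n)) ->
  (forall t, 0 <= t -> u_ ^~ t @ \oo --> u t) ->
  (forall n t, 0 <= t -> `|u_ n t| <= v t) ->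
  mu.-integrable Rp (EFin \o (fun t => v t ^+ 2)) ->
  [/\ measurable_fun (Rp : set TR) u, (forall t, 0 <= t -> `|u t| <= v t) &
  forall e, 0 < e -> exists n, N2 (fun t => (u t)%:C - (u_ n t)%:C) < e].
Proof.
move=> mu_ uu uv iv.
have mu0 : measurable_fun (Rp : set TR) u.
  by apply: (measurable_fun_cvg mu_) => t; rewrite RplusE => /uu.
have uv0 t : 0 <= t -> `|u t| <= v t.
  move=> t0; have /cvg_norm := uu t t0.
  move=> /(cvg_lim (@norm_hausdorff _ _)) <-; apply: limr_le.
    by apply: is_cvg_norm; apply/cvg_ex; exists (u t); exact: uu.
  by apply: nearW => n; exact: uv.
split=> // e e0.
have i4 : mu.-integrable Rp (EFin \o (fun t => 4 * v t ^+ 2)) by exact: integrableZr.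
have [|||//||_ _ H] := @dominated_convergence _ TR R mu Rp measurable_Rplus
  (fun n => EFin \o (fun t => (u t - u_ n t) ^+ 2)) (fun=> 0%E) (EFin \o (fun t => 4 * v t ^+ 2)).
- by move=> n; apply/measurable_EFinP/measurable_funX/measurable_funB.
- exact: measurable_cst.
- apply: aeW => t; rewrite RplusE => t0; apply: cvg_EFin; first exact: nearW.
  rewrite /= (_ : 0%R = (u t - u t) ^+ 2); last by rewrite subrr expr0n.
  apply: (@cvg_comp _ _ _ (fun n => u t - u_ n t) (fun x => x ^+ 2) \oo (nbhs (u t - u t))).
    by apply: cvgB; [exact: cvg_cst|exact: uu].
  exact: exprn_continuous.
- apply: aeW => t n; rewrite RplusE => t0 /=; rewrite lee_fin ger0_norm ?sqr_ge0//.
  have := uv0 t t0; have := uv n t t0; rewrite !ler_norml => /andP[a1 a2] /andP[a3 a4].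
  have v0 : 0 <= v t by apply: le_trans (uv0 t t0).
  rewrite -subr_ge0 (_ : _ - _ = (2 * v t - (u t - u_ n t)) * (2 * v t + (u t - u_ n t))); last by ring.
  by rewrite mulr_ge0//; lra.
rewrite integral0 in H.
have {}H : (fun n => \int[mu]_(t in Rp) ((u t - u_ n t) ^+ 2))%R @ \oo --> (0 : R).
  exact: (@fine_cvg _ _ _ _ (fun n => (\int[mu]_(t in Rp) ((u t - u_ n t) ^+ 2)%:E)%E)).
move/cvgrPdist_lt : H => /(_ _ e0)[n _ /(_ n (leqnn n))] /=.
rewrite sub0r normrN => H; exists n; apply: le_lt_trans H; apply: le_trans (ler_norm _).
rewrite le_eqVlt; apply/orP; left; apply/eqP; apply: eq_Rintegral => t _.
by rewrite -rmorphB normcR real_normK// num_real.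
Qed.

End SquareIntegrable.
#[export] Hint Resolve measurable_Rplus : core.

(** * The complex exponential, and differentiation along the real line *)
Section ComplexExponential.
Variable R : realType.
Implicit Types (z w : R[i]) (t x : R).

Lemma cexpD z w : cexp (z + w) = cexp z * cexp w.
Proof.
rewrite /cexp Re_add Im_add expRD cosD sinD; apply: complex_eqP;
  rewrite !(Re_mul, Im_mul, Re_mulr, Im_mulr) /=; ring.
Qed.

Lemma cexp0 : cexp (0 : R[i]) = 1.
Proof. by rewrite /cexp /= expR0 cos0 sin0; apply: complex_eqP; rewrite /=; ring. Qed.

Lemma Re_cexp z : Re (cexp z) = expR (Re z) * cos (Im z).
Proof. by rewrite Re_mulr. Qed.

Lemma Im_cexp z : Im (cexp z) = expR (Re z) * sin (Im z).
Proof. by rewrite Im_mulr. Qed.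

Lemma normc_cexp z : normc (cexp z) = expR (Re z).
Proof.
rewrite /cexp Normc.normcM normcR ger0_norm ?expR_ge0//.
rewrite (_ : normc _ = 1) ?mulr1//= cos2Dsin2 sqrtr1//.
Qed.

Lemma cexp_neq0 z : cexp z != 0.
Proof. by rewrite -normc_eq0 normc_cexp expR_eq0. Qed.

Lemma cexpN z : cexp (- z) = (cexp z)^-1.
Proof.
apply: (mulfI (cexp_neq0 z)); rewrite -cexpD subrr cexp0 divff//.
exact: cexp_neq0.
Qed.

Lemma cexpR x : cexp x%:C = (expR x)%:C.
Proof. by apply: complex_eqP; rewrite ?Re_cexp ?Im_cexp /= ?cos0 ?sin0 ?mulr1 ?mulr0. Qed.

Lemma cisE t : cis t = cexp ('i%C * t%:C).
Proof.
have [h1 h2] : Re ('i%C * t%:C) = 0 /\ Im ('i%C * t%:C) = t.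
  by split; rewrite ?Re_mul ?Im_mul /=; ring.
by rewrite /cexp h1 h2 expR0 mul1r.
Qed.

Lemma normc_cis t : normc (cis t) = 1.
Proof. by rewrite /= cos2Dsin2 sqrtr1. Qed.

Lemma cis_neq0 t : cis t != 0.
Proof. by rewrite -normc_eq0 normc_cis oner_eq0. Qed.

(** Derivability along the real line, by components: the fundamental theorem of
    calculus and the mean value theorem are applied to real and imaginary parts. *)
Definition is_cderive (g : R -> R[i]) t (d : R[i]) :=
  is_derive t (1 : R) (fun x => Re (g x)) (Re d) /\
  is_derive t (1 : R) (fun x => Im (g x)) (Im d).

Lemma is_cderive_eq g t d d' : is_cderive g t d -> d = d' -> is_cderive g t d'.
Proof. by move=> + <-. Qed.

Lemma is_derive_ext (f g : R -> R) t d : f =1 g -> is_derive t (1:R) f d -> is_derive t (1:R) g d.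
Proof. by move=> /funext ->. Qed.

Lemma is_derive_to (f g : R -> R) t d d' : is_derive t (1:R) f d ->
  f =1 g -> d = d' -> is_derive t (1:R) g d'.
Proof. by move=> h /funext <- <-. Qed.

Lemma is_derive_expMl (a : R) t :
  is_derive t (1:R) (fun x => expR (a * x)) (a * expR (a * t)).
Proof.
have h : is_derive t (1:R) (fun x => a * x) a.
  apply: is_derive_to (is_deriveZ a (is_derive_id t (1:R))) _ _ => //.
  by rewrite /GRing.scale /= mulr1.
rewrite mulrC.
exact: (@is_derive1_comp _ expR (fun x => a * x) t _ _ (is_derive_expR _) h).
Qed.

Lemma is_cderive_ext g h t d : g =1 h -> is_cderive g t d -> is_cderive h t d.
Proof. by move=> /funext ->. Qed.

Lemma is_cderive_cst (a : R[i]) t : is_cderive (fun=> a) t 0.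
Proof. by split; [exact: (is_derive_cst (Re a) t 1)|exact: (is_derive_cst (Im a) t 1)]. Qed.

Lemma is_cderiveR (f : R -> R) t d : is_derive t (1:R) f d -> is_cderive (fun x => (f x)%:C) t d%:C.
Proof. by move=> h; split => //=; exact: (is_derive_cst (0 : R) t 1). Qed.

Lemma is_cderiveD g h t d e : is_cderive g t d -> is_cderive h t e ->
  is_cderive (fun x => g x + h x) t (d + e).
Proof.
move=> [g1 g2] [h1 h2]; split.
  by rewrite Re_add; apply: is_derive_ext (is_deriveD g1 h1) => x; rewrite Re_add.
by rewrite Im_add; apply: is_derive_ext (is_deriveD g2 h2) => x; rewrite Im_add.
Qed.

Lemma is_cderiveM g h t d e : is_cderive g t d -> is_cderive h t e ->
  is_cderive (fun x => g x * h x) t (d * h t + g t * e).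
Proof.
move=> [g1 g2] [h1 h2]; split.
  apply: is_derive_ext (is_derive_eq (is_deriveB (is_deriveM g1 h1) (is_deriveM g2 h2)) _).
    by move=> x; rewrite Re_mul.
  by rewrite Re_add !Re_mul /GRing.scale /=; ring.
apply: is_derive_ext (is_derive_eq (is_deriveD (is_deriveM g1 h2) (is_deriveM g2 h1)) _).
  by move=> x; rewrite Im_mul.
by rewrite Im_add !Im_mul /GRing.scale /=; ring.
Qed.

Lemma is_cderiveZ (a : R[i]) g t d : is_cderive g t d ->
  is_cderive (fun x => a * g x) t (a * d).
Proof.
move=> hg; apply: is_cderive_eq (is_cderiveM (is_cderive_cst a t) hg) _.
by rewrite mul0r add0r.
Qed.

Lemma is_cderive_sum I (s : seq I) (F : I -> R -> R[i]) (d : I -> R[i]) t :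
  (forall i, is_cderive (F i) t (d i)) ->
  is_cderive (fun x => \sum_(i <- s) F i x) t (\sum_(i <- s) d i).
Proof.
move=> h; elim: s => [|i s IH].
  by rewrite big_nil; apply: is_cderive_ext (is_cderive_cst 0 t) => x; rewrite big_nil.
by rewrite big_cons; apply: is_cderive_ext (is_cderiveD (h i) IH) => x; rewrite big_cons.
Qed.

Lemma is_cderive_cexp g t d : is_cderive g t d ->
  is_cderive (fun x => cexp (g x)) t (d * cexp (g t)).
Proof.
move=> [g1 g2].
have e1 : is_derive t (1:R) (fun x => expR (Re (g x))) (expR (Re (g t)) * Re d).
  exact: (@is_derive1_comp _ expR (fun x => Re (g x)) t _ _ (is_derive_expR _) g1).
have c2 : is_derive t (1:R) (fun x => cos (Im (g x))) (- sin (Im (g t)) * Im d).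
  exact: (@is_derive1_comp _ cos (fun x => Im (g x)) t _ _ (is_derive_cos _) g2).
have s2 : is_derive t (1:R) (fun x => sin (Im (g x))) (cos (Im (g t)) * Im d).
  exact: (@is_derive1_comp _ sin (fun x => Im (g x)) t _ _ (is_derive_sin _) g2).
split.
  apply: is_derive_ext (is_derive_eq (is_deriveM e1 c2) _).
    by move=> x; rewrite Re_cexp.
  by rewrite Re_mul Re_cexp Im_cexp /GRing.scale /=; ring.
apply: is_derive_ext (is_derive_eq (is_deriveM e1 s2) _).
  by move=> x; rewrite Im_cexp.
by rewrite Im_mul Re_cexp Im_cexp /GRing.scale /=; ring.
Qed.

Lemma is_derive_continuous (f : R -> R) t d : is_derive t (1:R) f d -> {for t, continuous f}.
Proof. by move=> h; apply/differentiable_continuous/derivable1_diffP. Qed.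

Lemma is_cderive_measurable (D : set R) g (d : R -> R[i]) :
  (forall t, is_cderive g t (d t)) -> cmeasurable D g.
Proof.
move=> h; split; apply: measurable_funTS; apply: continuous_measurable_fun => t;
  have [h1 h2] := h t; exact: is_derive_continuous.
Qed.

End ComplexExponential.

(** * Exponential moments on the half line *)
Section Moments.
Variable R : realType.
Notation mu := (@lebesgue_measure R).
Notation TR := (measurableTypeR R).
Notation Rp := (@Rplus R).

(** By induction on the polynomial, giving half of the exponent to the new
    factor t. *)
Lemma poly_le_exp (p : {poly R}) (d : R) : 0 < d ->
  exists2 C, 0 <= C & forall t, 0 <= t -> `|p.[t]| <= C * expR (d * t).
Proof.
elim/poly_ind: p d => [|p c IH] d d0.
  by exists 0 => // t t0; rewrite horner0 normr0 mul0r.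
have d20 : 0 < d / 2 by rewrite divr_gt0.
have [C C0 hC] := IH _ d20; exists (C * (2 / d) + `|c|).
  by rewrite addr_ge0// mulr_ge0// divr_ge0// ltW.
move=> t t0; rewrite hornerMXaddC; apply: le_trans (ler_normD _ _) _.
rewrite mulrDl lerD//; last first.
  by rewrite ler_peMr// -expR0 ler_expR mulr_ge0// ltW.
rewrite normrM (ger0_norm t0).
have h : t <= 2 / d * expR (d / 2 * t).
  rewrite -ler_pdivrMl ?divr_gt0// invf_div.
  by apply: le_trans (expR_ge1Dx _); rewrite lerDr.
apply: le_trans (ler_pM _ _ (hC t t0) h) _ => //.
rewrite (_ : d * t = d / 2 * t + d / 2 * t); last by field.
by rewrite expRD le_eqVlt; apply/orP; left; apply/eqP; ring.
Qed.

Lemma cvg_expR_ninfty (a C : R) : 0 < a -> C * expR (- a * t) @[t --> +oo] --> (0 : R).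
Proof.
move=> a0; rewrite -[X in _ --> X](mulr0 C); apply: cvgM; first exact: cvg_cst.
have h1 : (fun t => a * t) @ +oo --> +oo.
  apply/cvgryPge => A; near=> t.
  by rewrite -ler_pdivrMl//; near: t; exact: nbhs_pinfty_ge.
have := @cvg_comp _ _ _ (fun t => a * t) (fun x => expR (- x)) _ _ _ h1 (@cvgr_expR R).
rewrite /comp.
by under [in X in X -> _]eq_fun do rewrite -mulNr.
Unshelve. all: by end_near. Qed.

(** A signed function dominated by an exponential is a difference of
    nonnegative ones with explicit primitives, to which the fundamental theorem
    on the half line applies. *)
Lemma FTC_exp_dominated (u F : R -> R) (a C : R) : 0 < a ->
  (forall t, is_derive t (1:R) F (u t)) -> continuous u ->
  (forall t, 0 <= t -> `|u t| <= C * expR (- a * t)) ->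
  F t @[t --> +oo] --> (0 : R) ->
  mu.-integrable Rp (EFin \o u) /\ \int[mu]_(t in Rp) u t = - F 0.
Proof.
move=> a0 dF cu uC F0.
pose w t := C * expR (- a * t); pose W t := - (C / a) * expR (- a * t).
have C0 : 0 <= C.
  by have := uC 0 (lexx _); rewrite mulr0 expR0 mulr1; apply: le_trans.
have w0 t : 0 <= w t by rewrite mulr_ge0// expR_ge0.
have dW t : is_derive t (1:R) W (w t).
  apply: is_derive_to (is_deriveZ (- (C / a)) (is_derive_expMl (- a) t)) _ _ => //.
  by rewrite /GRing.scale /= /w; field; rewrite gt_eqF.
have cw : continuous w.
  move=> t; apply: cvgM; first exact: cvg_cst.
  apply: (@continuous_comp _ _ _ (fun x => - a * x) expR); last exact: continuous_expR.
  by apply: mulrl_continuous.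
have W0 : W t @[t --> +oo] --> (0 : R) by exact: cvg_expR_ninfty.
have key (v V : R -> R) : (forall t, 0 <= t -> 0 <= v t) -> continuous v ->
    (forall t, is_derive t (1:R) V (v t)) -> V t @[t --> +oo] --> (0 : R) ->
    mu.-integrable Rp (EFin \o v) /\ \int[mu]_(t in Rp) v t = - V 0.
  move=> v0 cv dV V0.
  have E : (\int[mu]_(t in Rp) (v t)%:E = 0%:E - (V 0)%:E)%E.
    apply: ge0_continuous_FTC2y => //.
    - exact: continuous_subspaceT.
    - by apply: cvg_at_right_filter; exact: is_derive_continuous.
    - by move=> t _; rewrite derive1E; apply: derive_val.
  split; last by rewrite /Rintegral E -EFinB /= sub0r.
  apply/integrableP; split.
    by apply/measurable_EFinP; apply: measurable_funTS; exact: continuous_measurable_fun.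
  rewrite (_ : \int[mu]_(t in Rp) _ = \int[mu]_(t in Rp) (v t)%:E)%E; last first.
    by apply: eq_integral => t; rewrite inE RplusE => t0 /=; rewrite ger0_norm ?v0.
  by rewrite E ltry.
have [iw Ew] := key w W (fun t _ => w0 t) cw dW W0.
have [iuw Euw] : mu.-integrable Rp (EFin \o (fun t => u t + w t)) /\
    \int[mu]_(t in Rp) (u t + w t) = - (F 0 + W 0).
  apply: (key (fun t => u t + w t) (fun t => F t + W t)).
  - by move=> t /uC; rewrite ler_norml => /andP[h _]; rewrite -lerBlDr sub0r.
  - by move=> t; apply: cvgD; [exact: cu|exact: cw].
  - by rewrite -[X in _ --> X](addr0 0); exact: cvgD.
have iu : mu.-integrable Rp (EFin \o u).
  have h1 := integrableZr (-1) (@measurable_Rplus R) iw.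
  have h2 := integrableDr (@measurable_Rplus R) iuw h1.
  apply: integrable_ext h2 => //.
  by move=> t _; rewrite mulN1r addrK.
by split=> //; move: Euw; rewrite RintegralD// Ew opprD => /addIr.
Qed.

Lemma integrable_expR (a C : R) : 0 < a ->
  mu.-integrable Rp (EFin \o (fun t => C * expR (- a * t))).
Proof.
move=> a0; apply: integrableZr => //.
have d2 t : is_derive t (1:R) (fun x => - a^-1 * expR (- a * x)) (expR (- a * t)).
  apply: is_derive_to (is_deriveZ (- a^-1) (is_derive_expMl (- a) t)) _ _ => //.
  by rewrite /GRing.scale /=; field; rewrite gt_eqF.
apply: (proj1 (@FTC_exp_dominated (fun t => expR (- a * t))
  (fun x => - a^-1 * expR (- a * x)) a 1 a0 d2 _ _ _)).
- by move=> t; exact: (is_derive_continuous (is_derive_expMl (- a) t)).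
- by move=> t t0; rewrite mul1r ger0_norm// expR_ge0.
- exact: cvg_expR_ninfty.
Qed.

Lemma cFTC_exp_dominated (g d e : R -> R[i]) (a C : R) : 0 < a ->
  (forall t, is_cderive g t (d t)) -> (forall t, is_cderive d t (e t)) ->
  (forall t, 0 <= t -> normc (d t) <= C * expR (- a * t)) ->
  (forall t, 0 <= t -> normc (g t) <= C * expR (- a * t)) ->
  cintegrable Rp d /\ cintegral Rp d = - g 0.
Proof.
move=> a0 dg dd hd hg.
have cvg0 (p : R -> R) : (forall t, 0 <= t -> `|p t| <= C * expR (- a * t)) ->
    p t @[t --> +oo] --> (0 : R).
  move=> hp; apply/norm_cvg0P.
  apply: (@squeeze_cvgr _ _ _ _ (fun=> 0) (fun t => C * expR (- a * t))).
  - near=> t; rewrite normr_ge0 /= hp//; near: t; exact: nbhs_pinfty_ge.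
  - exact: cvg_cst.
  - exact: cvg_expR_ninfty.
have [||||i1 E1] := @FTC_exp_dominated (fun t => Re (d t)) (fun t => Re (g t)) a C a0.
- by move=> t; have [] := dg t.
- by move=> t; have [h _] := dd t; exact: is_derive_continuous.
- by move=> t /hd; apply: le_trans; exact: normc_geRe.
- by apply: cvg0 => t /hg; apply: le_trans; exact: normc_geRe.
have [||||i2 E2] := @FTC_exp_dominated (fun t => Im (d t)) (fun t => Im (g t)) a C a0.
- by move=> t; have [] := dg t.
- by move=> t; have [_ h] := dd t; exact: is_derive_continuous.
- by move=> t /hd; apply: le_trans; exact: normc_geIm.
- by apply: cvg0 => t /hg; apply: le_trans; exact: normc_geIm.
split=> //; apply: complex_eqP; rewrite ?Re_opp ?Im_opp //=.
Unshelve. all: by end_near. Qed.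

(** Its integral over the half line is the Laplace transform of p at al. *)
Definition pexp (p : {poly R}) (al : R[i]) : R -> R[i] :=
  fun t => (p.[t])%:C * cexp (- (t%:C * al)).

Lemma is_cderive_pexp p al t :
  is_cderive (pexp p al) t (pexp p^`() al t - al * pexp p al t).
Proof.
have h1 := is_cderiveR (is_derive_poly p t).
have h2 : is_cderive (fun x => - (x%:C * al)) t (- al).
  have h := is_cderiveM (is_cderiveR (is_derive_id t (1:R))) (is_cderive_cst (- al) t).
  apply: is_cderive_ext (is_cderive_eq h _); first by move=> x; rewrite mulrN.
  by rewrite mulr0 addr0 mul1r.
apply: is_cderive_eq (is_cderiveM h1 (is_cderive_cexp h2)) _.
by rewrite /pexp; ring.
Qed.

Lemma normc_pexp p al t : normc (pexp p al t) = `|p.[t]| * expR (- (Re al) * t).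
Proof.
by rewrite Normc.normcM normcR normc_cexp Re_opp Re_mulr mulNr [t * _]mulrC.
Qed.

Lemma pexp_le p al : 0 < Re al ->
  exists2 C, 0 <= C & forall t, 0 <= t -> normc (pexp p al t) <= C * expR (- (Re al / 2) * t).
Proof.
move=> a0; have a20 : 0 < Re al / 2 by rewrite divr_gt0.
have [C C0 hC] := poly_le_exp p a20; exists C => // t t0.
rewrite normc_pexp; apply: le_trans (ler_wpM2r (expR_ge0 _) (hC t t0)) _.
rewrite -mulrA -expRD ler_wpM2l// ler_expR.
by rewrite le_eqVlt; apply/orP; left; apply/eqP; field.
Qed.

Lemma cintegrable_pexp p al : 0 < Re al -> cintegrable Rp (pexp p al).
Proof.
move=> a0; have [C C0 hC] := pexp_le p a0.
apply: (@cintegrable_le _ _ _ (fun t => C * expR (- (Re al / 2) * t))) => //.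
- exact: is_cderive_measurable (is_cderive_pexp p al).
- by move=> t; rewrite RplusE => /hC.
- by apply: integrable_expR; rewrite divr_gt0.
Qed.

(** Integration by parts: pexp p al has derivative pexp p' al - al * pexp p al
    and vanishes at infinity. *)
Lemma moment_deriv p al : 0 < Re al ->
  cintegral Rp (pexp p^`() al) = al * cintegral Rp (pexp p al) - (p.[0])%:C.
Proof.
move=> a0; have a20 : 0 < Re al / 2 by rewrite divr_gt0.
have [C C0 hC] := pexp_le p a0; have [C' C'0 hC'] := pexp_le p^`() a0.
have [||| _] := @cFTC_exp_dominated (pexp p al) _
  (fun t => (pexp p^`()^`() al t - al * pexp p^`() al t) - al * (pexp p^`() al t - al * pexp p al t))
  (Re al / 2) (C' + (normc al + 1) * C) a20 (is_cderive_pexp p al).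
- move=> t; have h1 := is_cderive_pexp p^`() al t.
  have h2 := is_cderiveZ (- al) (is_cderive_pexp p al t).
  apply: is_cderive_ext (is_cderive_eq (is_cderiveD h1 h2) _); last by rewrite mulNr.
  by move=> x; rewrite mulNr.
- move=> t t0; apply: le_trans (normcD _ _) _; rewrite normcNN (Normc.normcM al).
  set E := expR _; have E0 : 0 <= E by exact: expR_ge0.
  rewrite (_ : (C' + (normc al + 1) * C) * E = C' * E + (normc al + 1) * (C * E)); last by ring.
  rewrite lerD ?hC'//.
  apply: le_trans (ler_wpM2l (normc_ge0 _) (hC t t0)) _.
  by rewrite ler_wpM2r ?mulr_ge0// lerDl.
- move=> t t0; apply: le_trans (hC t t0) _; rewrite ler_wpM2r ?expR_ge0//.
  have := normc_ge0 al; nra.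
rewrite cintegralB//; [|exact: cintegrable_pexp|by apply: cintegrableZ => //; exact: cintegrable_pexp].
rewrite cintegralZ//; last exact: cintegrable_pexp.
move=> /eqP; rewrite subr_eq => /eqP ->; rewrite addrC; congr (_ - _).
by rewrite /pexp mul0r oppr0 cexp0 mulr1.
Qed.

End Moments.

(** * Density of exponentials *)
Section Density.
Variable R : realType.
Notation mu := (@lebesgue_measure R).
Notation TR := (measurableTypeR R).
Notation Rp := (@Rplus R).
Implicit Types (f g h : R -> R[i]) (N : set (R -> R[i])).

Definition lin_closed N := forall (a : R[i]) f g, L2 f -> L2 g -> N f -> N g ->
  N (fun t => a * f t + g t).

(** Closedness for the mean square distance, stated on representatives so that
    the quotient by almost everywhere equality need not be formed. *)
Definition N2_closed N := forall f, L2 f ->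
  (forall e, 0 < e -> exists g, [/\ L2 g, N g & N2 (fun t => f t - g t) < e]) -> N f.

Lemma N2_0 (f : R -> R[i]) : (forall t, 0 <= t -> f t = 0) -> N2 f = 0.
Proof.
move=> h; rewrite (@N2_ext _ f (fun=> 0)) // /N2.
rewrite (_ : Rintegral _ _ _ = \int[mu]_(t in Rp) (0 : R)).
  by rewrite /Rintegral integral0.
by apply: eq_Rintegral => t _; rewrite Normc.normc0 expr0n.
Qed.

Section Closed.
Variable N : set (R -> R[i]).
Hypotheses (linN : lin_closed N) (closN : N2_closed N).

Let NR (u : R -> R) := L2 (fun t => (u t)%:C) /\ N (fun t => (u t)%:C).

Lemma closed_ext f g : (forall t, 0 <= t -> f t = g t) -> L2 f -> N f -> N g.
Proof.
move=> fg Lf Nf; apply: closN; first exact: L2_ext Lf.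
by move=> e e0; exists f; split => //; rewrite N2_0// => t /fg ->; rewrite subrr.
Qed.

Lemma closedR_ext u v : (forall t, 0 <= t -> u t = v t) -> NR u -> NR v.
Proof.
move=> uv [L1 N1]; split; first by apply: L2_ext L1 => t /uv ->.
by apply: closed_ext L1 N1 => t /uv ->.
Qed.

Lemma closed0 f : L2 f -> N f -> NR (fun=> 0).
Proof.
move=> Lf Nf; split; first exact: L2_0.
have := linN (-1) Lf Lf Nf Nf; apply: closed_ext; last exact: L2_lin.
by move=> t _; rewrite mulN1r addNr.
Qed.

Lemma closedR_lin (a : R) u v : NR u -> NR v -> NR (fun t => a * u t + v t).
Proof.
move=> [L1 N1] [L3 N3]; split.
  by apply: L2_ext (L2_lin a%:C L1 L3) => t _; rewrite realCD realCM.
apply: closed_ext (linN a%:C L1 L3 N1 N3); last exact: L2_lin.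
by move=> t _; rewrite realCD realCM.
Qed.

Lemma closedR_sum (F : nat -> R -> R) (a : nat -> R) n :
  (forall i, NR (F i)) -> NR (fun t => \sum_(0 <= i < n) a i * F i t).
Proof.
move=> h; elim: n => [|n IH].
  have [L1 N1] := h 0%N.
  by apply: closedR_ext (closed0 L1 N1) => t _; rewrite big_geq.
apply: closedR_ext (closedR_lin (a n) (h n) IH) => t _.
by rewrite big_nat_recr //= addrC.
Qed.

Lemma closedR_dominated (u_ : nat -> R -> R) (u v : R -> R) :
  (forall n, NR (u_ n)) ->
  (forall t, 0 <= t -> u_ ^~ t @ \oo --> u t) ->
  (forall n t, 0 <= t -> `|u_ n t| <= v t) ->
  mu.-integrable Rp (EFin \o (fun t => v t ^+ 2)) -> NR u.
Proof.
move=> Nu uu uv iv.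
have mu_ n : measurable_fun (Rp : set TR) (u_ n).
  by have [/L2_meas[]] := Nu n.
have [m0 uv0 H] := dominated_L2 mu_ uu uv iv.
have Lu : L2 (fun t => (u t)%:C).
  apply: (L2_dom _ _ iv); first exact: cmeasurableR.
  by move=> t t0; rewrite normcR uv0.
split=> //; apply: closN => // e /H[n he].
by exists (fun t => (u_ n t)%:C); have [? ?] := Nu n.
Qed.

Lemma integrable_sqr_expR (a C : R) : 0 < a ->
  mu.-integrable Rp (EFin \o (fun t => (C * expR (- a * t)) ^+ 2)).
Proof.
move=> a0; have a20 : 0 < 2 * a by rewrite mulr_gt0.
have := integrable_expR (C ^+ 2) a20.
apply: integrable_ext => // t _; rewrite exprMn; congr (_ * _).
by rewrite expr2 -expRD; congr expR; ring.
Qed.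

Lemma expR_series_bound (x : R) n : 0 <= x -> \sum_(0 <= i < n) x ^+ i / i`!%:R <= expR x.
Proof.
move=> x0; have := nondecreasing_cvgn_le _ (@is_cvg_series_exp_coeff _ x) n.
apply; apply/nondecreasing_seqP => m; rewrite /series /= big_nat_recr //= lerDl.
by rewrite /exp_coeff /= divr_ge0// exprn_ge0.
Qed.

Lemma expR_series_norm_bound (x : R) n :
  `|\sum_(0 <= i < n) x ^+ i / i`!%:R| <= expR `|x|.
Proof.
apply: le_trans (ler_norm_sum _ _ _) _; apply: le_trans (expR_series_bound n (normr_ge0 x)).
rewrite le_eqVlt; apply/orP; left; apply/eqP; apply: eq_bigr => i _.
by rewrite normrM normrX normfV (@ger0_norm _ i`!%:R).
Qed.

Lemma cvg_expR_series (x : R) : (fun n => \sum_(0 <= i < n) x ^+ i / i`!%:R) @ \oo --> expR x.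
Proof. exact: is_cvg_series_exp_coeff. Qed.

(** The factor exp(-t/2) is expanded in powers of t: the partial sums are
    dominated by exp(t/2), which the decay exp(-ct), c >= 1, absorbs. *)
Lemma closed_exp_step (c : R) : 1 <= c ->
  (forall k, NR (fun t => t ^+ k * expR (- c * t))) ->
  forall k, NR (fun t => t ^+ k * expR (- (c + 2^-1) * t)).
Proof.
move=> c1 H k.
have half0 : (0 : R) < 2^-1 by rewrite invr_gt0.
have c40 : (0 : R) < 4^-1 by rewrite invr_gt0.
have [C C0 hC] := poly_le_exp ('X^k : {poly R}) c40.
pose u_ n (t : R) := \sum_(0 <= i < n) ((- 2^-1) ^+ i / i`!%:R) * (t ^+ (k + i) * expR (- c * t)).
have uE n t : u_ n t = t ^+ k * expR (- c * t) * \sum_(0 <= i < n) (- 2^-1 * t) ^+ i / i`!%:R.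
  rewrite /u_ mulr_sumr; apply: eq_bigr => i _; rewrite exprD exprMn.
  by ring.
apply: (@closedR_dominated u_ _ (fun t => C * expR (- 4^-1 * t))).
- by move=> n; apply: closedR_sum => i; exact: H.
- move=> t t0; rewrite (_ : _ * _ = t ^+ k * expR (- c * t) * expR (- 2^-1 * t)).
    rewrite (_ : u_ ^~ t = (fun n => t ^+ k * expR (- c * t) * \sum_(0 <= i < n) (- 2^-1 * t) ^+ i / i`!%:R)).
      by apply: cvgM; [exact: cvg_cst|exact: cvg_expR_series].
    by apply/funext => n; exact: uE.
  by rewrite -mulrA -expRD; congr (_ * expR _); ring.
- move=> n t t0; rewrite uE normrM.
  apply: le_trans (ler_wpM2l (normr_ge0 _) (expR_series_norm_bound _ _)) _.
  rewrite normrM (ger0_norm (expR_ge0 _)) normrM normrN (ger0_norm (ltW half0)) (ger0_norm t0).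
  rewrite -mulrA -expRD.
  have := hC t t0; rewrite hornerXn => h.
  apply: le_trans (ler_wpM2r (expR_ge0 _) h) _.
  rewrite -mulrA -expRD ler_wpM2l// ler_expR.
  have : c * t >= t by rewrite ler_peMl.
  rewrite mulNr; lra.
- exact: integrable_sqr_expR.
Qed.

Hypothesis expN : forall k : nat, NR (fun t => expR (- (1 + k%:R) * t)).

(** The double exponential exp(-m exp(-nt)) is a power series in exp(-nt). *)
Lemma closed_double_exp (n : nat) (m : R) : 0 <= m ->
  NR (fun t => expR (- t) * expR (- m * expR (- n%:R * t))).
Proof.
move=> m0.
pose u_ k (t : R) := \sum_(0 <= i < k) ((- m) ^+ i / i`!%:R) * expR (- (1 + (n * i)%:R) * t).
have uE k t : u_ k t = expR (- t) * \sum_(0 <= i < k) (- m * expR (- n%:R * t)) ^+ i / i`!%:R.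
  rewrite /u_ mulr_sumr; apply: eq_bigr => i _; rewrite exprMn -expRM_natl.
  rewrite (_ : - (1 + (n * i)%:R) * t = - t + i%:R * (- n%:R * t)) ?expRD; first by ring.
  by rewrite natrM; ring.
apply: (@closedR_dominated u_ _ (fun t => expR m * expR (- 1 * t))).
- by move=> k; apply: closedR_sum => i; exact: expN.
- move=> t t0; rewrite (_ : u_ ^~ t = (fun k => expR (- t) * \sum_(0 <= i < k) (- m * expR (- n%:R * t)) ^+ i / i`!%:R)).
    by apply: cvgM; [exact: cvg_cst|exact: cvg_expR_series].
  by apply/funext => k; exact: uE.
- move=> k t t0; rewrite uE normrM (ger0_norm (expR_ge0 _)) mulN1r mulrC.
  rewrite ler_wpM2r ?expR_ge0//; apply: le_trans (expR_series_norm_bound _ _) _.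
  rewrite ler_expR normrM normrN (ger0_norm m0) (ger0_norm (expR_ge0 _)).
  by rewrite ler_piMr// expR_le1 mulNr oppr_le0 mulr_ge0.
- exact: integrable_sqr_expR.
Qed.

(** As n grows, exp(-n exp(n(a-t))) tends to 1 for t > a and to 0 for t <= a. *)
Lemma closed_ray (a : R) : NR (fun t => expR (- t) * \1_(`]a, +oo[) t).
Proof.
apply: (@closedR_dominated (fun n t => expR (- t) * expR (- (n%:R * expR (n%:R * a)) * expR (- n%:R * t))) _
  (fun t => 1 * expR (- 1 * t))).
- by move=> n; apply: closed_double_exp; rewrite mulr_ge0// expR_ge0.
- move=> t t0; apply: cvgM; first exact: cvg_cst.
  rewrite indicE mem_setE in_itv /= andbT.
  pose x (n : nat) : R := n%:R * expR (n%:R * (a - t)).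
  rewrite (_ : (fun n : nat => _) = (fun n => expR (- x n))); last first.
    apply/funext => n; rewrite /x (_ : n%:R * (a - t) = n%:R * a + - n%:R * t); last by ring.
    by rewrite expRD; congr expR; ring.
  have [at_|ta] := ltP a t.
    rewrite -expR0; apply: continuous_cvg; first exact: continuous_expR.
    rewrite -oppr0; apply: cvgN.
    have d0 : 0 < t - a by rewrite subr_gt0.
    (* from 1 + y^2/2 <= exp y with y = n(t-a) *)
    have hx n : 0 <= x n.+1 <= 2 / (t - a) ^+ 2 * n.+1%:R^-1.
      apply/andP; split; first by rewrite mulr_ge0// expR_ge0.
      rewrite /x -opprB mulrN expRN ler_pdivrMr ?expR_gt0//.
      have y0 : 0 <= n.+1%:R * (t - a) by rewrite mulr_ge0// ltW.
      have h := expR_ge1Dxn 1 y0.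
      have h2 : (n.+1%:R * (t - a)) ^+ 2 / 2 <= expR (n.+1%:R * (t - a)).
        by apply: le_trans h; rewrite lerDr.
      apply: le_trans (ler_wpM2l _ h2); last by rewrite mulr_ge0// ?divr_ge0 ?invr_ge0// sqr_ge0.
      rewrite le_eqVlt; apply/orP; left; apply/eqP.
      by field; rewrite nat1r pnatr_eq0 /= gt_eqF.
    rewrite -(cvg_shiftS x).
    apply: (@squeeze_cvgr _ _ _ _ (fun=> 0) (fun n => 2 / (t - a) ^+ 2 * n.+1%:R^-1)).
    + by apply: nearW.
    + exact: cvg_cst.
    + rewrite -[X in _ --> X](mulr0 (2 / (t - a) ^+ 2)); apply: cvgM; first exact: cvg_cst.
      exact: cvg_harmonic.
  apply: (@squeeze_cvgr _ _ _ _ (fun=> 0) (fun n : nat => expR (- n%:R))).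
  + apply: nearW => n; rewrite expR_ge0 /= ler_expR lerN2 /x.
    by rewrite ler_peMr// -expR0 ler_expR mulr_ge0// subr_ge0.
  + exact: cvg_cst.
  + exact: cvgn_expR.
- move=> n t t0; rewrite mul1r mulN1r normrM !(ger0_norm (expR_ge0 _)).
  by rewrite ler_piMr ?expR_ge0// expR_le1 mulNr oppr_le0 !mulr_ge0 ?expR_ge0.
- exact: integrable_sqr_expR.
Qed.

Lemma indic_partial_sum (F : (set R)^nat) (t : R) : trivIset setT F ->
  (forall n, 0 <= \sum_(0 <= i < n) (\1_(F i) t : R) <= 1) /\
  (fun n => \sum_(0 <= i < n) \1_(F i) t : R) @ \oo --> (\1_(\bigcup_i F i) t : R).
Proof.
move=> tF; have [[k _ Fkt]|nF] := pselect ((\bigcup_i F i) t).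
  have E n : \sum_(0 <= i < n) \1_(F i) t = ((k < n)%N)%:R :> R.
    elim: n => [|n IH]; first by rewrite big_geq.
    rewrite big_nat_recr //= IH indicE ltnS.
    have [->|nk] := eqVneq n k; first by rewrite ltnn add0r mem_set// leqnn.
    rewrite memNset ?addr0; first by rewrite (leq_eqVlt k n) (eq_sym k) (negbTE nk).
    move=> Fnt; have /trivIsetP/(_ n k Logic.I Logic.I nk) := tF.
    by apply/eqP/set0P; exists t.
  split; first by move=> n; rewrite E; case: (k < n)%N; rewrite ?lexx ?ler01.
  rewrite indicE mem_set; last by exists k.
  apply: cvg_near_cst; exists k.+1 => // n /= kn; rewrite E (_ : (k < n)%N) //.
have E n : \sum_(0 <= i < n) \1_(F i) t = 0 :> R.
  rewrite big1_seq// => i _; rewrite indicE memNset// => Fit; apply: nF.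
  by exists i.
split; first by move=> n; rewrite E lexx ler01.
by rewrite indicE memNset//; apply: cvg_near_cst; apply: nearW => n; rewrite E.
Qed.

(** The rays are stable under intersection and generate the Borel sets, and the
    family of good sets is a Dynkin system. *)
Lemma closed_indic (B : set R) : measurable (B : set TR) ->
  NR (fun t => expR (- t) * \1_B t).
Proof.
pose G : set (set R) := [set B | NR (fun t => expR (- t) * \1_B t)].
have closT : NR (fun t => expR (- t)).
  by apply: closedR_ext (expN 0%N) => t _; rewrite addr0 mulN1r.
have dG : dynkin G.
  split.
  - by apply: closedR_ext closT => t _; rewrite indicT mulr1.
  - move=> X GX; rewrite /G /=; apply: closedR_ext (closedR_lin (-1) GX closT) => t _.
    by rewrite indicC !indicE; case: (t \in X) => /=; ring.
  - move=> F tF GF; rewrite /G /=.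
    apply: (@closedR_dominated (fun n t => expR (- t) * \sum_(0 <= i < n) \1_(F i) t) _
      (fun t => 1 * expR (- 1 * t))).
    + move=> n; apply: closedR_ext (closedR_sum (fun=> 1) n GF) => t _.
      by rewrite mulr_sumr; apply: eq_bigr => i _; rewrite mul1r.
    + move=> t t0; apply: cvgM; first exact: cvg_cst.
      exact: (indic_partial_sum t tF).2.
    + move=> n t t0; have /andP[h0 h1] := (indic_partial_sum t tF).1 n.
      by rewrite mul1r mulN1r normrM !ger0_norm ?expR_ge0// ler_piMr ?expR_ge0.
    + exact: integrable_sqr_expR.
pose rays : set (set R) := [set A | exists x, A = `]x, +oo[%classic].
have raysI : setI_closed rays.
  move=> X Y [x ->] [y ->]; exists (Num.max x y); apply/seteqP; split => t /=;
    rewrite !in_itv /= !andbT gt_max; first by case=> -> ->.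
  by move=> /andP[].
move=> mB; have : (<<s rays >>) B.
  have : (@RGenOInfty.G R).-sigma.-measurable B by rewrite -RGenOInfty.measurableE.
  by [].
rewrite -(setI_closed_g_dynkin_g_sigma_algebra raysI).
move=> hB; have : G B by apply: hB; split => // X [x ->]; exact: closed_ray.
by [].
Qed.

(** h exp(t) is approximated from below by simple functions g_n, so that
    exp(-t) g_n is dominated by h. *)
Lemma closed_nonneg (h : R -> R) : measurable_fun (Rp : set TR) h ->
  (forall t, 0 <= t -> 0 <= h t) ->
  mu.-integrable Rp (EFin \o (fun t => h t ^+ 2)) -> NR h.
Proof.
move=> mh h0 ih.
pose g (t : TR) : \bar R := (h t * expR t)%:E.
have mg : measurable_fun (Rp : set TR) g.
  apply/measurable_EFinP; apply: measurable_funM => //.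
  exact: measurable_funTS (@measurable_expR R).
have g0 t : Rp t -> (0 <= g t)%E.
  by rewrite RplusE => t0; rewrite lee_fin mulr_ge0 ?h0 ?expR_ge0.
have mRp := @measurable_Rplus R.
apply: (@closedR_dominated (fun n t => expR (- t) * approx Rp g n t) _ h) => //.
- move=> n.
  pose A k := dyadic_approx Rp g n k.
  have mA k : measurable (A k : set TR).
    rewrite /A /dyadic_approx; case: ifPn => [kn|_]//; rewrite -preimage_comp.
    by apply: mg => //; apply/measurable_image_EFin; exact: measurable_itv.
  have mB : measurable (integer_approx Rp g n : set TR).
    exact: emeasurable_fun_c_infty.
  pose c k : R := k%:R * 2 ^- n.
  have S1 := closedR_sum c (n * 2 ^ n) (fun k => closed_indic (mA k)).
  apply: closedR_ext (closedR_lin n%:R (closed_indic mB) S1) => t _.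
  rewrite /approx mulrDr mulr_sumr big_mkord addrC; congr (_ + _); last by rewrite mulrCA.
  by apply: eq_bigr => k _; rewrite /c mulrCA.
- move=> t t0; rewrite (_ : h t = expR (- t) * fine (g t)); last first.
    by rewrite /g /= mulrCA -expRD addNr expR0 mulr1.
  apply: cvgM; first exact: cvg_cst.
  by apply: (cvg_approx g0); rewrite ?RplusE// ltry.
- move=> n t t0; rewrite ger0_norm.
    rewrite -[X in _ <= X]mulr1 -expR0 -(addNr t) expRD mulrCA ler_wpM2l ?expR_ge0//.
    have := @le_approx _ TR R Rp g n t g0.
    by rewrite RplusE /g lee_fin; apply.
  apply: mulr_ge0; first exact: expR_ge0.
  apply: addr_ge0; last by apply: mulr_ge0.
  by apply: sumr_ge0 => k _; rewrite mulr_ge0// mulr_ge0// invr_ge0 exprn_ge0.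
Qed.

Lemma closed_real (h : R -> R) : measurable_fun (Rp : set TR) h ->
  mu.-integrable Rp (EFin \o (fun t => h t ^+ 2)) -> NR h.
Proof.
move=> mh ih.
have part (k : R -> R) : measurable_fun (Rp : set TR) k ->
    mu.-integrable Rp (EFin \o (fun t => k t ^+ 2)) -> NR (fun t => Num.max (k t) 0).
  move=> mk ik; have mm : measurable_fun (Rp : set TR) (fun t => Num.max (k t) 0).
    by apply: measurable_maxr => //; exact: measurable_cst.
  apply: closed_nonneg => //; first by move=> t _; rewrite le_max lexx orbT.
  apply: integrable_le ik => //; first exact: measurable_funX.
  move=> t _; rewrite ger0_norm ?sqr_ge0//.
  by have [k0|k0] := leP (k t) 0; rewrite ?expr0n ?sqr_ge0.
have p1 := part _ mh ih.
have p2 : NR (fun t => Num.max (- h t) 0).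
  apply: part; first exact: measurable_funN.
  by apply: integrable_ext ih => // t _; rewrite sqrrN.
apply: closedR_ext (closedR_lin (-1) p2 p1) => t _.
by case: (leP (h t) 0) => h1; case: (leP (- h t) 0) => h2; lra.
Qed.

Lemma closed_L2 f : L2 f -> N f.
Proof.
move=> Lf; have [m1 m2] := L2_meas Lf.
have i1 : mu.-integrable Rp (EFin \o (fun t => Re (f t) ^+ 2)).
  apply: integrable_le (L2_int Lf) => //; first exact: measurable_funX.
  by move=> t _; rewrite ger0_norm ?sqr_ge0// sqr_normc_def lerDl sqr_ge0.
have i2 : mu.-integrable Rp (EFin \o (fun t => Im (f t) ^+ 2)).
  apply: integrable_le (L2_int Lf) => //; first exact: measurable_funX.
  by move=> t _; rewrite ger0_norm ?sqr_ge0// sqr_normc_def lerDr sqr_ge0.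
have [L1 N1] := closed_real m1 i1; have [L3 N3] := closed_real m2 i2.
apply: closed_ext (linN 'i%C L3 L1 N3 N1); last exact: L2_lin.
by move=> t _; rewrite addrC -complex_split.
Qed.

End Closed.

(** Muntz-type density. A closed subspace containing all exp(-(1+k)t) contains
    exp(-t) times double exponentials, hence times indicators of rays, hence (by
    Dynkin's lemma) times indicators of Borel sets, hence every nonnegative
    function as a limit of simple functions times exp(-t). *)
Lemma L2_exp_ind N : lin_closed N -> N2_closed N ->
  (forall k : nat, L2 (fun t : R => (expR (- (1 + k%:R) * t))%:C) /\
                   N (fun t : R => (expR (- (1 + k%:R) * t))%:C)) ->
  forall f, L2 f -> N f.
Proof. by move=> l c h f; exact: closed_L2. Qed.

(** [closed_exp_step] increases the decay rate by 1/2 while keeping all powers of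
    t, so 2k steps reach exp(-(1+k)t). *)
Lemma L2_poly_exp_ind N : lin_closed N -> N2_closed N ->
  (forall k : nat, L2 (fun t : R => (t ^+ k * expR (- t))%:C) /\
                   N (fun t : R => (t ^+ k * expR (- t))%:C)) ->
  forall f, L2 f -> N f.
Proof.
move=> l c h; apply: L2_exp_ind => // k.
pose e (j i : nat) (t : R) : R := t ^+ i * expR (- (1 + j%:R * 2^-1) * t).
have H (j : nat) : forall i, L2 (fun t => (e j i t)%:C) /\ N (fun t => (e j i t)%:C).
  elim: j => [|j IH] i.
    apply: (closedR_ext c _ (h i)) => t _.
    by rewrite /e mul0r addr0 mulN1r.
  have c1 : 1 <= 1 + j%:R * 2^-1 :> R by rewrite lerDl mulr_ge0.
  apply: (closedR_ext c _ (closed_exp_step l c c1 IH i)) => t _.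
  by rewrite /e -addrA -(natr1 j) mulrDl mul1r.
apply: (closedR_ext c _ (H k.*2 0%N)) => t _.
by rewrite /e expr0 mul1r -muln2 natrM mulfK// pnatr_eq0.
Qed.

End Density.

(** * Laguerre functions *)
Section Laguerre.
Variable R : realType.
Notation mu := (@lebesgue_measure R).
Notation TR := (measurableTypeR R).
Notation Rp := (@Rplus R).
Implicit Types (p q r : {poly R}).

(** The primitive of p that vanishes at 0. *)
Definition primp p : {poly R} := \sum_(i < size p) (p`_i / i.+1%:R) *: 'X^(i.+1).

Lemma deriv_primp p : (primp p)^`() = p.
Proof.
rewrite /primp raddf_sum /= -[RHS]coefK poly_def; apply: eq_bigr => i _.
by rewrite derivZ derivXn /= -['X^i *+ _]scaler_nat scalerA divfK// pnatr_eq0.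
Qed.

Lemma primp_at0 p : (primp p).[0] = 0.
Proof.
rewrite /primp horner_sum big1// => i _.
by rewrite hornerZ hornerXn expr0n mulr0.
Qed.

Lemma deriv_inj p q : p^`() = q^`() -> p.[0] = q.[0] -> p = q.
Proof.
move=> d0 h0; apply/polyP => -[|i]; first by rewrite -!horner_coef0.
have := congr1 (fun r : {poly R} => r`_i) d0; rewrite !coef_deriv.
rewrite -[p`_i.+1 *+ _]mulr_natl -[q`_i.+1 *+ _]mulr_natl; apply: mulfI.
by rewrite pnatr_eq0.
Qed.

Lemma primp_lin (a b : R) p q : primp (a *: p + b *: q) = a *: primp p + b *: primp q.
Proof.
apply: deriv_inj; first by rewrite derivD !derivZ !deriv_primp.
by rewrite hornerD !hornerZ !primp_at0 !mulr0 addr0.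
Qed.

(** On the Laplace side, taking primitives of p exp(-t) in this way is
    multiplication by 1/(1+s), so that [lagop] is multiplication by the Cayley
    transform (1-s)/(1+s). *)
Definition lagop p : {poly R} := 2%:R *: primp p - p.

(** Up to sign, the Laguerre polynomial L_n(2t). Generating them by [lagop] makes
    both their Laplace transforms and their orthogonality inductive. *)
Definition lagp n := iter n lagop 1.

Lemma lagpS n : lagp n.+1 = lagop (lagp n). Proof. by []. Qed.

Lemma moment_lin (a b : R) p q (al : R[i]) : 0 < Re al ->
  cintegral Rp (pexp (a *: p + b *: q) al) =
  a%:C * cintegral Rp (pexp p al) + b%:C * cintegral Rp (pexp q al).
Proof.
move=> a0; have ip := cintegrable_pexp p a0; have iq := cintegrable_pexp q a0.
have mRp := @measurable_Rplus R.
rewrite -!cintegralZ// -cintegralD//; [|exact: cintegrableZ..].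
apply: cintegral_ext => t _; rewrite /pexp hornerD !hornerZ realCD !realCM; ring.
Qed.

Lemma moment_primp p (al : R[i]) : 0 < Re al ->
  cintegral Rp (pexp p al) = al * cintegral Rp (pexp (primp p) al).
Proof.
by move=> a0; have := moment_deriv (primp p) a0; rewrite deriv_primp primp_at0 subr0.
Qed.

Lemma moment1 (al : R[i]) : 0 < Re al -> al * cintegral Rp (pexp 1 al) = 1.
Proof.
move=> a0; have := moment_deriv 1 a0; rewrite derivC hornerC => /esym/eqP.
rewrite subr_eq => /eqP ->; rewrite (_ : cintegral _ _ = 0) ?add0r//.
rewrite -[RHS](cintegral0 Rp); apply: cintegral_ext => t _.
by rewrite /pexp horner0 mul0r.
Qed.

Lemma moment_lagop p (al : R[i]) : 0 < Re al ->
  cintegral Rp (pexp (lagop p) al) = (2 / al - 1) * cintegral Rp (pexp p al).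
Proof.
move=> a0; have al0 : al != 0 by apply/eqP => al0; move: a0; rewrite al0 ltxx.
rewrite /lagop -scaleN1r moment_lin// (moment_primp p a0).
have -> : (2%:R : R)%:C = 2 :> R[i] by exact: rmorph_nat.
have -> : (- 1 : R)%:C = - 1 :> R[i] by rewrite realCN.
by field.
Qed.

Lemma moment_lagp n (al : R[i]) : 0 < Re al ->
  cintegral Rp (pexp (lagp n) al) = (2 / al - 1) ^+ n / al.
Proof.
move=> a0; have al0 : al != 0 by apply/eqP => al0; move: a0; rewrite al0 ltxx.
elim: n => [|n IH].
  by apply: (mulfI al0); rewrite moment1// expr0 mul1r divff.
by rewrite lagpS moment_lagop// IH exprS mulrA.
Qed.

Definition wint p : R := \int[mu]_(t in Rp) (p.[t] * expR (- 2 * t)).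

Let re2 : 0 < Re (2%:R%:C : R[i]). Proof. by rewrite /=. Qed.

Lemma pexp2 p (t : R) : pexp p 2%:R%:C t = (p.[t] * expR (- 2 * t))%:C.
Proof.
by rewrite /pexp -realCM -realCN cexpR -realCM mulrC [t * _]mulrC mulNr mulrC.
Qed.

Lemma wintE p : cintegral Rp (pexp p 2%:R%:C) = (wint p)%:C.
Proof. by rewrite -cintegralR; apply: cintegral_ext => t _; exact: pexp2. Qed.

Lemma integrable_wint p : mu.-integrable Rp (EFin \o (fun t => p.[t] * expR (- 2 * t))).
Proof.
have [h _] := cintegrable_pexp p re2.
by apply: integrable_ext h => // t _; rewrite pexp2.
Qed.

Lemma wint_lin (a b : R) p q : wint (a *: p + b *: q) = a * wint p + b * wint q.
Proof.
by apply: complexI; rewrite -wintE moment_lin// !wintE -!realCM -realCD.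
Qed.

Lemma wint_deriv p : wint p^`() = 2 * wint p - p.[0].
Proof.
by apply: complexI; rewrite -wintE moment_deriv// !wintE -realCM -realCN -realCD.
Qed.

Lemma wint_primp p : wint p = 2 * wint (primp p).
Proof. by have := wint_deriv (primp p); rewrite deriv_primp primp_at0 subr0. Qed.

(** [lagop] is an isometry for the weight exp(-2t): integrate the derivative
    of the product of the two primitives. *)
Lemma wint_lagop p q : wint (lagop p * lagop q) = wint (p * q).
Proof.
have h := wint_deriv (primp p * primp q).
rewrite derivM !deriv_primp hornerM primp_at0 mul0r subr0 in h.
have -> : lagop p * lagop q =
    1 *: (4%:R *: (primp p * primp q) + (- 2%:R) *: (p * primp q + primp p * q)) + 1 *: (p * q).
  by rewrite /lagop -!mul_polyC !polyCN !polyC_natr polyC1; ring.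
rewrite wint_lin wint_lin h; ring.
Qed.

Lemma wint_lagopl p : wint (lagop p) = 0.
Proof. by rewrite /lagop -scaleN1r wint_lin mulN1r -wint_primp subrr. Qed.

Lemma wint1 : wint 1 = 2^-1.
Proof.
apply: complexI; rewrite -wintE.
have h := moment1 re2; have n0 : (2%:R%:C : R[i]) != 0 by rewrite gt_eqF// ltcR.
by apply: (mulfI n0); rewrite h -realCM divff.
Qed.

Lemma wint_lagp m n : wint (lagp m * lagp n) = (m == n)%:R / 2.
Proof.
elim: m n => [|m IH] [|n].
- by rewrite mulr1 wint1 mul1r.
- by rewrite mul1r lagpS wint_lagopl mul0r.
- by rewrite mulr1 lagpS wint_lagopl mul0r.
- by rewrite !lagpS wint_lagop IH.
Qed.

Definition ell n (t : R) : R := Num.sqrt 2 * (lagp n).[t] * expR (- t).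

Lemma sqr_sqrt2 : Num.sqrt 2 * Num.sqrt 2 = 2 :> R.
Proof. by rewrite -expr2 sqr_sqrtr. Qed.

Lemma ellM m n (t : R) : ell m t * ell n t = 2 * ((lagp m * lagp n).[t] * expR (- 2 * t)).
Proof.
rewrite /ell (_ : - 2 * t = - t + - t); last by ring.
rewrite expRD hornerM; have := sqr_sqrt2; set s := Num.sqrt 2.
have -> : s * (lagp m).[t] * expR (- t) * (s * (lagp n).[t] * expR (- t)) =
  (s * s) * ((lagp m).[t] * (lagp n).[t] * (expR (- t) * expR (- t))) by ring.
by move=> ->.
Qed.

Lemma measurable_poly_exp p (c : R) : measurable_fun (Rp : set TR) (fun t => p.[t] * expR (c * t)).
Proof.
apply: measurable_funTS; apply: continuous_measurable_fun => t.
apply: cvgM; first exact: continuous_horner.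
by apply: is_derive_continuous (is_derive_expMl c t).
Qed.

Lemma L2_poly_exp p : L2 (fun t => (p.[t] * expR (- t))%:C).
Proof.
apply/L2P; split.
  by apply: cmeasurableR; have := measurable_poly_exp p (-1); under eq_fun do rewrite mulN1r.
apply: integrable_ext (integrable_wint (p * p)) => // t _.
rewrite normcR real_normK ?num_real// hornerM exprMn.
by rewrite (_ : - 2 * t = - t + - t) ?expRD -?expr2//; ring.
Qed.

Lemma L2_ell n : L2 (fun t => (ell n t)%:C).
Proof.
by apply: L2_ext (L2_poly_exp (Num.sqrt 2 *: lagp n)) => t _; rewrite hornerZ.
Qed.

Lemma integral_ellM m n : \int[mu]_(t in Rp) (ell m t * ell n t) = (m == n)%:R.
Proof.
transitivity (2 * wint (lagp m * lagp n)).
  rewrite -RintegralZl//; last exact: integrable_wint.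
  by apply: eq_Rintegral => t _; rewrite ellM.
by rewrite wint_lagp mulrCA divff ?mulr1.
Qed.

Lemma N2_ell n : N2 (fun t => (ell n t)%:C) = 1.
Proof.
transitivity ((n == n)%:R : R); last by rewrite eqxx.
rewrite -integral_ellM.
by apply: eq_Rintegral => t _; rewrite normcR real_normK ?num_real.
Qed.

(** The primitive of [lagp n] is the half sum of [lagp n] and [lagp n.+1], so the
    iterated primitives t^k/k! of 1 are combinations of the [lagp n]. *)
Lemma L2_ell_ind (N : set (R -> R[i])) : lin_closed N -> N2_closed N ->
  (forall n, N (fun t => (ell n t)%:C)) -> forall f, L2 f -> N f.
Proof.
move=> lN cN hN; apply: L2_poly_exp_ind => // k.
have [_ h0] := closed0 lN cN (L2_ell 0) (hN 0%N).
pose P p := N (fun t => (p.[t] * expR (- t))%:C).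
have Plin a b p q : P p -> P q -> P (a *: p + b *: q).
  move=> Pp Pq.
  have h1 := lN b%:C _ _ (L2_poly_exp q) (@L2_0 R) Pq h0.
  have h2 := lN a%:C _ _ (L2_poly_exp p) (L2_lin _ (L2_poly_exp q) (@L2_0 R)) Pp h1.
  apply: (closed_ext cN _ _ h2).
    by move=> t _; rewrite addr0 -!realCM -realCD hornerD !hornerZ; congr (_%:C); ring.
  by apply: L2_lin; [exact: L2_poly_exp|apply: L2_lin; [exact: L2_poly_exp|exact: L2_0]].
have Plag n : P (lagp n).
  have := lN (Num.sqrt 2)^-1%:C _ _ (L2_ell n) (@L2_0 R) (hN n).
  move=> /(_ h0); apply: (closed_ext cN); last by apply: L2_lin; [exact: L2_ell|exact: L2_0].
  move=> t _; rewrite addr0 -realCM /ell; congr (_%:C).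
  by rewrite -mulrA mulKf// gt_eqF// sqrtr_gt0.
have Pit j : forall n, P (iter j primp (lagp n)).
  elim: j => [//|j IH] n; rewrite iterSr.
  have -> : primp (lagp n) = 2^-1 *: lagp n.+1 + 2^-1 *: lagp n.
    by rewrite -scalerDr lagpS /lagop subrK scalerA mulVf// scale1r.
  suff -> : forall p q, iter j primp (2^-1 *: p + 2^-1 *: q) = 2^-1 *: iter j primp p + 2^-1 *: iter j primp q.
    exact: Plin.
  move=> p q; elim: (j) => [//|i IHi]; by rewrite !iterS IHi primp_lin.
have E j : iter j primp 1 = j`!%:R^-1 *: 'X^j.
  elim: j => [|j IH]; first by rewrite fact0 invr1 scale1r expr0.
  rewrite iterS IH; apply: deriv_inj; last by rewrite primp_at0 hornerZ hornerXn expr0n mulr0.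
  rewrite deriv_primp derivZ derivXn /= -['X^j *+ _]scaler_nat scalerA; congr (_ *: _).
  by rewrite factS natrM invfM mulrAC mulVf ?mul1r// pnatr_eq0.
have Xk : P 'X^k.
  have := Plin (k`!%:R) 0 _ _ (Pit k 0%N) (Pit k 0%N).
  by rewrite E scale0r addr0 scalerA divff ?scale1r// pnatr_eq0 -lt0n fact_gt0.
split.
  by apply: L2_ext (L2_poly_exp 'X^k) => t _; rewrite hornerXn.
by apply: (closed_ext cN _ (L2_poly_exp 'X^k) Xk) => t _; rewrite hornerXn.
Qed.

End Laguerre.

(** * The transform of L2 into the Hardy space *)
Section Transform.
Variable R : realType.
Notation mu := (@lebesgue_measure R).
Notation TR := (measurableTypeR R).
Notation Rp := (@Rplus R).
Implicit Types (f g : R -> R[i]) (z : R[i]).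

Lemma cayley_Re_gt0 z : disk z -> 0 < Re ((1 - z) / (1 + z)).
Proof.
move=> zd; have z1 := disk_1D zd.
have -> : (1 - z) / (1 + z) = (1 - z) * conjc (1 + z) * ((normc (1 + z) ^+ 2)^-1)%:C.
  have c1 : conjc (1 + z) != 0 by rewrite -normc_eq0 normc_conj normc_eq0.
  by rewrite realCV -mulr_conj invfM mulrACA (divff c1) mulr1.
rewrite mulrC Re_mulr; apply: mulr_gt0.
  by rewrite invr_gt0 exprn_gt0// normc_gt0.
move: zd => /diskE zd.
have : normc z ^+ 2 < 1 by rewrite expr_lt1 ?normc_ge0.
rewrite sqr_normc_def Re_mul Re_conj Im_conj !Re_add !Im_add Re_opp Im_opp /=; lra.
Qed.

Lemma Re_al_gt0 z : disk z -> 0 < Re (2 / (1 + z)).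
Proof.
move=> zd; have z1 := disk_1D zd; have h := cayley_Re_gt0 zd.
have -> : 2 / (1 + z) = 1 + (1 - z) / (1 + z) by field.
by rewrite Re_add /= ltr_pwDl// ltW.
Qed.

Definition hker z (t : R) : R[i] := cexp (t%:C * (z - 1) / (z + 1)).

Lemma hkerE z t : hker z t = pexp 1 ((1 - z) / (1 + z)) t.
Proof.
rewrite /pexp hornerC mul1r /hker; congr cexp.
by rewrite [z + 1]addrC -mulrA -mulrN -mulNr opprB.
Qed.

Lemma L2_hker z : disk z -> L2 (hker z).
Proof.
move=> /cayley_Re_gt0 h; apply: (@L2_dom _ _ (fun t => 1 * expR (- Re ((1 - z) / (1 + z)) * t))).
- have [m1 m2] := is_cderive_measurable Rp (is_cderive_pexp 1 ((1 - z) / (1 + z))).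
  by apply: cmeasurable_ext (conj m1 m2) => t _; rewrite hkerE.
- by move=> t t0; rewrite hkerE normc_pexp hornerC normr1.
- exact: integrable_sqr_expR.
Qed.

Definition hcst z : R[i] := (Num.sqrt 2)%:C / (1 + z).

Lemma HmapE f z : Hmap f z = hcst z * cintegral Rp (fun t => f t * hker z t).
Proof. by []. Qed.

Lemma Hmap_lin (a : R[i]) f g z : disk z -> L2 f -> L2 g ->
  Hmap (fun t => a * f t + g t) z = a * Hmap f z + Hmap g z.
Proof.
move=> zd Lf Lg; have Lk := L2_hker zd; have mRp := @measurable_Rplus R.
have i1 := L2M_int Lf Lk; have i2 := L2M_int Lg Lk.
rewrite !HmapE mulrCA -mulrDr; congr (_ * _).
rewrite -cintegralZ// -cintegralD//; last exact: cintegrableZ.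
by apply: cintegral_ext => t _; rewrite mulrDl mulrA.
Qed.

(** Cauchy-Schwarz against the kernel [hker z]. *)
Lemma Hmap_bound z : disk z -> exists2 K, 0 <= K &
  forall f, L2 f -> normc (Hmap f z) ^+ 2 <= K * N2 f.
Proof.
move=> zd; have Lk := L2_hker zd.
exists (normc (hcst z) ^+ 2 * N2 (hker z)); first by rewrite mulr_ge0 ?sqr_ge0 ?N2_ge0.
move=> f Lf; rewrite HmapE Normc.normcM exprMn -[X in _ <= X]mulrA.
rewrite ler_wpM2l ?sqr_ge0// mulrC; exact: cauchy_schwarz.
Qed.

Lemma Hmap_ae f g z : disk z -> L2 f -> L2 g -> L2eq f g -> Hmap f z = Hmap g z.
Proof.
move=> zd Lf Lg fg; rewrite !HmapE; congr (_ * _); apply: cintegral_ae => //.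
- exact: cintegrable_measurable (L2M_int Lf (L2_hker zd)).
- exact: cintegrable_measurable (L2M_int Lg (L2_hker zd)).
- by apply: filterS fg => t /= /[apply] ->.
Qed.

Lemma pexpMR p (t : R) (al : R[i]) :
  (p.[t] * expR (- t))%:C * pexp 1 al t = pexp p (1 + al) t.
Proof.
rewrite /pexp hornerC mul1r realCM -mulrA -cexpR -cexpD; congr (_ * cexp _).
by rewrite realCN mulrDr mulr1 opprD.
Qed.

Lemma Hmap_poly_exp (p : {poly R}) z : disk z ->
  Hmap (fun t => (p.[t] * expR (- t))%:C) z = hcst z * cintegral Rp (pexp p (2 / (1 + z))).
Proof.
move=> zd; have z1 := disk_1D zd; rewrite HmapE; congr (_ * _).
apply: cintegral_ext => t _; rewrite hkerE pexpMR; congr (pexp _ _ _).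
by field.
Qed.

(** The transform at z is a Laplace transform at 2/(1+z), where the factor
    2/al - 1 of [moment_lagp] equals z. *)
Lemma Hmap_ell n z : disk z -> Hmap (fun t => (ell n t)%:C) z = z ^+ n.
Proof.
move=> zd; have z1 := disk_1D zd; have al0 := Re_al_gt0 zd.
rewrite (_ : (fun t => (ell n t)%:C) = (fun t => ((Num.sqrt 2 *: lagp R n).[t] * expR (- t))%:C)); last first.
  by apply/funext => t; rewrite hornerZ.
rewrite Hmap_poly_exp//.
have -> : Num.sqrt 2 *: lagp R n = Num.sqrt 2 *: lagp R n + 0 *: lagp R n by rewrite scale0r addr0.
rewrite moment_lin// moment_lagp//.
have -> : (0%:C : R[i]) = 0 by [].
have -> : 2 / (2 / (1 + z)) - 1 = z by field; rewrite z1.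
have s2 : (Num.sqrt 2)%:C * (Num.sqrt 2)%:C = 2 :> R[i].
  by rewrite -realCM sqr_sqrt2; exact: rmorph_nat.
rewrite /hcst mul0r addr0; set s := (Num.sqrt 2)%:C.
have -> : s / (1 + z) * (s * (z ^+ n / (2 / (1 + z)))) = (s * s) / 2 * z ^+ n by field; rewrite z1.
by rewrite s2 divff ?mul1r.
Qed.

(** Laguerre coefficients, the Taylor coefficients of the transform. *)
Definition lcoef f n : R[i] := cintegral Rp (fun t => f t * (ell n t)%:C).

Lemma lcoef_lin (a : R[i]) f g n : L2 f -> L2 g ->
  lcoef (fun t => a * f t + g t) n = a * lcoef f n + lcoef g n.
Proof.
move=> Lf Lg; have Lk := @L2_ell R n; have mRp := @measurable_Rplus R.
have i1 := L2M_int Lf Lk; have i2 := L2M_int Lg Lk.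
rewrite /lcoef -cintegralZ// -cintegralD//; last exact: cintegrableZ.
by apply: cintegral_ext => t _; rewrite mulrDl mulrA.
Qed.

Lemma lcoef_bound f n : L2 f -> normc (lcoef f n) ^+ 2 <= N2 f.
Proof.
by move=> Lf; have := cauchy_schwarz Lf (@L2_ell R n); rewrite N2_ell mulr1.
Qed.

Lemma lcoef_ell m n : lcoef (fun t => (ell m t)%:C) n = (m == n)%:R.
Proof.
rewrite /lcoef (_ : cintegral _ _ = (\int[mu]_(t in Rp) (ell m t * ell n t))%:C).
  by rewrite integral_ellM rmorph_nat.
by rewrite -cintegralR; apply: cintegral_ext => t _; rewrite realCM.
Qed.

Lemma N2_minus_proj f n : L2 f ->
  N2 (fun t => f t - lcoef f n * (ell n t)%:C) = N2 f - normc (lcoef f n) ^+ 2.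
Proof.
move=> Lf; set a := lcoef f n; have Le := @L2_ell R n.
have mRp := @measurable_Rplus R.
have i1 := L2_int Lf; have i2 := L2_int Le.
have ia := cintegrableZ (conjc a) mRp (L2M_int Lf Le); have [iar _] := ia.
have E t : normc (f t - a * (ell n t)%:C) ^+ 2 =
    (normc (f t) ^+ 2 + (-2) * Re (conjc a * (f t * (ell n t)%:C))) +
    normc a ^+ 2 * normc (ell n t)%:C ^+ 2.
  rewrite !sqr_normc_def Re_add Im_add Re_opp Im_opp !Re_mul !Im_mul Re_conj Im_conj /=; ring.
transitivity (\int[mu]_(t in Rp) ((normc (f t) ^+ 2 + (-2) * Re (conjc a * (f t * (ell n t)%:C))) +
    normc a ^+ 2 * normc (ell n t)%:C ^+ 2)).
  by apply: eq_Rintegral => t _; exact: E.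
rewrite RintegralD//; [|by apply: integrableDr => //; exact: integrableZr|exact: integrableZr].
rewrite RintegralD//; [|exact: integrableZr].
rewrite !RintegralZl// -/(N2 _) -/(N2 (fun t => (ell n t)%:C)) N2_ell mulr1.
have -> : \int[mu]_(t in Rp) Re (conjc a * (f t * (ell n t)%:C)) =
    Re (cintegral Rp (fun t => (conjc a) * (f t * (ell n t)%:C))) by [].
rewrite cintegralZ//; last exact: L2M_int.
rewrite -/(lcoef f n) -/a [conjc a * a]mulrC mulr_conj /= /N2; ring.
Qed.

(** Each subtracted projection lowers N2 by the square of its coefficient and, by
    orthonormality, leaves the later coefficients unchanged. *)
Lemma bessel f M : L2 f -> \sum_(0 <= n < M) normc (lcoef f n) ^+ 2 <= N2 f.
Proof.
move=> Lf.
pose h M := fun t => f t - \sum_(0 <= n < M) lcoef f n * (ell n t)%:C.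
suff [Lh [ch Nh]] : L2 (h M) /\ (forall n, (M <= n)%N -> lcoef (h M) n = lcoef f n) /\
    N2 (h M) = N2 f - \sum_(0 <= n < M) normc (lcoef f n) ^+ 2.
  by have := N2_ge0 (h M); rewrite Nh subr_ge0.
elim: M => [|M [Lh [ch Nh]]].
  have h0 t : h 0%N t = f t by rewrite /h big_geq// subr0.
  split; first by apply: L2_ext Lf => t _; rewrite h0.
  split; first by move=> n _; apply: cintegral_ext => t _; rewrite h0.
  by rewrite big_geq// subr0; apply: N2_ext.
have hS t : h M.+1 t = - lcoef f M * (ell M t)%:C + h M t.
  by rewrite /h big_nat_recr //= opprD mulNr; ring.
split; first by apply: L2_ext (L2_lin _ (@L2_ell R M) Lh) => t _; rewrite hS.
split.
  move=> n Mn; transitivity (lcoef (fun t => - lcoef f M * (ell M t)%:C + h M t) n).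
    by apply: cintegral_ext => t _; rewrite hS.
  rewrite lcoef_lin//; last exact: L2_ell.
  by rewrite lcoef_ell (ltn_eqF Mn) mulr0 add0r ch// ltnW.
rewrite [in RHS]big_nat_recr// opprD addrA -Nh -(ch M (leqnn M)) -N2_minus_proj//.
by apply: N2_ext => t _; rewrite hS ch// mulNr addrC.
Qed.

Lemma sum_geom_le (q : R) n : 0 <= q < 1 -> \sum_(0 <= i < n) q ^+ i <= (1 - q)^-1.
Proof.
move=> /andP[q0 q1]; have d : 0 < 1 - q by rewrite subr_gt0.
rewrite -div1r ler_pdivlMr// big_mkord mulrC -opprB mulNr -subrX1 opprB.
by rewrite gerBl exprn_ge0.
Qed.

Lemma L2norm_sqr f : L2norm f ^+ 2 = N2 f.
Proof. by rewrite L2normE sqr_sqrtr// N2_ge0. Qed.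

Lemma lcoef_norm f n : L2 f -> normc (lcoef f n) <= L2norm f.
Proof.
move=> Lf; rewrite -(ler_pXn2r (n := 2)) ?nnegrE ?normc_ge0 ?sqrtr_ge0//.
by rewrite L2norm_sqr; exact: lcoef_bound.
Qed.

Definition lsum f z M := \sum_(0 <= n < M) lcoef f n * z ^+ n.

Lemma lsum_lin (a : R[i]) f g z M : L2 f -> L2 g ->
  lsum (fun t => a * f t + g t) z M = a * lsum f z M + lsum g z M.
Proof.
move=> Lf Lg; rewrite /lsum mulr_sumr -big_split; apply: eq_bigr => n _ /=.
by rewrite lcoef_lin// mulrDl mulrA.
Qed.

Lemma lsum_bound f z M : disk z -> L2 f ->
  normc (lsum f z M) ^+ 2 <= (1 - normc z) ^- 2 * N2 f.
Proof.
move=> /diskE zd Lf; rewrite -L2norm_sqr -exprVn -exprMn.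
have d : 0 < 1 - normc z by rewrite subr_gt0.
have q : 0 <= normc z < 1 by rewrite normc_ge0.
rewrite lerXn2r ?nnegrE ?normc_ge0//; first by rewrite mulr_ge0 ?sqrtr_ge0// invr_ge0 ltW.
apply: le_trans (normc_sum _ _ _) _.
apply: (@le_trans _ _ (\sum_(0 <= n < M) L2norm f * normc z ^+ n)).
  apply: ler_sum => n _; rewrite Normc.normcM normcX ler_wpM2r ?exprn_ge0 ?normc_ge0//.
  exact: lcoef_norm.
by rewrite -mulr_sumr mulrC ler_wpM2r ?sqrtr_ge0//; exact: sum_geom_le.
Qed.

Lemma ltr_sqr_lt (x e : R) : 0 <= x -> 0 < e -> x ^+ 2 < e ^+ 2 -> x < e.
Proof. by move=> x0 e0; rewrite ltr_pXn2r ?nnegrE// ltW. Qed.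

(** Both sides are continuous in f and agree on the Laguerre functions. *)
Lemma Hmap_series f z : disk z -> L2 f ->
  (lsum f z : nat -> R[i]^o) @ \oo --> (Hmap f z : R[i]^o).
Proof.
move=> zd; move: f; apply: L2_ell_ind.
- move=> a f g Lf Lg hf hg /=.
  rewrite (Hmap_lin a zd Lf Lg).
  have -> : lsum (fun t => a * f t + g t) z = (fun M => a * lsum f z M + lsum g z M).
    by apply/funext => M; exact: lsum_lin.
  exact: cvgc_lin.
- move=> f Lf hf; apply/cvgcP => e e0.
  have [K K0 hK] := Hmap_bound zd.
  set K' := (1 - normc z) ^- 2.
  have K'0 : 0 <= K' by rewrite invr_ge0 sqr_ge0.
  have e3 : 0 < e / 3 by rewrite divr_gt0.
  have KK : 0 < K + K' + 1 by rewrite ltr_wpDl// addr_ge0.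
  have d0 : 0 < (e / 3) ^+ 2 / (K + K' + 1) by rewrite divr_gt0// exprn_gt0.
  have [g [Lg hg Nfg]] := hf _ d0.
  have Ld := L2_sub Lf Lg.
  have small k : 0 <= k -> k <= K + K' -> k * N2 (fun t => f t - g t) < (e / 3) ^+ 2.
    move=> k0 kk; have n0 := N2_ge0 (fun t => f t - g t).
    move: Nfg; rewrite ltr_pdivlMr// => h; apply: le_lt_trans h.
    by rewrite mulrC ler_wpM2l// (le_trans kk)// lerDl.
  have fE t : f t = 1 * (f t - g t) + g t by rewrite mul1r subrK.
  have Hd : Hmap f z = Hmap (fun t => f t - g t) z + Hmap g z.
    rewrite (_ : Hmap f z = Hmap (fun t => 1 * (f t - g t) + g t) z).
      by rewrite (Hmap_lin 1 zd Ld Lg) mul1r.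
    by congr (Hmap _ z); apply/funext => t; exact: fE.
  have Sd M : lsum f z M = lsum (fun t => f t - g t) z M + lsum g z M.
    rewrite (_ : lsum f z M = lsum (fun t => 1 * (f t - g t) + g t) z M).
      by rewrite (lsum_lin 1 z M Ld Lg) mul1r.
    by congr (lsum _ z M); apply/funext => t; exact: fE.
  have h1 : normc (Hmap (fun t => f t - g t) z) < e / 3.
    apply: ltr_sqr_lt; rewrite ?normc_ge0//; apply: le_lt_trans (hK _ Ld) _.
    by apply: small; rewrite // lerDl.
  have h2 M : normc (lsum (fun t => f t - g t) z M) < e / 3.
    apply: ltr_sqr_lt; rewrite ?normc_ge0//; apply: le_lt_trans (lsum_bound M zd Ld) _.
    by apply: small; rewrite // lerDr.
  move/cvgcP : hg => /(_ _ e3); apply: filterS => M h3.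
  rewrite Sd Hd (_ : _ - _ = lsum (fun t => f t - g t) z M - Hmap (fun t => f t - g t) z + (lsum g z M - Hmap g z)); last by ring.
  rewrite (_ : e = e / 3 + e / 3 + e / 3); last by field.
  apply: le_lt_trans (normcD _ _) _; rewrite ltrD//.
  by apply: le_lt_trans (normcD _ _) _; rewrite normcNN ltrD.
- move=> m; rewrite Hmap_ell//; apply: cvg_near_cst; exists m.+1 => // M /= mM.
  rewrite /lsum (bigD1_seq m) ?iota_uniq ?mem_index_iota //= big1 ?addr0.
    by rewrite lcoef_ell eqxx mul1r.
  by move=> i im; rewrite lcoef_ell eq_sym (negbTE im) mul0r.
Qed.

Lemma Hmap_hardy2 f : L2 f -> hardy2 (Hmap f).
Proof.
move=> Lf; exists (lcoef f); split; last by move=> z zd; exact: Hmap_series.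
apply: nondecreasing_is_cvgn.
  by apply/nondecreasing_seqP => n; rewrite /series /= big_nat_recr //= lerDl sqr_ge0.
by exists (N2 f) => _ [M _ <-]; exact: bessel.
Qed.

(** At the real point z = (1-c)/(1+c) the kernel is exp(-ct), so f is orthogonal
    to the exponentials exp(-(1+k)t), hence to the conjugate of f by density. *)
Lemma Hmap_inj0 f : L2 f -> (forall z, disk z -> Hmap f z = 0) -> L2eq f (fun=> 0).
Proof.
move=> Lf h0; have mRp := @measurable_Rplus R.
have H g : L2 g -> cintegral Rp (fun t => g t * f t) = 0.
  move: g; apply: L2_exp_ind.
  - move=> a g k Lg Lk hg hk /=.
    have i1 := L2M_int Lg Lf; have i2 := L2M_int Lk Lf.
    transitivity (a * cintegral Rp (fun t => g t * f t) + cintegral Rp (fun t => k t * f t)).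
      rewrite -cintegralZ// -cintegralD//; last exact: cintegrableZ.
      by apply: cintegral_ext => t _; rewrite mulrDl mulrA.
    by rewrite hg hk mulr0 addr0.
  - move=> g Lg hg; apply/eqP; rewrite -normc_eq0; apply/negP => /negP n0.
    have {}n0 : 0 < normc (cintegral Rp (fun t => g t * f t)) by rewrite lt_neqAle eq_sym n0 normc_ge0.
    set x := normc _ in n0.
    have P : 0 < N2 f + 1 by rewrite ltr_wpDl ?N2_ge0.
    have [k [Lk hk Nk]] := hg (x ^+ 2 / (N2 f + 1)) (divr_gt0 (exprn_gt0 2 n0) P).
    have := cauchy_schwarz (L2_sub Lg Lk) Lf.
    rewrite (_ : cintegral _ _ = cintegral Rp (fun t => g t * f t) - cintegral Rp (fun t => k t * f t)); last first.
      rewrite -cintegralB//; [|exact: L2M_int..].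
      by apply: cintegral_ext => t _; rewrite mulrBl.
    rewrite hk subr0 -/x; move: Nk; rewrite ltr_pdivlMr// mulrDr mulr1.
    have := N2_ge0 (fun t => g t - k t); lra.
  - move=> k; pose c : R := 1 + k%:R; pose w : R := (1 - c) / (1 + c).
    have c0 : 0 <= c by rewrite addr_ge0.
    have c1 : 1 + c != 0 by rewrite gt_eqF// ltr_pwDl.
    have E t : hker w%:C t = (expR (- c * t))%:C.
      rewrite hkerE /pexp hornerC mul1r -cexpR; congr cexp.
      have -> : (1 - w%:C) / (1 + w%:C) = c%:C :> R[i].
        rewrite -[1]/(1%:C) -realCN -!realCD -realCV -realCM; congr (_%:C).
        have -> : 1 - w = 2 * c / (1 + c) by rewrite /w; field.
        have -> : 1 + w = 2 / (1 + c) by rewrite /w; field.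
        by field.
      by rewrite -realCM -realCN; congr (_%:C); ring.
    have wd : disk w%:C.
      apply/diskE; rewrite normcR ltr_norml /w.
      have cp : 0 < 1 + c by rewrite ltr_pwDl.
      rewrite ltr_pdivlMr// ltr_pdivrMr//.
      have : 1 <= c by rewrite lerDl.
      lra.
    split.
      by apply: L2_ext (L2_hker wd) => t _; exact: E.
    have := h0 _ wd; rewrite HmapE => /eqP; rewrite mulf_eq0 => /orP[|/eqP h].
      rewrite /hcst mulf_eq0 invr_eq0 (negbTE (disk_1D wd)) orbF.
      by rewrite -normc_eq0 normcR normr_eq0 sqrtr_eq0 leNgt ltr0n.
    by rewrite -[RHS]h; apply: cintegral_ext => t _; rewrite E mulrC.
have N0 : N2 f = 0.
  have := H _ (L2_conj Lf).
  rewrite (_ : cintegral _ _ = (N2 f)%:C); first by move=> [].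
  by rewrite -cintegralR; apply: cintegral_ext => t _; rewrite mulrC mulr_conj.
have i0 := L2_int Lf.
have E0 : (\int[mu]_(t in Rp) `|(normc (f t) ^+ 2)%:E| = 0)%E.
  rewrite -[RHS]/(0%:E) -N0 /N2 /Rintegral fineK; last exact: integrable_fin_num.
  by apply: eq_integral => t _ /=; rewrite ger0_norm// sqr_ge0.
have m0 := measurable_int mu i0.
have := (ae_eq_integral_abs mu mRp m0).1 E0.
apply: filterS => t /= h Dt; have := h Dt => -[] /eqP.
by rewrite sqrf_eq0 normc_eq0 => /eqP.
Qed.

Lemma Hmap_inj f g : L2 f -> L2 g -> (forall z, disk z -> Hmap f z = Hmap g z) -> L2eq f g.
Proof.
move=> Lf Lg h; have L := L2_lin (-1) Lg Lf.
have := Hmap_inj0 L; rewrite /L2eq => H.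
have {}H : ae_eq mu Rp (fun t => -1 * g t + f t) (fun=> 0).
  by apply: H => z zd; rewrite Hmap_lin// h// mulN1r addNr.
apply: filterS H => t /= H Dt; have := H Dt.
by move=> /eqP; rewrite mulN1r addrC subr_eq0 => /eqP.
Qed.

End Transform.

(** * Partial sums of the logarithm *)
Section Logarithm.
Variable R : realType.
Implicit Types (w z : R[i]).

(** Taylor polynomial of log(1 - w); it replaces a branch of the complex
    logarithm. *)
Definition logp N w : R[i] := - \sum_(0 <= k < N) w ^+ k.+1 / k.+1%:R.

Lemma geom_complex w N : (1 - w) * \sum_(0 <= k < N) w ^+ k = 1 - w ^+ N.
Proof. by rewrite big_mkord -opprB mulNr -subrX1 opprB. Qed.

Lemma is_cderive_monomial (n : nat) (t : R) :
  is_cderive (fun x : R => (x ^+ n.+1)%:C) t (n.+1%:R * t ^+ n)%:C.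
Proof.
apply: is_cderiveR; apply: is_derive_to (is_derive_poly 'X^(n.+1) t) _ _.
  by move=> x; rewrite hornerXn.
by rewrite derivXn hornerMn hornerXn mulr_natl.
Qed.

(** The factor 2 comes from treating real and imaginary parts separately. *)
Lemma mean_value_bound (g d : R -> R[i]) (M : R) :
  (forall t, is_cderive g t (d t)) ->
  (forall t, 0 <= t <= 1 -> normc (d t) <= M) ->
  normc (g 1 - g 0) <= 2 * M.
Proof.
move=> dg dM.
have part (u v : R -> R) : (forall t, is_derive t (1:R) u (v t)) ->
    (forall t, 0 <= t <= 1 -> `|v t| <= M) -> `|u 1 - u 0| <= M.
  move=> du vM; have cu : {within `[0, 1], continuous u}.
    by apply: continuous_subspaceT => t; exact: (is_derive_continuous (du t)).
  have [c] := @MVT_segment R u v 0 1 ler01 (fun t _ => du t) cu.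
  by rewrite in_itv /= => /vM h ->; rewrite subr0 mulr1.
apply: le_trans (normc_leD _) _; rewrite mulr_natl mulr2n lerD//.
  rewrite Re_add Re_opp; apply: (part (fun t => Re (g t)) (fun t => Re (d t))).
    by move=> t; have [] := dg t.
  by move=> t /dM; apply: le_trans; exact: normc_geRe.
rewrite Im_add Im_opp; apply: (part (fun t => Im (g t)) (fun t => Im (d t))).
  by move=> t; have [] := dg t.
by move=> t /dM; apply: le_trans; exact: normc_geIm.
Qed.

Lemma Re_logp_bound N w (rho : R) : 0 <= rho < 1 -> normc w <= rho ->
  Re (- logp N w) <= (1 - rho)^-1.
Proof.
move=> rho01 wr; have [rho0 rho1] := andP rho01.
apply: le_trans (sum_geom_le N rho01); rewrite opprK Re_sum.
apply: ler_sum => k _; apply: le_trans (ler_norm _) _; apply: le_trans (normc_geRe _) _.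
rewrite Normc.normcM normcX Normc.normcV -[k.+1%:R](rmorph_nat (real_complex R)) normcR normr_nat.
rewrite ler_pdivrMr ?ltr0n//.
apply: le_trans (_ : rho ^+ k.+1 <= _); first by rewrite lerXn2r ?nnegrE ?normc_ge0.
rewrite exprS mulrC ler_wpM2l ?exprn_ge0// (le_trans (ltW rho1))// ler1n//.
Qed.

(** The function cexp(-logp N (tw)) (1-tw) has derivative -w (tw)^N cexp(-logp N (tw)). *)
Lemma cexp_logp (rho : R) : 0 <= rho < 1 -> exists2 C, 0 <= C &
  forall N w, normc w <= rho -> normc (cexp (- logp N w) * (1 - w) - 1) <= C * rho ^+ N.
Proof.
move=> rho01; have [rho0 rho1] := andP rho01.
exists (2 * expR (1 - rho)^-1); first by rewrite mulr_ge0 ?expR_ge0.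
move=> N w wr.
pose g (t : R) := - logp N (t%:C * w).
have dg t : is_cderive g t (w * \sum_(0 <= k < N) (t%:C * w) ^+ k).
  have h k := is_cderiveZ (w ^+ k.+1 / k.+1%:R) (is_cderive_monomial k t).
  apply: is_cderive_ext (is_cderive_eq (is_cderive_sum (index_iota 0 N) h) _).
    move=> x; rewrite /g opprK; apply: eq_bigr => k _.
    by rewrite exprMn realCX; ring.
  rewrite mulr_sumr; apply: eq_bigr => k _.
  have k0 : k.+1%:R != 0 :> R[i] by rewrite pnatr_eq0.
  rewrite realCM realCX exprMn exprS (rmorph_nat (real_complex R)).
  by field; rewrite nat1r.
have d1 t : is_cderive (fun x : R => 1 - x%:C * w) t (- w).
  have h := is_cderiveD (is_cderive_cst 1 t) (is_cderiveZ (- w) (is_cderiveR (is_derive_id t (1:R)))).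
  apply: is_cderive_ext (is_cderive_eq h _); last by rewrite add0r mulr1.
  by move=> x; rewrite mulNr mulrC.
pose h (t : R) := cexp (g t) * (1 - t%:C * w).
have dh t : is_cderive h t (- (cexp (g t) * (w * (t%:C * w) ^+ N))).
  apply: is_cderive_eq (is_cderiveM (is_cderive_cexp (dg t)) (d1 t)) _.
  have E := geom_complex (t%:C * w) N; set S := \sum_(0 <= k < N) _ in E *.
  rewrite (_ : _ + _ = cexp (g t) * (w * ((1 - t%:C * w) * S - 1))); last by ring.
  by rewrite E; ring.
have -> : cexp (- logp N w) * (1 - w) - 1 = h 1 - h 0.
  rewrite /h /g mul1r mul0r subr0 mulr1 (_ : logp N 0 = 0) ?oppr0 ?cexp0//.
  by rewrite /logp big1 ?oppr0// => k _; rewrite expr0n mul0r.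
rewrite -mulrA; apply: (mean_value_bound dh) => t /andP[t0 t1].
have tw : normc (t%:C * w) <= rho.
  by rewrite Normc.normcM normcR ger0_norm// (le_trans _ wr)// ler_piMl ?normc_ge0.
rewrite normcNN Normc.normcM normc_cexp.
apply: ler_pM; rewrite ?expR_ge0 ?normc_ge0//.
  by rewrite ler_expR; exact: Re_logp_bound tw.
rewrite Normc.normcM normcX.
have w1 : normc w <= 1 by rewrite (le_trans wr) ?ltW.
apply: (@le_trans _ _ (1 * normc (t%:C * w) ^+ N)).
  by rewrite ler_wpM2r ?exprn_ge0 ?normc_ge0.
by rewrite mul1r lerXn2r ?nnegrE ?normc_ge0.
Qed.

Lemma ln_near1 (x e : R) : 0 < x -> 0 <= e -> e <= 2^-1 -> `|x - 1| <= e -> `|ln x| <= 2 * e.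
Proof.
move=> x0 e0 e2; rewrite !ler_norml => /andP[h1 h2].
have a1 : ln x <= x - 1.
  by have := @le_ln1Dx R (x - 1); rewrite (addrC 1) subrK; apply; lra.
have a2 : - ln x <= x^-1 - 1.
  rewrite -lnV//; have := @le_ln1Dx R (x^-1 - 1); rewrite (addrC 1) subrK; apply.
  by rewrite ltrBrDl subrr invr_gt0.
have a3 : x^-1 - 1 <= 2 * e.
  have -> : x^-1 - 1 = (1 - x) / x by field; rewrite gt_eqF.
  rewrite ler_pdivrMr//; nra.
by apply/andP; split; lra.
Qed.

Lemma normc_1sub_gt0 w : normc w < 1 -> 0 < normc (1 - w).
Proof.
move=> w1; rewrite normc_gt0 subr_eq0; apply: contraTN w1 => /eqP <-.
by rewrite Normc.normc1 ltxx.
Qed.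

(** Taking moduli in the estimate of [cexp_logp] turns it into an estimate on
    log|1 - w|, uniform in w. *)
Lemma ln_logp N w (e : R) : normc w < 1 -> 0 <= e -> e <= 2^-1 ->
  normc (cexp (- logp N w) * (1 - w) - 1) <= e ->
  `|ln (normc (1 - w)) - Re (logp N w)| <= 2 * e.
Proof.
move=> w1 e0 e2 he; have p := normc_1sub_gt0 w1.
set x := normc (cexp (- logp N w) * (1 - w)).
have xE : x = expR (- Re (logp N w)) * normc (1 - w).
  by rewrite /x Normc.normcM normc_cexp Re_opp.
have x0 : 0 < x by rewrite xE mulr_gt0 ?expR_gt0.
have -> : ln (normc (1 - w)) - Re (logp N w) = ln x.
  by rewrite xE lnM ?posrE ?expR_gt0// expRK addrC.
apply: ln_near1 => //; apply: le_trans he.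
have hx : forall a : R[i], `|normc a - 1| <= normc (a - 1).
  move=> a; have h1 := normcD a (- (a - 1)); have h2 := normcD (a - 1) 1.
  rewrite subrK Normc.normc1 in h2.
  rewrite normcNN (_ : a - (a - 1) = 1) ?Normc.normc1 in h1; last by ring.
  by rewrite ler_norml; apply/andP; split; lra.
exact: hx.
Qed.

End Logarithm.

(** * Integrals over the circle *)
Section Circle.
Variable R : realType.
Notation mu := (@lebesgue_measure R).
Notation TR := (measurableTypeR R).
Notation T := (`[0, 2 * pi]%classic : set R).
Implicit Types (z w : R[i]) (g h : R -> R[i]).

Definition ccont g := continuous (fun t => Re (g t)) /\ continuous (fun t => Im (g t)).

Lemma ccont_ext g h : g =1 h -> ccont g -> ccont h.
Proof. by move=> /funext ->. Qed.

Lemma ccont_cderive g d : (forall t, is_cderive g t (d t)) -> ccont g.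
Proof.
by move=> h; split => t; have [h1 h2] := h t; exact: is_derive_continuous.
Qed.

Lemma ccont_cst (a : R[i]) : ccont (fun=> a).
Proof. by split => t; exact: cvg_cst. Qed.

Lemma ccontD g h : ccont g -> ccont h -> ccont (fun t => g t + h t).
Proof.
move=> [g1 g2] [h1 h2]; split.
  by under eq_fun do rewrite Re_add; move=> t; apply: cvgD; [exact: g1|exact: h1].
by under eq_fun do rewrite Im_add; move=> t; apply: cvgD; [exact: g2|exact: h2].
Qed.

Lemma ccontM g h : ccont g -> ccont h -> ccont (fun t => g t * h t).
Proof.
move=> [g1 g2] [h1 h2]; split.
  under eq_fun do rewrite Re_mul; move=> t; apply: cvgB; apply: cvgM;
    [exact: g1|exact: h1|exact: g2|exact: h2].
under eq_fun do rewrite Im_mul; move=> t; apply: cvgD; apply: cvgM;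
  [exact: g1|exact: h2|exact: g2|exact: h1].
Qed.

Lemma ccontR (u : R -> R) : continuous u -> ccont (fun t => (u t)%:C).
Proof. by split => //= t; exact: cvg_cst. Qed.

Lemma ccont_conj g : ccont g -> ccont (fun t => conjc (g t)).
Proof.
move=> [g1 g2]; split; first by under eq_fun do rewrite Re_conj.
by under eq_fun do rewrite Im_conj; move=> t; apply: cvgN; exact: g2.
Qed.

Lemma ccont_sqr_normc g : ccont g -> continuous (fun t => normc (g t) ^+ 2).
Proof.
move=> [g1 g2]; under eq_fun do rewrite sqr_normc_def !expr2; move=> t.
by apply: cvgD; apply: cvgM; [exact: g1|exact: g1|exact: g2|exact: g2].
Qed.

Lemma ccont_normc g : ccont g -> continuous (fun t => normc (g t)).
Proof.
move=> hg; have -> : (fun t => normc (g t)) = Num.sqrt \o (fun t => normc (g t) ^+ 2).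
  by apply/funext => t /=; rewrite sqrtr_sqr ger0_norm// normc_ge0.
move=> t; apply: continuous_comp; first exact: ccont_sqr_normc.
exact: sqrt_continuous.
Qed.

Lemma ccontV g : (forall t, g t != 0) -> ccont g -> ccont (fun t => (g t)^-1).
Proof.
move=> g0 hg.
have c1 : ccont (fun t => ((normc (g t) ^+ 2)^-1)%:C).
  apply: ccontR => t; apply: cvgV; last exact: ccont_sqr_normc.
  by rewrite sqrf_eq0 normc_eq0.
apply: ccont_ext (ccontM (ccont_conj hg) c1) => t.
have c0 : conjc (g t) != 0 by rewrite -normc_eq0 normc_conj normc_eq0.
by rewrite realCV -mulr_conj invfM mulrCA (mulfV c0) mulr1.
Qed.

Lemma ccont_sum I (s : seq I) (F : I -> R -> R[i]) :
  (forall i, ccont (F i)) -> ccont (fun t => \sum_(i <- s) F i t).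
Proof.
move=> hF; elim: s => [|i s IH].
  by apply: ccont_ext (ccont_cst 0) => t; rewrite big_nil.
by apply: ccont_ext (ccontD (hF i) IH) => t; rewrite big_cons.
Qed.

Lemma measurable_circle : measurable (T : set TR).
Proof. exact: measurable_itv. Qed.
Hint Resolve measurable_circle : core.

Lemma ccont_int g : ccont g -> cintegrable T g.
Proof.
move=> [g1 g2]; split; apply: continuous_compact_integrable;
  [exact: segment_compact|exact: continuous_subspaceT|
   exact: segment_compact|exact: continuous_subspaceT].
Qed.

Lemma pi2_gt0 : 0 < 2 * pi :> R.
Proof. by rewrite mulr_gt0// pi_gt0. Qed.

Lemma cFTC_circle g d : (forall t, is_cderive g t (d t)) -> ccont d ->
  cintegral T d = g (2 * pi) - g 0.
Proof.
move=> dg [d1 d2].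
have part (u v : R -> R) : (forall t, is_derive t (1:R) u (v t)) -> continuous v ->
    \int[mu]_(t in T) v t = u (2 * pi) - u 0.
  move=> du cv; rewrite /Rintegral (@continuous_FTC2 _ v u _ _ pi2_gt0) ?EFinB//.
  - exact: continuous_subspaceT.
  - split => [t _||]; first by [].
      by apply: cvg_at_right_filter; exact: (is_derive_continuous (du 0)).
    by apply: cvg_at_left_filter; exact: (is_derive_continuous (du (2 * pi))).
  - by move=> t _; rewrite derive1E; apply: derive_val.
apply: complex_eqP; rewrite ?Re_add ?Im_add ?Re_opp ?Im_opp /=.
  by apply: (part (fun t => Re (g t))) => // t; have [] := dg t.
by apply: (part (fun t => Im (g t))) => // t; have [] := dg t.
Qed.

(** Covers both e^(it) and e^(-it) in one computation. *)
Definition wave (u : R[i]) (t : R) : R[i] := cexp (u * t%:C).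

Lemma is_cderive_wave u (t : R) : is_cderive (wave u) t (u * wave u t).
Proof.
have h := is_cderive_cexp (is_cderiveZ u (is_cderiveR (is_derive_id t (1:R)))).
by apply: is_cderive_eq h _; rewrite mulr1.
Qed.

Lemma cis_wave : @cis R = wave 'i%C.
Proof. by apply/funext => t; rewrite cisE. Qed.

Lemma ccont_cis : ccont (@cis R).
Proof. by rewrite cis_wave; exact: ccont_cderive (is_cderive_wave _). Qed.

Lemma ccont_wave u : ccont (wave u).
Proof. exact: ccont_cderive (is_cderive_wave u). Qed.

Lemma ccontX g n : ccont g -> ccont (fun t => g t ^+ n).
Proof.
move=> hg; elim: n => [|n IH]; first by apply: ccont_ext (ccont_cst 1).
by apply: ccont_ext (ccontM hg IH) => t; rewrite exprS.
Qed.

Lemma is_cderive_waveX u n (t : R) :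
  is_cderive (fun x => wave u x ^+ n) t (n%:R * u * wave u t ^+ n).
Proof.
elim: n => [|n IH].
  apply: is_cderive_ext (is_cderive_eq (is_cderive_cst 1 t) _) => //.
  by rewrite !mul0r.
apply: is_cderive_ext (is_cderive_eq (is_cderiveM (is_cderive_wave u t) IH) _).
  by move=> x; rewrite exprS.
by rewrite exprS -natr1; ring.
Qed.

Lemma cis2pi : cis (2 * pi) = 1 :> R[i].
Proof. by rewrite mulr_natl /cis cos2pi sin2pi. Qed.

Lemma int_waveX u n : u != 0 -> wave u (2 * pi) = 1 ->
  cintegral T (fun t => wave u t ^+ n) = if n == 0%N then (2 * pi)%:C else 0.
Proof.
move=> u0 u1; case: n => [|n] /=.
  rewrite (_ : cintegral _ _ = (\int[mu]_(t in T) (1 : R))%:C).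
    by rewrite Rintegral_cst// mul1r /= lebesgue_measure_itv /= lte_fin pi2_gt0 /= subr0.
  by rewrite -cintegralR; apply: cintegral_ext => t _; rewrite expr0.
have c : n.+1%:R * u != 0 by rewrite mulf_neq0// pnatr_eq0.
have := cFTC_circle (is_cderive_waveX u n.+1) (ccontM (ccont_cst _) (ccontX n.+1 (ccont_wave u))).
rewrite cintegralZ//; last by apply: ccont_int; apply: ccontX; exact: ccont_wave.
have w0 : wave u 0 = 1 by rewrite /wave mulr0 cexp0.
by rewrite u1 w0 subrr => /eqP; rewrite mulf_eq0 (negbTE c) /= => /eqP.
Qed.

Lemma cis_conj (t : R) : conjc (cis t) = (cis t)^-1.
Proof.
apply: (mulfI (cis_neq0 t)); rewrite mulr_conj normc_cis expr1n divff//.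
exact: cis_neq0.
Qed.

Lemma normc_circle_le g (M : R) : ccont g -> (forall t, normc (g t) <= M) ->
  normc (cintegral T g) <= 2 * pi * M.
Proof.
move=> hg gM.
apply: le_trans (normc_cintegral_le _ (ccont_int hg) (fun t _ => gM t) _) _ => //.
  have [h _] := ccont_int (ccont_cst M%:C).
  by apply: integrable_ext h.
by rewrite Rintegral_cst// mulrC /= lebesgue_measure_itv /= lte_fin pi2_gt0 /= subr0.
Qed.

Lemma i_neq0 : 'i%C != 0 :> R[i].
Proof. by rewrite eq_complex /= oner_eq0 andbF. Qed.

Lemma cisV_wave (t : R) : (cis t)^-1 = wave (- 'i%C) t.
Proof. by rewrite cisE -cexpN -mulNr. Qed.

Lemma int_cisX n : cintegral T (fun t => cis t ^+ n) = if n == 0%N then (2 * pi)%:C else 0.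
Proof. by rewrite cis_wave int_waveX ?i_neq0// -cis_wave cis2pi. Qed.

Lemma int_cisVX n : cintegral T (fun t => (cis t)^-1 ^+ n) = if n == 0%N then (2 * pi)%:C else 0.
Proof.
transitivity (cintegral T (fun t => wave (- 'i%C) t ^+ n)).
  by apply: cintegral_ext => t _; rewrite cisV_wave.
by apply: int_waveX; [rewrite oppr_eq0 i_neq0|rewrite -cisV_wave cis2pi invr1].
Qed.

(** The recurrence pushes b n to z^k b (n+k), with b bounded. *)
Lemma bounded_backward_rec z (b : nat -> R[i]) (M : R) : normc z < 1 ->
  (forall n, b n = z * b n.+1) -> (forall n, normc (b n) <= M) -> forall n, b n = 0.
Proof.
move=> z1 br bM n.
have bk k : b n = z ^+ k * b (n + k)%N.
  elim: k => [|k IH]; first by rewrite expr0 mul1r addn0.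
  by rewrite IH br exprSr mulrA addnS.
apply: Normc.eq0_normc; apply/eqP; rewrite eq_le normc_ge0 andbT.
have cv : (fun k => normc z ^+ k * M) @ \oo --> (0 : R).
  rewrite -[X in _ --> X](mul0r M); apply: cvgM; last exact: cvg_cst.
  by apply: cvg_expr; rewrite ger0_norm ?normc_ge0.
rewrite -(cvg_lim (@Rhausdorff R) cv); apply: limr_ge; first by apply/cvg_ex; exists 0.
by apply: nearW => k; rewrite (bk k) Normc.normcM normcX ler_wpM2l ?exprn_ge0 ?normc_ge0.
Qed.

(** The Schwarz kernel, with e^(it) = [cis t]. *)
Definition skern z (t : R) : R[i] := (cis t + z) / (cis t - z).

Section Kernel.
Variable z : R[i].
Hypothesis zd : disk z.

Lemma cis_sub_neq0 (t : R) : cis t - z != 0.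
Proof.
rewrite subr_eq0; apply/eqP => h; move: zd => /diskE.
by rewrite -h normc_cis ltxx.
Qed.

Lemma ccont_skern : ccont (skern z).
Proof.
apply: ccontM; first by apply: ccontD; [exact: ccont_cis|exact: ccont_cst].
apply: ccontV; first exact: cis_sub_neq0.
by apply: ccontD; [exact: ccont_cis|exact: ccont_cst].
Qed.

Lemma skern_bound (t : R) : normc (skern z t) <= 2 / (1 - normc z).
Proof.
have zd' := zd; move: zd' => /diskE z1; have d : 0 < 1 - normc z by rewrite subr_gt0.
rewrite Normc.normcM Normc.normcV ler_pM ?normc_ge0 ?invr_ge0 ?normc_ge0//.
  by apply: le_trans (normcD _ _) _; rewrite normc_cis; lra.
rewrite lef_pV2 ?posrE ?normc_gt0 ?cis_sub_neq0//.
have := normcD (cis t - z) z; rewrite subrK normc_cis; lra.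
Qed.

Lemma skernE (t : R) : (cis t - z) * skern z t = cis t + z.
Proof. by rewrite /skern mulrCA divff ?mulr1// cis_sub_neq0. Qed.

(* The identity (e^(it) - z) skern = e^(it) + z relates the consecutive Fourier
   coefficients of the kernel; those of one sign vanish because they are bounded
   and satisfy b_n = z b_(n+1). *)
Let A n := cintegral T (fun t => skern z t * cis t ^+ n).
Let B n := cintegral T (fun t => skern z t * (cis t)^-1 ^+ n).

Let iA n : cintegrable T (fun t => skern z t * cis t ^+ n).
Proof. by apply: ccont_int; apply: ccontM; [exact: ccont_skern|apply: ccontX; exact: ccont_cis]. Qed.

Let ccV n : ccont (fun t : R => (cis t)^-1 ^+ n).
Proof. by apply: ccontX; apply: ccontV; [move=> t; exact: cis_neq0|exact: ccont_cis]. Qed.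

Let iB n : cintegrable T (fun t => skern z t * (cis t)^-1 ^+ n).
Proof. by apply: ccont_int; apply: ccontM; [exact: ccont_skern|exact: ccV]. Qed.

Let A_rec n : A n.+1 = z * A n + z * (if n == 0%N then (2 * pi)%:C else 0).
Proof.
have iP k := ccont_int (ccontX k ccont_cis).
transitivity (cintegral T (fun t => z * (skern z t * cis t ^+ n) + (cis t ^+ n.+1 + z * cis t ^+ n))).
  apply: cintegral_ext => t _; have h := skernE t; rewrite exprS.
  transitivity (((cis t - z) * skern z t) * cis t ^+ n + z * (skern z t * cis t ^+ n)); first by ring.
  by rewrite h; ring.
rewrite cintegralD//; [|exact: cintegrableZ|by apply: cintegrableD => //; exact: cintegrableZ].
rewrite cintegralD//; last exact: cintegrableZ.
rewrite !cintegralZ// !int_cisX /= add0r //.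
Qed.

Let B_rec n : B n = z * B n.+1 + (if n == 0%N then (2 * pi)%:C else 0).
Proof.
have iP k := ccont_int (ccV k).
transitivity (cintegral T (fun t => z * (skern z t * (cis t)^-1 ^+ n.+1) + ((cis t)^-1 ^+ n + z * (cis t)^-1 ^+ n.+1))).
  apply: cintegral_ext => t _; have h := skernE t; rewrite exprS.
  have c0 := cis_neq0 t.
  transitivity (((cis t - z) * skern z t) * ((cis t)^-1 * (cis t)^-1 ^+ n) + z * (skern z t * ((cis t)^-1 * (cis t)^-1 ^+ n))).
    rewrite mulrBl mulrBl; set a := _ ^+ n; clearbody a.
    by field.
  by rewrite h; set a := _ ^+ n; clearbody a; field.
rewrite cintegralD//; [|exact: cintegrableZ|by apply: cintegrableD => //; exact: cintegrableZ].
rewrite cintegralD//; last exact: cintegrableZ.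
by rewrite !cintegralZ// !int_cisVX /= mulr0 addr0.
Qed.

Let B_0 n : B n.+1 = 0.
Proof.
have zd' := zd; move: zd' => /diskE z1.
have h1 m : B m.+1 = z * B m.+2 by rewrite [LHS](B_rec m.+1); exact: addr0.
have h2 m : normc (B m.+1) <= 2 * pi * (2 / (1 - normc z)).
  apply: normc_circle_le; first by apply: ccontM; [exact: ccont_skern|exact: ccV].
  move=> t; rewrite Normc.normcM normcX Normc.normcV normc_cis invr1 expr1n mulr1.
  exact: skern_bound.
exact: (@bounded_backward_rec z (fun n => B n.+1) _ z1 h1 h2).
Qed.

Let A_val n : A n.+1 = (4 * pi)%:C * z ^+ n.+1.
Proof.
have A0 : A 0%N = (2 * pi)%:C.
  transitivity (B 0%N); first by apply: cintegral_ext => t _; rewrite !expr0.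
  by rewrite [LHS](B_rec 0) B_0 mulr0 add0r.
elim: n => [|n IH].
  have E : A 1%N = z * A 0%N + z * (2 * pi)%:C := A_rec 0.
  rewrite [LHS]E A0 expr1 (_ : 4 * pi = 2 * pi + 2 * pi :> R); last by ring.
  by rewrite [(2 * pi + _)%:C]realCD [RHS]mulrDl !(mulrC z).
have E : A n.+2 = z * A n.+1 + z * 0 := A_rec n.+1.
by rewrite [LHS]E IH [z ^+ n.+2]exprS mulr0 addr0 mulrCA.
Qed.

(** The real part splits into a power of e^(it) and a power of e^(-it); only the
    former contributes. *)
Lemma schwarz_monomial (c : R[i]) n :
  cintegral T (fun t => skern z t * (Re (c * cis t ^+ n.+1))%:C) = (2 * pi)%:C * (c * z ^+ n.+1).
Proof.
have half (x : R[i]) : (Re x)%:C = 2^-1 * (x + (conjc x)).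
  by rewrite ReJ_add mulrC.
transitivity (cintegral T (fun t => (c / 2) * (skern z t * cis t ^+ n.+1) +
                             ((conjc c) / 2) * (skern z t * (cis t)^-1 ^+ n.+1))).
  apply: cintegral_ext => t _; rewrite half conjcM conjcX cis_conj.
  by set a := _ ^+ _; set a' := _ ^+ _; clearbody a a'; field.
rewrite cintegralD//; [|exact: cintegrableZ..].
rewrite !cintegralZ// -/(A n.+1) -/(B n.+1) A_val B_0 mulr0 addr0.
rewrite (_ : 4 * pi = 2 * (2 * pi) :> R); last by ring.
rewrite realCM (_ : 2%:C = 2 :> R[i]); last exact: rmorph_nat.
by field.
Qed.

Lemma schwarz_logp (b : R[i]) N :
  cintegral T (fun t => skern z t * (Re (logp N (b * cis t)))%:C) = (2 * pi)%:C * logp N (b * z).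
Proof.
pose c k : R[i] := - (b ^+ k.+1 / k.+1%:R).
have E w : logp N (b * w) = \sum_(0 <= k < N) c k * w ^+ k.+1.
  rewrite /logp -sumrN; apply: eq_bigr => k _; rewrite /c exprMn; ring.
rewrite E mulr_sumr.
transitivity (cintegral T (fun t => \sum_(0 <= k < N) skern z t * (Re (c k * cis t ^+ k.+1))%:C)).
  by apply: cintegral_ext => t _; rewrite E Re_sum rmorph_sum mulr_sumr.
rewrite cintegral_sum//; last first.
  move=> k; apply: ccont_int; apply: ccontM; first exact: ccont_skern.
  apply: ccontR; apply: (ccontM (ccont_cst _) (ccontX _ ccont_cis)).1.
by apply: eq_bigr => k _; exact: schwarz_monomial.
Qed.

End Kernel.
End Circle.
#[export] Hint Resolve measurable_circle : core.

(** * Outer functions *)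
Section Outer.
Variable R : realType.
Notation mu := (@lebesgue_measure R).
Notation TR := (measurableTypeR R).
Notation T := (`[0, 2 * pi]%classic : set R).
Implicit Types (z w b : R[i]) (s : seq R[i]).

Lemma cvgc_Im (U : Type) (F : set_system U) {FF : Filter F} (f : U -> R[i]) (l : R[i]) :
  ((f : U -> R[i]^o) @ F --> (l : R[i]^o)) -> ((fun t => Im (f t)) @ F --> Im l).
Proof.
move=> /cvgcP h; apply/cvgrPdist_lt => e /h; apply: filterS => x.
apply: le_lt_trans; rewrite -[X in _ <= X]normcNN opprB -Im_opp -Im_add.
exact: normc_geIm.
Qed.

Lemma cvgc_unique (U : Type) (F : set_system U) {FF : ProperFilter F} (f : U -> R[i]) (l m : R[i]) :
  ((f : U -> R[i]^o) @ F --> (l : R[i]^o)) -> ((f : U -> R[i]^o) @ F --> (m : R[i]^o)) -> l = m.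
Proof.
move=> h1 h2; apply: complex_eqP.
  have a : (fun t => Re (f t)) @ F --> Re l by exact: cvgc_Re.
  have b : (fun t => Re (f t)) @ F --> Re m by exact: cvgc_Re.
  by rewrite -(cvg_lim (@Rhausdorff R) a) -(cvg_lim (@Rhausdorff R) b).
have a : (fun t => Im (f t)) @ F --> Im l by exact: cvgc_Im.
have b : (fun t => Im (f t)) @ F --> Im m by exact: cvgc_Im.
by rewrite -(cvg_lim (@Rhausdorff R) a) -(cvg_lim (@Rhausdorff R) b).
Qed.

Lemma cvgc_cexp (U : Type) (F : set_system U) {FF : Filter F} (f : U -> R[i]) (l : R[i]) :
  ((f : U -> R[i]^o) @ F --> (l : R[i]^o)) ->
  (((fun t => cexp (f t)) : U -> R[i]^o) @ F --> (cexp l : R[i]^o)).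
Proof.
move=> h; have h1 := cvgc_Re h; have h2 := cvgc_Im h.
have e1 : (fun t => expR (Re (f t))) @ F --> expR (Re l).
  by apply: continuous_cvg; [exact: continuous_expR|exact: h1].
have c1 : (fun t => cos (Im (f t))) @ F --> cos (Im l).
  by apply: continuous_cvg; [exact: continuous_cos|exact: h2].
have s1 : (fun t => sin (Im (f t))) @ F --> sin (Im l).
  by apply: continuous_cvg; [exact: continuous_sin|exact: h2].
apply: cvgc_ReIm; rewrite ?Re_cexp ?Im_cexp.
  by under eq_cvg do rewrite Re_cexp; apply: cvgM.
by under eq_cvg do rewrite Im_cexp; apply: cvgM.
Qed.

Lemma cvgc_geometric (u : nat -> R[i]) l (C rho : R) : 0 <= rho < 1 ->
  (\forall n \near \oo, normc (u n - l) <= C * rho ^+ n) ->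
  (u : nat -> R[i]^o) @ \oo --> (l : R[i]^o).
Proof.
move=> /andP[r0 r1] h; apply/cvgcP => e e0.
have cv : (fun k => C * rho ^+ k) @ \oo --> (0 : R).
  rewrite -[X in _ --> X](mulr0 C); apply: cvgM; first exact: cvg_cst.
  by apply: cvg_expr; rewrite ger0_norm.
move/cvgrPdist_lt : cv => /(_ _ e0); apply: filterS2 h => n h1.
by rewrite sub0r normrN => /(le_lt_trans (ler_norm _)); exact: le_lt_trans.
Qed.

Lemma ccont_1sub b : ccont (fun t : R => 1 - b * cis t).
Proof.
apply: ccont_ext (ccontD (ccont_cst 1) (ccontM (ccont_cst (- b)) (@ccont_cis R))) => t.
by rewrite mulNr.
Qed.

Lemma normc_bcis b (t : R) : normc (b * cis t) = normc b.
Proof. by rewrite Normc.normcM normc_cis mulr1. Qed.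

Lemma ccont_ln1sub b : normc b < 1 ->
  ccont (fun t : R => (ln (normc (1 - b * cis t)))%:C).
Proof.
move=> b1; apply: ccontR => t.
have p : 0 < normc (1 - b * cis t) by apply: normc_1sub_gt0; rewrite normc_bcis.
apply: (@continuous_comp _ _ _ (fun t => normc (1 - b * cis t)) (@ln R)).
  exact: (ccont_normc (ccont_1sub b)).
exact: continuous_ln.
Qed.

Lemma ccont_logp b N : ccont (fun t : R => (Re (logp N (b * cis t)))%:C).
Proof.
apply: ccontR; apply: (proj1 (_ : ccont (fun t : R => logp N (b * cis t)))).
have h k : ccont (fun t : R => - (k.+1%:R)^-1 * (b * cis t) ^+ k.+1).
  apply: ccontM; first exact: ccont_cst.
  by apply: ccontX; apply: ccontM; [exact: ccont_cst|exact: ccont_cis].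
apply: ccont_ext (ccont_sum (index_iota 0 N) h) => t.
by rewrite /logp -sumrN; apply: eq_bigr => k _; rewrite mulNr mulrC.
Qed.

(** Schwarz formula for log|1 - b e^(it)|, by uniform approximation of the
    logarithm by the polynomials [logp N]. *)
Lemma schwarz_log1sub b z : normc b < 1 -> disk z ->
  cexp ((2 * pi)^-1%:C * cintegral T (fun t => skern z t * (ln (normc (1 - b * cis t)))%:C)) = 1 - b * z.
Proof.
move=> b1 zd; set J := cintegral _ _; set I := _ * J.
have rho01 : 0 <= normc b < 1 by rewrite normc_ge0.
have [C C0 hC] := cexp_logp rho01.
have pi2 := @pi2_gt0 R; have pi0 : (2 * pi)%:C != 0 :> R[i] by rewrite gt_eqF// ltcR.
have z1 : 0 < 1 - normc z by rewrite subr_gt0; exact/diskE.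
have bz : normc (b * z) <= normc b.
  by rewrite Normc.normcM ler_piMr ?normc_ge0// ltW//; exact/diskE.
have small : \forall N \near \oo, C * normc b ^+ N <= 2^-1.
  have cv : (fun k => C * normc b ^+ k) @ \oo --> (0 : R).
    rewrite -[X in _ --> X](mulr0 C); apply: cvgM; first exact: cvg_cst.
    by apply: cvg_expr; rewrite ger0_norm ?normc_ge0.
  have h0 : (0 : R) < 2^-1 by rewrite invr_gt0.
  move/cvgrPdist_lt : cv => /(_ _ h0); apply: filterS => n.
  by rewrite sub0r normrN => h; apply: le_trans (ltW h); exact: ler_norm.
have key : \forall N \near \oo, normc (logp N (b * z) - I) <= (2 / (1 - normc z) * 2 * C) * normc b ^+ N.
  apply: filterS small => N hN.
  have e0 : 0 <= C * normc b ^+ N by rewrite mulr_ge0 ?exprn_ge0 ?normc_ge0.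
  pose g t := skern z t * ((Re (logp N (b * cis t)))%:C - (ln (normc (1 - b * cis t)))%:C).
  have i1 : cintegrable T (fun t => skern z t * (Re (logp N (b * cis t)))%:C).
    by apply: ccont_int; apply: ccontM; [exact: ccont_skern|exact: ccont_logp].
  have i2 : cintegrable T (fun t => skern z t * (ln (normc (1 - b * cis t)))%:C).
    by apply: ccont_int; apply: ccontM; [exact: ccont_skern|exact: ccont_ln1sub].
  have E : logp N (b * z) - I = (2 * pi)^-1%:C * cintegral T g.
    rewrite (_ : cintegral T g = (2 * pi)%:C * logp N (b * z) - J).
      by rewrite /I realCV mulrBr mulKf.
    rewrite -schwarz_logp// -cintegralB//.
    by apply: cintegral_ext => t _; rewrite /g mulrBr.
  have hg : normc (cintegral T g) <= 2 * pi * (2 / (1 - normc z) * (2 * (C * normc b ^+ N))).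
    apply: normc_circle_le.
      apply: ccontM; first exact: ccont_skern.
      apply: ccont_ext (ccontD (ccont_logp b N) (ccontM (ccont_cst (-1)) (ccont_ln1sub b1))) => t.
      by rewrite mulN1r.
    move=> t; rewrite /g Normc.normcM ler_pM ?normc_ge0//; first exact: skern_bound.
    rewrite -realCN -realCD normcR distrC; apply: ln_logp => //; first by rewrite normc_bcis.
    by apply: hC; rewrite normc_bcis.
  rewrite E Normc.normcM normcR ger0_norm ?invr_ge0 ?(ltW pi2)//.
  rewrite ler_pdivrMl//; apply: le_trans hg _.
  by rewrite le_eqVlt; apply/orP; left; apply/eqP; ring.
have lim1 := cvgc_geometric rho01 key.
have lim0 : ((fun=> 0) : nat -> R[i]^o) @ \oo --> (0 : R[i]^o) by exact: cvg_cst.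
have lim2 : ((fun N => cexp (-1 * logp N (b * z) + 0)) : nat -> R[i]^o) @ \oo --> (cexp (-1 * I + 0) : R[i]^o).
  by apply: cvgc_cexp; exact: cvgc_lin.
have lim3 : ((fun N => (1 - b * z) * cexp (-1 * logp N (b * z) + 0) + 0) : nat -> R[i]^o) @ \oo -->
    ((1 - b * z) * cexp (-1 * I + 0) + 0 : R[i]^o).
  exact: (@cvgc_lin R nat \oo _ (1 - b * z) (fun N => cexp (-1 * logp N (b * z) + 0)) (fun=> 0) _ _ lim2 lim0).
have lim4 : ((fun N => (1 - b * z) * cexp (-1 * logp N (b * z) + 0) + 0) : nat -> R[i]^o) @ \oo --> (1 : R[i]^o).
  apply: (@cvgc_geometric _ _ C (normc b)) => //; apply: nearW => N.
  by rewrite !addr0 mulN1r mulrC; exact: hC.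
have := cvgc_unique lim3 lim4; rewrite !addr0 mulN1r cexpN => h.
have e0 := cexp_neq0 I.
by apply/esym/(mulIf (invr_neq0 e0)); rewrite h mulfV.
Qed.

Definition prod1sub s z := \prod_(b <- s) (1 - b * z).

Lemma normc_prod_gt0 s (w : R[i]) : all (fun b => normc b < 1) s -> normc w <= 1 ->
  0 < normc (prod1sub s w).
Proof.
move=> + w1; rewrite /prod1sub; elim: s => [|b s IH] /=.
  by rewrite big_nil Normc.normc1.
move=> /andP[b1 hs]; rewrite big_cons Normc.normcM mulr_gt0 ?IH//.
apply: normc_1sub_gt0; rewrite Normc.normcM; apply: le_lt_trans b1.
by rewrite ler_piMr ?normc_ge0.
Qed.

(** Both sides are multiplicative in s, the logarithm turning products into sums
    under the integral. *)
Lemma schwarz_prod1sub s z : all (fun b => normc b < 1) s -> disk z ->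
  ccont (fun t : R => (ln (normc (prod1sub s (cis t))))%:C) /\
  cexp ((2 * pi)^-1%:C * cintegral T (fun t => skern z t * (ln (normc (prod1sub s (cis t))))%:C)) =
  prod1sub s z.
Proof.
move=> + zd; elim: s => [_|b s IH /= /andP[b1 hs]].
  have E t : (ln (normc (prod1sub [::] (cis t))))%:C = 0 :> R[i].
    by rewrite /prod1sub big_nil Normc.normc1 ln1.
  split; first by apply: ccont_ext (ccont_cst 0) => t; rewrite E.
  rewrite (_ : cintegral _ _ = 0) ?mulr0 ?cexp0 /prod1sub ?big_nil//.
  by rewrite -[RHS](cintegral0 T); apply: cintegral_ext => t _; rewrite E mulr0.
have [cs Es] := IH hs; have cb := ccont_ln1sub b1.
have E t : (ln (normc (prod1sub (b :: s) (cis t))))%:C =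
    (ln (normc (1 - b * cis t)))%:C + (ln (normc (prod1sub s (cis t))))%:C :> R[i].
  rewrite -realCD; congr (_%:C); rewrite {1}/prod1sub big_cons Normc.normcM lnM//.
    by rewrite posrE; apply: normc_1sub_gt0; rewrite normc_bcis.
  by rewrite posrE; apply: normc_prod_gt0; rewrite ?normc_cis.
split; first by apply: ccont_ext (ccontD cb cs) => t; rewrite E.
rewrite {2}/prod1sub big_cons -/(prod1sub s z) -(schwarz_log1sub b1 zd) -{}Es -cexpD -mulrDr.
have cz := ccont_skern zd.
rewrite -cintegralD//; [|by apply: ccont_int; exact: ccontM..].
by congr (cexp (_ * _)); apply: cintegral_ext => t _; rewrite E mulrDr.
Qed.

Lemma boundary_prod1sub s F (t : R) : (forall z, disk z -> F z = prod1sub s z) ->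
  boundary F t = prod1sub s (cis t).
Proof.
move=> hF; rewrite /boundary; apply: (@cvg_lim R[i]^o); first exact: norm_hausdorff.
have cs : ccont (fun r : R => prod1sub s (r%:C * cis t)).
  elim: s {hF} => [|b s IH].
    by apply: ccont_ext (ccont_cst 1) => r; rewrite /prod1sub big_nil.
  have cid : ccont (fun r : R => r%:C) by apply: ccontR => r; exact: cvg_id.
  have c1 : ccont (fun r : R => 1 + (- (b * cis t)) * r%:C).
    by apply: ccontD; [exact: ccont_cst|apply: ccontM => //; exact: ccont_cst].
  apply: ccont_ext (ccontM c1 IH) => r; rewrite /prod1sub big_cons; congr (_ * _).
  by ring.
have [c1 c2] := cs.
have lim : ((fun r : R => prod1sub s (r%:C * cis t)) : R -> R[i]^o) @ (1 : R)^'- --> (prod1sub s (cis t) : R[i]^o).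
  rewrite -[cis t in X in _ --> X]mul1r.
  by apply: cvgc_ReIm; apply: cvg_at_left_filter; [exact: c1|exact: c2].
have rd : \forall r \near (1 : R)^'-, disk (r%:C * cis t).
  near=> r; have r0 : 0 < r by near: r; apply: nbhs_left_gt; exact: ltr01.
  have r1 : r < 1 by near: r; exact: nbhs_left_lt.
  by apply/diskE; rewrite Normc.normcM normc_cis mulr1 normcR gtr0_norm.
move/cvgcP : lim => lim; apply/cvgcP => e e0.
by apply: filterS2 rd (lim e e0) => r rd; rewrite hF.
Unshelve. all: by end_near. Qed.

(** The product is continuous up to the circle, so its radial limits are its
    values and the Schwarz formula is the one of [schwarz_prod1sub]. *)
Lemma outer_prod1sub s F : all (fun b => normc b < 1) s -> hardy2 F ->
  (forall z, disk z -> F z = prod1sub s z) -> outer F.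
Proof.
move=> hs hF FE; split=> //.
  exists 0; first exact: disk0.
  by rewrite (FE _ (@disk0 R)) /prod1sub big1 ?oner_eq0// => b _; rewrite mulr0 subr0.
exists 1; first by rewrite normr1.
move=> z zd; rewrite mul1r FE// -(schwarz_prod1sub hs zd).2; congr (cexp (_ * _)).
by apply: cintegral_ext => t _; rewrite (boundary_prod1sub t FE).
Qed.

End Outer.

(** * Time shifts *)
Section TimeShift.
Variable R : realType.
Notation mu := (@lebesgue_measure R).
Notation TR := (measurableTypeR R).
Notation Rp := (@Rplus R).

Let sh (tau : R) : TR -> TR := fun t => t - tau.

Let msh tau : measurable_fun [set: TR] (sh tau).
Proof. by apply: measurable_funB; [exact: measurable_id|exact: measurable_cst]. Qed.

Lemma lebesgue_measure_shift (tau : R) (A : set R) : measurable (A : set TR) ->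
  pushforward mu (sh tau) A = mu A.
Proof.
move=> mA; apply/esym.
pose mshm := isMeasurableFun.Build _ _ _ _ _ (msh tau).
pose shm : {mfun TR >-> TR} := HB.pack (sh tau) mshm.
apply: (@lebesgue_measure_unique _ (pushforward mu shm)) mA => _ [[a b]] _ <-.
have E : shm @^-1` `]a, b]%classic = `]a + tau, b + tau]%classic.
  by apply/seteqP; split => t /=; rewrite !in_itv /= ltrBrDr lerBlDr.
change (mu `]a, b]%classic = mu (shm @^-1` `]a, b]%classic)).
rewrite E !lebesgue_measure_itv /= !lte_fin ltrD2r.
by case: ifP => // _; rewrite -!EFinB; congr (_%:E); ring.
Qed.

Lemma integral_shift (tau : R) (F : R -> R) : measurable_fun [set: TR] F ->
  (\int[mu]_t (F (t - tau)%R)%:E = \int[mu]_t (F t)%:E)%E.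
Proof.
move=> mF.
have pos (G : R -> \bar R) : measurable_fun [set: TR] G -> (forall t, 0 <= G t)%E ->
    (\int[mu]_t (G (t - tau)%R) = \int[mu]_t (G t))%E.
  move=> mG G0; have := @ge0_integral_pushforward _ _ TR TR R (sh tau) (msh tau) mu setT G
    measurableT mG (fun t _ => G0 t).
  rewrite preimage_setT => <-; apply: eq_measure_integral => A mA _.
  exact: lebesgue_measure_shift.
have mE : measurable_fun [set: TR] (fun t => (F t)%:E) by exact/measurable_EFinP.
have p1 := pos _ (measurable_funepos mE) (fun t => funepos_ge0 _ t).
have p2 := pos _ (measurable_funeneg mE) (fun t => funeneg_ge0 _ t).
rewrite integralE [RHS]integralE -p1 -p2; congr (_ - _)%E.
  by apply: eq_integral => t _; rewrite !funeposE.
by apply: eq_integral => t _; rewrite !funenegE.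
Qed.

Lemma shiftE (tau : R) (u : R -> R) (t : R) :
  (u \_ Rp) (t - tau) = if tau <= t then u (t - tau) else 0.
Proof.
rewrite patchE; case: ifPn => h.
  by move: h; rewrite inE RplusE subr_ge0 => ->.
by case: ifPn => // ht; move: h; rewrite notin_setE RplusE subr_ge0 ht.
Qed.

Lemma measurable_shift (tau : R) (u : R -> R) : measurable_fun (Rp : set TR) u ->
  measurable_fun [set: TR] (fun t : R => if tau <= t then u (t - tau) else 0).
Proof.
move=> mu_; have mU : measurable_fun [set: TR] (u \_ Rp).
  exact: (proj1 (@measurable_restrictT _ _ TR _ Rp u (@measurable_Rplus R)) mu_).
rewrite (_ : (fun t => _) = (u \_ Rp) \o (sh tau)).
  by apply: measurableT_comp => //; exact: msh.
by apply/funext => t /=; rewrite shiftE.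
Qed.

Lemma Rintegral_shift (tau : R) (u : R -> R) : 0 <= tau -> measurable_fun (Rp : set TR) u ->
  \int[mu]_(t in Rp) (if tau <= t then u (t - tau) else 0) = \int[mu]_(t in Rp) u t.
Proof.
move=> tau0 mu_; have mU : measurable_fun [set: TR] (u \_ Rp).
  exact: (proj1 (@measurable_restrictT _ _ TR _ Rp u (@measurable_Rplus R)) mu_).
rewrite Rintegral_mkcond [RHS]Rintegral_mkcond /Rintegral; congr fine.
rewrite -[RHS](integral_shift tau mU); apply: eq_integral => t _.
rewrite shiftE patchE; case: ifPn => // h.
case: ifPn => // ht; move: h; rewrite notin_setE RplusE => h2.
by exfalso; apply: h2; exact: le_trans ht.
Qed.

Lemma Re_time_shift tau (G : R -> R[i]) t :
  Re (time_shift tau G t) = if tau <= t then Re (G (t - tau)) else 0.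
Proof. by rewrite /time_shift; case: ifP. Qed.

Lemma Im_time_shift tau (G : R -> R[i]) t :
  Im (time_shift tau G t) = if tau <= t then Im (G (t - tau)) else 0.
Proof. by rewrite /time_shift; case: ifP. Qed.

Lemma cintegral_shift tau (G : R -> R[i]) : 0 <= tau -> cmeasurable Rp G ->
  cintegral Rp (time_shift tau G) = cintegral Rp G.
Proof.
move=> tau0 [m1 m2]; apply: complex_eqP => /=.
  rewrite -(Rintegral_shift tau0 m1); apply: eq_Rintegral => t _.
  exact: Re_time_shift.
rewrite -(Rintegral_shift tau0 m2); apply: eq_Rintegral => t _.
exact: Im_time_shift.
Qed.

Lemma cmeasurable_shift tau (G : R -> R[i]) : cmeasurable Rp G ->
  cmeasurable Rp (time_shift tau G).
Proof.
move=> [m1 m2]; split.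
  under eq_fun do rewrite Re_time_shift.
  by apply: measurable_funTS; exact: (measurable_shift tau m1).
under eq_fun do rewrite Im_time_shift.
by apply: measurable_funTS; exact: (measurable_shift tau m2).
Qed.

Lemma hkerD (z : R[i]) (s t : R) : hker z (s + t) = hker z s * hker z t.
Proof. by rewrite /hker -cexpD realCD; congr cexp; rewrite !mulrDl. Qed.

(** Changing variables in the integral, because [hker z] turns sums into
    products. *)
Lemma Hmap_shift tau (f g : R -> R[i]) (z : R[i]) : disk z -> 0 <= tau -> L2 f -> L2 g ->
  L2eq g (time_shift tau f) -> Hmap g z = hker z tau * Hmap f z.
Proof.
move=> zd tau0 Lf Lg gf; have Lk := L2_hker zd; have mRp := @measurable_Rplus R.
have ifk := L2M_int Lf Lk.
rewrite !HmapE mulrCA; congr (_ * _); rewrite -cintegralZ//.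
pose G t := hker z tau * (f t * hker z t).
have mG : cmeasurable Rp G by exact: (cmeasurableM mRp (cmeasurable_cst _ mRp) (cintegrable_measurable ifk)).
rewrite -/G -(cintegral_shift tau0 mG); apply: cintegral_ae => //.
- exact: cintegrable_measurable (L2M_int Lg Lk).
- exact: cmeasurable_shift.
apply: filterS gf => t /= h Dt; rewrite (h Dt) /time_shift /G.
case: ifP => _; last by rewrite mul0r.
have -> : hker z t = hker z tau * hker z (t - tau).
  by rewrite -hkerD; congr (hker z _); ring.
by ring.
Qed.

(** The transform is a unimodular constant times two exponentials. *)
Lemma shifted_min_phase_neq0 (g : R -> R[i]) (z : R[i]) : shifted_min_phase g -> disk z ->
  Hmap g z != 0.
Proof.
move=> [Lg [f [tau [[Lf [_ _ [lam lam1 oF]]] tau0 gf]]]] zd.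
rewrite (Hmap_shift zd tau0 Lf Lg gf) oF//; apply: mulf_neq0; first exact: cexp_neq0.
apply: mulf_neq0; last exact: cexp_neq0.
by apply/eqP => l0; move: lam1; rewrite l0 normr0 => /esym/eqP; rewrite oner_eq0.
Qed.

End TimeShift.

(** * Analyticity *)
Lemma derivable_quot (K : numFieldType) (f g : K^o -> K^o) z :
  derivable f z 1 -> derivable g z 1 -> g z != 0 -> derivable (fun x => f x / g x) z 1.
Proof.
move=> df dg g0; have h := @derivableV K K^o g z 1 g0 dg.
exact: (@derivableM K K^o f (fun x => (g x)^-1) z 1 df h).
Qed.

Section Analytic.
Variable R : realType.
Implicit Types (z x D : R[i]) (F : R[i] -> R[i]).

Lemma second_order_derivable F z D (d B : R) : 0 < d ->
  (forall x, normc (x - z) < d ->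
     normc (F x - F z - (x - z) * D) <= B * normc (x - z) ^+ 2) ->
  derivable (F : R[i]^o -> R[i]^o) z 1.
Proof.
move=> d0 h; apply/cvg_ex; exists D; apply/cvgcP => e e0.
have d0' : (0 : R[i]) < d%:C by rewrite ltcR.
have B0 : 0 < `|B| + 1 by rewrite ltr_wpDl.
have e1 : (0 : R[i]) < (e / (`|B| + 1))%:C by rewrite ltcR divr_gt0.
near=> k.
have k0 : k != 0 by near: k; exact: nbhs_dnbhs_neq.
have kd : `|k| < d%:C by near: k; exact: (@dnbhs0_lt R[i] R[i]^o).
have ke : `|k| < (e / (`|B| + 1))%:C by near: k; exact: (@dnbhs0_lt R[i] R[i]^o).
rewrite normE ltcR in kd; rewrite normE ltcR in ke.
have -> : k^-1 *: ((F \o shift z) (k *: 1) - F z) - D = k^-1 * (F (k + z) - F z - k * D).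
  by rewrite /GRing.scale /= mulr1 [RHS]mulrBr mulKf.
have := h (k + z); rewrite addrK => /(_ kd) hk.
have nk : 0 < normc k by rewrite normc_gt0.
rewrite Normc.normcM Normc.normcV mulrC ltr_pdivrMr//; apply: le_lt_trans hk _.
move: ke; rewrite ltr_pdivlMr// => ke.
rewrite expr2 mulrA ltr_pM2r//; apply: le_lt_trans ke.
rewrite mulrC ler_wpM2l ?normc_ge0//; apply: le_trans (ler_norm B) _.
by rewrite lerDl.
Unshelve. all: by end_near. Qed.

(** Taylor remainder of a power, from T_(n+1) = x T_n + n z^(n-1) (x-z)^2. *)
Lemma power_remainder x z (r : R) n : 0 < r -> normc x <= r -> normc z <= r ->
  normc (x ^+ n - z ^+ n - n%:R * z ^+ n.-1 * (x - z)) * r ^+ 2 <=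
  normc (x - z) ^+ 2 * (n%:R ^+ 2 * r ^+ n).
Proof.
move=> r0 xr zr; elim: n => [|n IH].
  have -> : x ^+ 0 - z ^+ 0 - 0%:R * z ^+ 0.-1 * (x - z) = 0 by rewrite !expr0; ring.
  by rewrite Normc.normc0 mul0r expr0 mulr1; apply: mulr_ge0; exact: sqr_ge0.
have -> : x ^+ n.+1 - z ^+ n.+1 - n.+1%:R * z ^+ n.+1.-1 * (x - z) =
    x * (x ^+ n - z ^+ n - n%:R * z ^+ n.-1 * (x - z)) + n%:R * z ^+ n.-1 * (x - z) ^+ 2.
  case: n {IH} => [|n] /=; first by rewrite !expr0 !expr1; ring.
  by rewrite -[n.+2%:R]natr1 !(exprS _ n.+1) (exprS z n); ring.
set T := _ - _ - _ in IH *.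
have zn : normc (n%:R * z ^+ n.-1) * r <= n%:R * r ^+ n.
  case: n {IH T} => [|n]; first by rewrite mul0r Normc.normc0 !mul0r.
  rewrite Normc.normcM -(rmorph_nat (real_complex R)) normcR normr_nat normcX /= -mulrA.
  by rewrite ler_wpM2l// exprSr ler_wpM2r ?(ltW r0)// lerXn2r ?nnegrE ?normc_ge0 ?(ltW r0).
apply: le_trans (ler_wpM2r (sqr_ge0 r) (normcD _ _)) _.
rewrite mulrDl (Normc.normcM x) [normc (_ * (x - z) ^+ 2)]Normc.normcM normcX.
have a1 : normc x * normc T * r ^+ 2 <= r * (normc (x - z) ^+ 2 * (n%:R ^+ 2 * r ^+ n)).
  rewrite -mulrA; apply: ler_pM => //; first exact: normc_ge0.
  by rewrite mulr_ge0 ?normc_ge0 ?sqr_ge0.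
have a2 : normc (n%:R * z ^+ n.-1) * normc (x - z) ^+ 2 * r ^+ 2 <=
    normc (x - z) ^+ 2 * (n%:R * r ^+ n) * r.
  rewrite (_ : _ * r ^+ 2 = normc (x - z) ^+ 2 * (normc (n%:R * z ^+ n.-1) * r) * r); last by ring.
  by rewrite ler_wpM2r ?(ltW r0)// ler_wpM2l ?sqr_ge0.
apply: le_trans (lerD a1 a2) _.
rewrite (_ : _ + _ = normc (x - z) ^+ 2 * ((n%:R ^+ 2 + n%:R) * r ^+ n.+1)); last first.
  by rewrite [r ^+ n.+1]exprSr; ring.
rewrite ler_wpM2l ?sqr_ge0// ler_wpM2r ?exprn_ge0 ?(ltW r0)//.
by rewrite -[n.+1%:R]natr1; have : 0 <= n%:R :> R by []; nra.
Qed.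

Lemma poly_geometric_sum (r : R) : 0 < r < 1 -> exists2 B, 0 <= B &
  forall M, \sum_(0 <= n < M) n%:R ^+ 2 * r ^+ n <= B.
Proof.
move=> /andP[r0 r1].
pose d := - (ln r) / 2; have ln0 : ln r < 0 by rewrite ln_lt0 ?r0.
have d0 : 0 < d by rewrite /d divr_gt0// oppr_gt0.
have [C C0 hC] := @poly_le_exp R 'X^2 d d0.
pose q := expR (- d); have q01 : 0 <= q < 1 by rewrite expR_ge0 expR_lt1 oppr_lt0.
exists (C * (1 - q)^-1).
  by rewrite mulr_ge0// invr_ge0 subr_ge0 ltW//; have /andP[] := q01.
move=> M; apply: le_trans (ler_wpM2l C0 (sum_geom_le M q01)).
rewrite mulr_sumr; apply: ler_sum => n _.
have := hC n%:R (ler0n _ _); rewrite hornerXn ger0_norm ?sqr_ge0// => h.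
have rn : r ^+ n = expR (- (2 * d) * n%:R).
  by rewrite expRM_natr (_ : - (2 * d) = ln r) ?lnK ?posrE// /d; field.
apply: le_trans (ler_wpM2r (exprn_ge0 n (ltW r0)) h) _.
rewrite -mulrA ler_wpM2l// rn -expRD /q -expRM_natr ler_expR.
by rewrite le_eqVlt; apply/orP; left; apply/eqP; ring.
Qed.

Lemma cvgc_norm_le (u : nat -> R[i]) (l : R[i]) (B : R) :
  (u : nat -> R[i]^o) @ \oo --> (l : R[i]^o) -> (forall n, normc (u n) <= B) -> normc l <= B.
Proof.
move=> /cvgcP h uB; apply/ler_addgt0Pl => e e0.
have [n _ /(_ n (leqnn n)) hn] := h e e0.
have -> : l = u n - (u n - l) by ring.
by apply: le_trans (normcD _ _) _; rewrite normcNN addrC lerD// ltW.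
Qed.

Lemma abs_cvg_series (u : nat -> R) (B : R) :
  (forall M, \sum_(0 <= n < M) `|u n| <= B) -> cvgn (series u).
Proof.
move=> h; have cv : cvgn (series (fun n => `|u n|)).
  apply: nondecreasing_is_cvgn.
    by apply/nondecreasing_seqP => n; rewrite /series /= big_nat_recr //= lerDl.
  by exists B => _ [M _ <-]; exact: h.
by apply: normed_cvg; exact: cv.
Qed.

Lemma abs_cvgc_series (u : nat -> R[i]) (B : R) :
  (forall M, \sum_(0 <= n < M) normc (u n) <= B) ->
  exists D : R[i], (fun M => \sum_(0 <= n < M) u n : R[i]^o) @ \oo --> (D : R[i]^o).
Proof.
move=> h.
have /cvg_ex[a ha] : cvgn (series (fun n => Re (u n))).
  apply: (@abs_cvg_series _ B) => M; apply: le_trans (h M).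
  by apply: ler_sum => n _; exact: normc_geRe.
have /cvg_ex[b hb] : cvgn (series (fun n => Im (u n))).
  apply: (@abs_cvg_series _ B) => M; apply: le_trans (h M).
  by apply: ler_sum => n _; exact: normc_geIm.
exists (a +i* b); apply: cvgc_ReIm => /=.
  by under eq_fun do rewrite Re_sum; exact: ha.
by under eq_fun do rewrite Im_sum; exact: hb.
Qed.

(** The bound of [power_remainder] is summable over n for a radius r with
    |z| < r < 1, and passes to the limit of the partial sums. *)
Lemma power_series_analytic F (a : nat -> R[i]) (C : R) :
  (forall n, normc (a n) <= C) ->
  (forall z, disk z -> (fun M => \sum_(0 <= n < M) a n * z ^+ n : R[i]^o) @ \oo --> (F z : R[i]^o)) ->
  analytic_on_disk F.
Proof.
move=> aC hF z zd; have C0 : 0 <= C by apply: le_trans (aC 0%N); exact: normc_ge0.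
have zd' := zd; move: zd' => /diskE z1.
pose r := (1 + normc z) / 2.
have z0 := normc_ge0 z.
have r01 : 0 < r < 1 by rewrite /r; apply/andP; split; lra.
have [r0 r1] := andP r01.
have zr : normc z <= r by rewrite /r; lra.
have [B B0 hB] := poly_geometric_sum r01.
have [D hD] : exists D : R[i], (fun M => \sum_(0 <= n < M) a n * (n%:R * z ^+ n.-1) : R[i]^o) @ \oo --> (D : R[i]^o).
  apply: (@abs_cvgc_series _ (C / r * B)) => M.
  apply: le_trans (ler_wpM2l _ (hB M)); last by rewrite divr_ge0// ltW.
  rewrite mulr_sumr; apply: ler_sum => n _.
  rewrite Normc.normcM; case: n => [|n].
    by rewrite mul0r Normc.normc0 mulr0 !mulr_ge0 ?invr_ge0 ?sqr_ge0 ?exprn_ge0 ?(ltW r0).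
  rewrite -mulrA; apply: ler_pM; rewrite ?normc_ge0//.
  rewrite Normc.normcM -(rmorph_nat (real_complex R)) normcR normr_nat normcX /=.
  rewrite (_ : r^-1 * _ = n.+1%:R ^+ 2 * r ^+ n); last by rewrite [r ^+ n.+1]exprS; field; rewrite gt_eqF.
  apply: ler_pM; rewrite ?exprn_ge0 ?normc_ge0//.
    by rewrite expr2 ler_peMr// ler1n.
  by rewrite lerXn2r ?nnegrE ?normc_ge0 ?(ltW r0).
apply: (@second_order_derivable _ _ D (r - normc z) (C * B / r ^+ 2)).
  by rewrite /r; lra.
move=> x xz.
have xr : normc x <= r.
  have := normcD (x - z) z; rewrite subrK => h; apply: le_trans h _.
  by move: xz; rewrite ltrBrDr => /ltW.
have xd : disk x by apply/diskE; exact: le_lt_trans r1.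
pose u M := \sum_(0 <= n < M) a n * (x ^+ n - z ^+ n - n%:R * z ^+ n.-1 * (x - z)).
have lim : (u : nat -> R[i]^o) @ \oo --> (F x - F z - (x - z) * D : R[i]^o).
  have FF : Filter (\oo : set_system nat) by typeclasses eauto.
  have l1 := @cvgc_lin R nat \oo FF (-1) _ _ _ _ (hF z zd) (hF x xd).
  have l2 := @cvgc_lin R nat \oo FF (- (x - z)) _ _ _ _ hD l1.
  rewrite (_ : F x - F z - _ = - (x - z) * D + (-1 * F z + F x)); last by ring.
  rewrite (_ : u = fun M => - (x - z) * (\sum_(0 <= n < M) a n * (n%:R * z ^+ n.-1)) +
    (-1 * (\sum_(0 <= n < M) a n * z ^+ n) + \sum_(0 <= n < M) a n * x ^+ n)); first exact: l2.
  apply/funext => M; rewrite /u !mulr_sumr -!big_split; apply: eq_bigr => n _ /=; ring.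
apply: (cvgc_norm_le lim) => M; rewrite /u.
apply: le_trans (normc_sum _ _ _) _.
rewrite (_ : C * B / r ^+ 2 * _ = C * normc (x - z) ^+ 2 / r ^+ 2 * B); last by ring.
apply: le_trans (ler_wpM2l _ (hB M)); last by rewrite !mulr_ge0 ?invr_ge0 ?sqr_ge0 ?normc_ge0 ?C0 ?(ltW r0).
rewrite mulr_sumr; apply: ler_sum => n _; rewrite Normc.normcM.
rewrite (_ : _ * (n%:R ^+ 2 * r ^+ n) = C * (normc (x - z) ^+ 2 / r ^+ 2 * (n%:R ^+ 2 * r ^+ n))); last by ring.
apply: ler_pM; [exact: normc_ge0|exact: normc_ge0|exact: aC|].
have := power_remainder n r0 xr zr.
rewrite -ler_pdivlMr ?exprn_gt0// => h; apply: le_trans h _.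
by rewrite le_eqVlt; apply/orP; left; apply/eqP; ring.
Qed.

Lemma Hmap_analytic (f : R -> R[i]) : L2 f -> analytic_on_disk (Hmap f).
Proof.
move=> Lf; apply: (@power_series_analytic _ (lcoef f) (L2norm f)).
  by move=> n; exact: lcoef_norm.
by move=> z zd; exact: Hmap_series.
Qed.

End Analytic.

(** * Functionals nonvanishing on zero-free polynomials *)
Section Gleason.
Variable R : realType.
Implicit Types (m : nat -> R[i]) (p q : {poly R[i]}) (s : seq R[i]) (b c w : R[i]).

(** The linear functional on polynomials that sends X^k to m k. *)
Definition mom m p : R[i] := \sum_(k < size p) p`_k * m k.

Lemma mom_widen m p N : (size p <= N)%N -> mom m p = \sum_(k < N) p`_k * m k.
Proof.
move=> pN; rewrite /mom (big_ord_widen N (fun k => p`_k * m k) pN) big_mkcond /=.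
apply: eq_bigr => k _; case: ltnP => // h.
by rewrite nth_default// mul0r.
Qed.

Lemma momD m p q : mom m (p + q) = mom m p + mom m q.
Proof.
pose N := maxn (size p) (size q).
rewrite (@mom_widen m (p + q) N) ?size_polyD// (@mom_widen m p N) ?leq_maxl// (@mom_widen m q N) ?leq_maxr//.
by rewrite -big_split; apply: eq_bigr => k _; rewrite coefD mulrDl.
Qed.

Lemma momZ m c p : mom m (c *: p) = c * mom m p.
Proof.
rewrite (@mom_widen m (c *: p) (size p)) ?size_scale_leq// /mom mulr_sumr.
by apply: eq_bigr => k _; rewrite coefZ mulrA.
Qed.

Lemma momXM m p : mom m ('X * p) = mom (fun k => m k.+1) p.
Proof.
rewrite (@mom_widen m ('X * p) (size p).+1); last first.
  by apply: leq_trans (size_polyMleq _ _) _; rewrite size_polyX.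
rewrite big_ord_recl coefXM eqxx mul0r add0r /mom; apply: eq_bigr => k _.
by rewrite coefXM.
Qed.

Definition polyprod1 s : {poly R[i]} := \prod_(b <- s) (1 - b *: 'X).

(** The moments of the functional p -> mom m ((1 - bX) p). *)
Definition twist b m k := m k - b * m k.+1.

Lemma mom_twist m b p : mom m ((1 - b *: 'X) * p) = mom (twist b m) p.
Proof.
rewrite mulrBl mul1r -scalerAl -scaleNr momD momZ momXM /mom /twist mulr_sumr -big_split.
by apply: eq_bigr => k _ /=; ring.
Qed.

Definition nonvanishing m :=
  forall s, all (fun b => normc b < 1) s -> mom m (polyprod1 s) != 0.

Lemma nonvanishing_twist m b : normc b < 1 -> nonvanishing m -> nonvanishing (twist b m).
Proof.
move=> b1 hm s hs; rewrite -mom_twist.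
have := hm (b :: s); rewrite /polyprod1 big_cons; apply.
by rewrite /= b1.
Qed.

Lemma mom_nil m : mom m (polyprod1 [::]) = m 0%N.
Proof. by rewrite /polyprod1 big_nil /mom size_poly1 big_ord1 coef1 mul1r. Qed.

Lemma nonvanishing0 m : nonvanishing m -> m 0%N != 0.
Proof. by move=> /(_ [::] isT); rewrite mom_nil. Qed.

Lemma coef_1subXM b p k :
  ((1 - b *: 'X) * p)`_k = p`_k - b * (if k is k'.+1 then p`_k' else 0).
Proof.
rewrite mulrBl mul1r coefB -scalerAl coefZ coefXM; congr (_ - b * _).
by case: k.
Qed.

(** The low coefficients give the first two power sums of the b. *)
Lemma polyprod1_coefs s : let P := polyprod1 s in
  [/\ P`_0 = 1, P`_1 = - \sum_(b <- s) b &
      2 * P`_2 = (\sum_(b <- s) b) ^+ 2 - \sum_(b <- s) b ^+ 2].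
Proof.
elim: s => [|b s [h0 h1 h2]] /=.
  rewrite /polyprod1 !big_nil !coef1 /=; split => //; first by rewrite oppr0.
  by rewrite mulr0 expr0n subr0.
rewrite /polyprod1 !big_cons -/(polyprod1 s) !coef_1subXM h0 h1; split.
- by rewrite mulr0 subr0.
- by rewrite mulr1 opprD addrC.
- rewrite mulrBr h2; ring.
Qed.

(** The polynomial x -> mom m ((1 - xX)^n). *)
Definition mompoly m n : {poly R[i]} :=
  \poly_(k < n.+1) ('C(n, k)%:R * (- 1) ^+ k * m k).

Lemma polyprod1_nseq n x : polyprod1 (nseq n x) = (1 - x *: 'X) ^+ n.
Proof.
by rewrite /polyprod1 big_nseq; elim: n => [|n IH]; rewrite ?expr0//= IH exprS.
Qed.

Lemma mom_sum m (I : Type) (r : seq I) (F : I -> {poly R[i]}) :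
  mom m (\sum_(i <- r) F i) = \sum_(i <- r) mom m (F i).
Proof.
apply: (big_morph (mom m)); first exact: momD.
by rewrite -(scale0r 0) momZ mul0r.
Qed.

Lemma mom_Xn m k : mom m 'X^k = m k.
Proof.
elim: k m => [|k IH] m; first by rewrite expr0 /mom size_poly1 big_ord1 coef1 mul1r.
by rewrite exprS momXM IH.
Qed.

Lemma mompolyE m n x : (mompoly m n).[x] = mom m (polyprod1 (nseq n x)).
Proof.
rewrite polyprod1_nseq exprDn mom_sum /mompoly horner_poly; apply: eq_bigr => k _.
rewrite expr1n mul1r -scaleNr exprZn -[(_ *: _) *+ _]scaler_nat scalerA momZ mom_Xn [(- x) ^+ _]exprNn.
by rewrite -!mulrA; congr (_ * (_ * _)); rewrite mulrC.
Qed.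

Lemma mompoly_root m n x : nonvanishing m -> root (mompoly m n) x -> 1 <= normc x.
Proof.
move=> hm; rewrite /root mompolyE => h; rewrite leNgt; apply/negP => x1.
have := hm (nseq n x); rewrite h => /(_ _)/negP; apply => //.
by apply/allP => y /nseqP[-> _].
Qed.

(** The roots of [mompoly] lie outside the open disk, so their inverses b_i satisfy
    |sum b_i^2| <= n, while sum b_i = n m_1/m_0 and the second elementary
    function is C(n,2) m_2/m_0: comparing the terms in n^2 gives the claim. *)
Lemma nonvanishing_square m : nonvanishing m -> m 0%N * m 2 = m 1%N ^+ 2.
Proof.
move=> hm; have m0 := nonvanishing0 hm.
pose w1 := m 1%N / m 0%N; pose w2 := m 2 / m 0%N.
suff h : w2 = w1 ^+ 2.
  have m1E : m 1%N = w1 * m 0%N by rewrite /w1 divfK.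
  have m2E : m 2 = w2 * m 0%N by rewrite /w2 divfK.
  by rewrite m1E m2E h; ring.
have key n : (0 < n)%N -> normc (w1 ^+ 2 - w2) * n%:R <= 1 + normc w2.
  move=> n0; pose P := mompoly m n.
  have [r Pr] := closed_field_poly_normal P.
  have P0 : P`_0 = m 0%N by rewrite coef_poly /= bin0 expr0 !mul1r.
  have Pn0 : P != 0 by apply/eqP => Pz; move: m0; rewrite -P0 Pz coef0 eqxx.
  have lc0 : lead_coef P != 0 by rewrite lead_coef_eq0.
  have r1 z : z \in r -> 1 <= normc z.
    move=> zr; apply: (@mompoly_root m n) => //; rewrite -/P Pr rootZ//.
    by rewrite root_prod_XsubC.
  have r0 z : z \in r -> z != 0.
    by move=> /r1 h; rewrite -normc_gt0; exact: lt_le_trans h.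
  have szr : (size r <= n)%N.
    have := size_poly n.+1 (fun k => 'C(n, k)%:R * (- 1) ^+ k * m k).
    by rewrite -/(mompoly m n) -/P Pr size_scale// size_prod_XsubC ltnS.
  pose s := [seq z^-1 | z <- r].
  have Ps : P = m 0%N *: polyprod1 s.
    have E : \prod_(z <- r) ('X - z%:P) = (\prod_(z <- r) (- z)) *: polyprod1 s.
      rewrite /polyprod1 /s big_map; elim: (r) r0 => [|z r' IH] r0'.
        by rewrite !big_nil scale1r.
      rewrite !big_cons IH; last by move=> y yr; apply: r0'; rewrite inE yr orbT.
      have z0 : z != 0 by apply: r0'; rewrite inE eqxx.
      have -> : 'X - z%:P = (- z) *: (1 - z^-1 *: 'X).
        by rewrite scalerBr scalerA mulNr divff// scaleN1r opprK -alg_polyC scaleNr addrC.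
      by rewrite -scalerAl -scalerAr scalerA.
    have [c0 _ _] := polyprod1_coefs s.
    have lcE : lead_coef P * (\prod_(z <- r) (- z)) = m 0%N.
      by rewrite -P0 {2}Pr E !coefZ c0 mulr1.
    by rewrite {1}Pr E scalerA lcE.
  have [_ c1 c2] := polyprod1_coefs s.
  have P1 : P`_1 = - (n%:R * m 1%N).
    by rewrite coef_poly ltnS n0 bin1 expr1; ring.
  have P2 : 2 * P`_2 = n%:R * (n%:R - 1) * m 2.
    rewrite coef_poly; case: ltnP => n2.
      have h := mul_bin_diag n 1; rewrite bin1 in h.
      rewrite sqrrN expr1n mulr1 mulrA -[2 * _]natrM -h natrM.
      suff -> : n%:R - 1 = n.-1%:R :> R[i] by [].
      by rewrite -{1}(prednK n0) -natr1 addrK.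
    have -> : n = 1%N by apply/eqP; rewrite eqn_leq n0 -ltnS n2.
    by rewrite mulr0 mulr1n subrr mulr0 mul0r.
  have e1 : \sum_(b <- s) b = n%:R * w1.
    have := P1; rewrite Ps coefZ c1 mulrN => /oppr_inj h.
    by apply: (mulfI m0); rewrite h /w1; field.
  have e2 : (n%:R * w1) ^+ 2 - \sum_(b <- s) b ^+ 2 = n%:R * (n%:R - 1) * w2.
    have := P2; rewrite Ps coefZ mulrCA c2 e1 => h.
    by apply: (mulfI m0); rewrite h /w2; field.
  have p2 : normc (\sum_(b <- s) b ^+ 2) <= n%:R.
    apply: le_trans (normc_sum _ _ _) _; rewrite /s big_map.
    apply: (@le_trans _ _ (\sum_(z <- r) 1)).
      rewrite !big_seq; apply: ler_sum => z zr.
      rewrite normcX Normc.normcV exprn_ile1 ?invr_ge0 ?normc_ge0//.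
      by rewrite invf_le1 ?r1// normc_gt0 r0.
    by rewrite big_const_seq count_predT iter_addr_0 ler_nat.
  have n0' : 0 < n%:R :> R by rewrite ltr0n.
  rewrite -(ler_pM2r n0').
  have -> : normc (w1 ^+ 2 - w2) * n%:R * n%:R = normc (\sum_(b <- s) b ^+ 2 - n%:R * w2).
    have -> : \sum_(b <- s) b ^+ 2 - n%:R * w2 = (w1 ^+ 2 - w2) * (n%:R * n%:R).
      by rewrite -[\sum_(b <- s) b ^+ 2](subKr ((n%:R * w1) ^+ 2)) e2; ring.
    rewrite Normc.normcM -natrM -(rmorph_nat (real_complex R)) normcR normr_nat natrM.
    by rewrite mulrA.
  apply: le_trans (normcD _ _) _; rewrite normcNN mulrDl mul1r lerD//.
  by rewrite Normc.normcM -(rmorph_nat (real_complex R)) normcR normr_nat mulrC.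
apply/eqP; rewrite eq_sym -subr_eq0 -normc_eq0; apply/negP => /negP h0.
have h1 : 0 < normc (w1 ^+ 2 - w2) by rewrite lt_neqAle eq_sym h0 normc_ge0.
pose x := (1 + normc w2) / normc (w1 ^+ 2 - w2).
have x0 : 0 <= x by rewrite divr_ge0 ?normc_ge0// addr_ge0 ?normc_ge0.
have := key (Num.bound x) _; rewrite mulrC -ler_pdivlMr// -/x.
have hb := archi_boundP x0.
have bp : (0 < Num.bound x)%N by rewrite -(ltr_nat R); exact: le_lt_trans hb.
by move=> /(_ bp); rewrite leNgt hb.
Qed.

(** The moments of the functional twisted by b = 1/2 have the same ratio w: by
    [nonvanishing_square] they begin with m_0 (1 - w/2) and m_0 w (1 - w/2). The
    claim for k+1 applied to them gives the claim for k+2. *)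
Lemma nonvanishing_powers m : nonvanishing m ->
  forall k, m k = m 0%N * (m 1%N / m 0%N) ^+ k.
Proof.
suff H k : forall m, nonvanishing m -> m k = m 0%N * (m 1%N / m 0%N) ^+ k /\
    m k.+1 = m 0%N * (m 1%N / m 0%N) ^+ k.+1.
  by move=> hm k; have [] := H k m hm.
have H2 m' : nonvanishing m' -> m' 2 = m' 0%N * (m' 1%N / m' 0%N) ^+ 2.
  move=> hm; have m0 := nonvanishing0 hm; apply: (mulfI m0).
  by rewrite nonvanishing_square//; field.
elim: k => [|k IH] {}m hm; have m0 := nonvanishing0 hm.
  by rewrite expr0 mulr1 expr1 mulrCA divff// mulr1.
have [hk hk1] := IH m hm; split => //.
have h2 : (2 : R[i]) != 0 by rewrite pnatr_eq0.
have half1 : normc (2^-1 : R[i]) < 1.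
  by rewrite Normc.normcV -(rmorph_nat (real_complex R)) normcR normr_nat invf_lt1// ltr1n.
have ht := nonvanishing_twist half1 hm.
have [_] := IH _ ht; have := nonvanishing0 ht; rewrite /twist hk1 (H2 m hm).
set w := m 1%N / m 0%N; have m1 : m 1%N = m 0%N * w by rewrite mulrCA divff ?mulr1.
rewrite m1 => t0.
have -> : m 0%N * w - 2^-1 * (m 0%N * w ^+ 2) = w * (m 0%N - 2^-1 * (m 0%N * w)) by ring.
rewrite mulfK// => h.
apply: (mulfI (invr_neq0 h2)).
have -> : 2^-1 * m k.+2 = m 0%N * w ^+ k.+1 - (m 0%N * w ^+ k.+1 - 2^-1 * m k.+2) by ring.
by rewrite h [w ^+ k.+2]exprS; ring.
Qed.

End Gleason.

(** * Operators preserving shifted minimum phase functions *)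
Section Operator.
Variable R : realType.
Notation Rp := (@Rplus R).
Implicit Types (f g : R -> R[i]) (z : R[i]).

Definition comb (c : nat -> R[i]) N : R -> R[i] :=
  fun t => \sum_(0 <= n < N) c n * (ell n t)%:C.

Lemma combS c N t : comb c N.+1 t = c N * (ell N t)%:C + comb c N t.
Proof. by rewrite /comb big_nat_recr //= addrC. Qed.

Lemma L2_comb c N : L2 (comb c N).
Proof.
elim: N => [|N IH]; first by apply: L2_ext (@L2_0 R) => t _; rewrite /comb big_geq.
by apply: L2_ext (L2_lin (c N) (@L2_ell R N) IH) => t _; rewrite combS.
Qed.

Lemma functional_comb (Phi : (R -> R[i]) -> R[i]) :
  (forall a f g, L2 f -> L2 g -> Phi (fun t => a * f t + g t) = a * Phi f + Phi g) ->
  forall c N, Phi (comb c N) = \sum_(0 <= n < N) c n * Phi (fun t => (ell n t)%:C).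
Proof.
move=> lin c; elim=> [|N IH].
  rewrite big_geq //.
  have -> : comb c 0 = (fun t => -1 * comb c 0 t + comb c 0 t).
    by apply/funext => t; rewrite /comb big_geq// mulr0 addr0.
  by rewrite lin ?mulN1r ?addNr//; exact: L2_comb.
rewrite big_nat_recr //= -IH addrC -lin; [|exact: L2_ell|exact: L2_comb].
by congr Phi; apply/funext => t; exact: combS.
Qed.

Lemma lcoef_comb c N n : (N <= n)%N -> lcoef (comb c N) n = 0.
Proof.
move=> Nn; rewrite (@functional_comb (fun f => lcoef f n)) => [|a f g Lf Lg]; last exact: lcoef_lin.
rewrite big_nat big1// => k /andP[_ kN]; rewrite lcoef_ell ltn_eqF ?mulr0//.
exact: leq_trans Nn.
Qed.

Lemma N2_comb c N : N2 (comb c N) = \sum_(0 <= n < N) normc (c n) ^+ 2.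
Proof.
elim: N => [|N IH]; first by rewrite big_geq// N2_0// => t _; rewrite /comb big_geq.
have cN : lcoef (comb c N.+1) N = c N.
  rewrite (_ : comb c N.+1 = (fun t => c N * (ell N t)%:C + comb c N t)).
    rewrite lcoef_lin; [|exact: L2_ell|exact: L2_comb].
    by rewrite lcoef_ell eqxx mulr1 lcoef_comb// addr0.
  by apply/funext => t; exact: combS.
have := N2_minus_proj N (L2_comb c N.+1); rewrite cN.
rewrite (@N2_ext _ _ (comb c N)); last by move=> t _; rewrite combS addrC addKr.
by rewrite IH big_nat_recr //= => ->; rewrite subrK.
Qed.

Lemma Hmap_comb c N z : disk z -> Hmap (comb c N) z = \sum_(0 <= n < N) c n * z ^+ n.
Proof.
move=> zd; rewrite (@functional_comb (fun f => Hmap f z)) => [|a f g Lf Lg]; last exact: Hmap_lin.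
by apply: eq_bigr => n _; rewrite Hmap_ell.
Qed.

Lemma prod1sub_horner (s : seq R[i]) z : (polyprod1 s).[z] = prod1sub s z.
Proof.
rewrite /polyprod1 /prod1sub; elim: s => [|b s IH]; first by rewrite !big_nil hornerC.
by rewrite !big_cons hornerM IH !hornerE.
Qed.

(** No delay is needed, since the transform is a product of factors 1 - b z. *)
Lemma min_phase_prod (s : seq R[i]) : all (fun b => normc b < 1) s ->
  shifted_min_phase (comb (fun k => (polyprod1 s)`_k) (size (polyprod1 s))).
Proof.
move=> hs; set f := comb _ _; have Lf : L2 f by exact: L2_comb.
split=> //; exists f, 0; split => //; last first.
  apply: aeW => t; rewrite RplusE => t0.
  by rewrite /time_shift t0 subr0.
split=> //; apply: (outer_prod1sub hs); first exact: Hmap_hardy2.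
move=> z zd; rewrite Hmap_comb// -prod1sub_horner horner_coef.
by rewrite big_mkord.
Qed.

Variable A : (R -> R[i]) -> (R -> R[i]).
Hypotheses (hA : bounded_linear_L2 A)
  (hM : A @` (@shifted_min_phase R) `<=` @shifted_min_phase R).

Lemma operator_L2 f : L2 f -> L2 (A f).
Proof. by case: hA => h _ _ _; exact: h. Qed.

Definition value z f := Hmap (A f) z.

Lemma value_lin z (a : R[i]) f g : disk z -> L2 f -> L2 g ->
  value z (fun t => a * f t + g t) = a * value z f + value z g.
Proof.
move=> zd Lf Lg; have [_ _ lin _] := hA.
rewrite /value -Hmap_lin//; [|exact: operator_L2..].
apply: Hmap_ae => //; first by apply: operator_L2; exact: L2_lin.
  by apply: L2_lin; exact: operator_L2.
exact: lin.
Qed.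

Lemma value_bound z : disk z -> exists2 K, 0 <= K &
  forall f, L2 f -> normc (value z f) ^+ 2 <= K * N2 f.
Proof.
move=> zd; have [_ _ _ [K hK]] := hA; have [C C0 hC] := Hmap_bound zd.
exists (C * K ^+ 2); first by rewrite mulr_ge0 ?sqr_ge0.
move=> f Lf; apply: le_trans (hC _ (operator_L2 Lf)) _.
rewrite -mulrA ler_wpM2l// -!L2norm_sqr -exprMn.
have h := hK f Lf.
by rewrite lerXn2r ?nnegrE ?sqrtr_ge0// (le_trans _ h)// sqrtr_ge0.
Qed.

Definition moments z n := value z (fun t => (ell n t)%:C).

Lemma moments_nonvanishing z : disk z -> nonvanishing (moments z).
Proof.
move=> zd s hs; have := min_phase_prod hs; set f := comb _ _ => mf.
have Af : shifted_min_phase (A f) by apply: hM; exists f.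
have := shifted_min_phase_neq0 Af zd; rewrite -/(value z f) /f.
rewrite (functional_comb (fun a f g => @value_lin z a f g zd)) big_mkord.
by [].
Qed.

(** The moments at z turn out to be psi z * phi z ^+ n, which fixes these
    choices. *)
Definition psi z := moments z 0%N.
Definition phi z := moments z 1%N / moments z 0%N.

Lemma psi_neq0 z : disk z -> psi z != 0.
Proof. by move=> zd; apply: nonvanishing0; exact: moments_nonvanishing. Qed.

Lemma momentsE z n : disk z -> moments z n = psi z * phi z ^+ n.
Proof. by move=> zd; apply: nonvanishing_powers; exact: moments_nonvanishing. Qed.

(** If |phi z| >= 1, the combinations with coefficients conj(phi z)^n would
    violate boundedness. *)
Lemma phi_disk z : disk z -> disk (phi z).
Proof.
move=> zd; apply/diskE; rewrite ltNge; apply/negP => w1.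
set w := phi z in w1.
have [K K0 hK] := value_bound zd.
pose c n := conjc w ^+ n.
pose S N := \sum_(0 <= n < N) (normc w ^+ n) ^+ 2.
have S1 N : N%:R <= S N.
  rewrite -[X in X <= _]mulr1 mulr_natl -[X in _ *+ X]subn0 -sumr_const_nat.
  by apply: ler_sum => n _; rewrite -exprM exprn_ege1.
have NS N : N2 (comb c N) = S N.
  by rewrite N2_comb; apply: eq_bigr => n _; rewrite /c normcX normc_conj.
have VS N : value z (comb c N) = psi z * (S N)%:C.
  rewrite (functional_comb (fun a f g => @value_lin z a f g zd)) /S rmorph_sum mulr_sumr.
  apply: eq_bigr => n _; rewrite -/(moments z n) momentsE// /c mulrCA -conjcX mulrC.
  by rewrite [conjc _ * _]mulrC mulr_conj normcX mulrC.
have p0 : 0 < normc (psi z) ^+ 2 by rewrite exprn_gt0// normc_gt0 psi_neq0.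
have key N : normc (psi z) ^+ 2 * N.+1%:R <= K.
  have SN : 0 < S N.+1 by apply: lt_le_trans (S1 N.+1); rewrite ltr0n.
  have := hK _ (L2_comb c N.+1); rewrite VS NS Normc.normcM normcR gtr0_norm// exprMn.
  rewrite [S _ ^+ 2]expr2 mulrA ler_pM2r// => h.
  by apply: le_trans h; rewrite ler_wpM2l ?sqr_ge0.
have x0 : 0 <= K / normc (psi z) ^+ 2 by rewrite divr_ge0// ltW.
have := key (Num.bound (K / normc (psi z) ^+ 2)).
rewrite mulrC -ler_pdivlMr// leNgt => /negP; apply.
by apply: lt_le_trans (archi_boundP x0) _; rewrite ler_nat.
Qed.

Lemma phi_analytic : analytic_on_disk phi.
Proof.
move=> z zd.
have h1 := Hmap_analytic (operator_L2 (@L2_ell R 1)) zd.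
have h0 := Hmap_analytic (operator_L2 (@L2_ell R 0)) zd.
exact: (@derivable_quot R[i] _ _ z h1 h0 (psi_neq0 zd)).
Qed.

(** Both sides are continuous in f and agree on the Laguerre functions. *)
Lemma value_weighted z f : disk z -> L2 f -> Hmap (A f) z = psi z * Hmap f (phi z).
Proof.
move=> zd; have wd := phi_disk zd.
pose D f := value z f - psi z * Hmap f (phi z).
have Dlin a f' g : L2 f' -> L2 g -> D (fun t => a * f' t + g t) = a * D f' + D g.
  by move=> Lf Lg; rewrite /D value_lin// Hmap_lin//; ring.
have [K K0 hK] := value_bound zd; have [C C0 hC] := Hmap_bound wd.
have Dbound f' : L2 f' -> normc (D f') ^+ 2 <= (2 * K + 2 * (normc (psi z) ^+ 2 * C)) * N2 f'.
  move=> Lf; apply: le_trans (normc_sqrD _ _) _.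
  rewrite normcNN (Normc.normcM (psi z)) (exprMn _ (normc (psi z))).
  have h1 := hK _ Lf; have h2 := ler_wpM2l (sqr_ge0 (normc (psi z))) (hC _ Lf).
  move: h1 h2; set p := normc (psi z) ^+ 2; rewrite (mulrA p C) => h1 h2.
  rewrite (_ : (_ + _) * N2 f' = 2 * (K * N2 f') + 2 * (p * C * N2 f')); last by ring.
  by apply: lerD; rewrite ler_pM2l.
suff h : forall f, L2 f -> D f = 0 by move=> /h /eqP; rewrite subr_eq0 => /eqP.
apply: L2_ell_ind.
- by move=> a f1 g Lf Lg hf hg; rewrite /= Dlin// hf hg mulr0 addr0.
- move=> f1 Lf hf; set B := _ + _ in Dbound.
  apply/eqP; rewrite -normc_eq0; apply/negP => /negP n0.
  have {}n0 : 0 < normc (D f1) by rewrite lt_neqAle eq_sym n0 normc_ge0.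
  have B0 : 0 <= B by rewrite addr_ge0// mulr_ge0// mulr_ge0// sqr_ge0.
  have B1 : 0 < B + 1 by rewrite ltr_wpDl.
  have [g [Lg hg Ng]] := hf _ (divr_gt0 (exprn_gt0 2 n0) B1).
  have Ld := L2_lin (-1) Lg Lf.
  have := Dbound _ Ld; rewrite Dlin// hg mulr0 add0r.
  rewrite (@N2_ext _ _ (fun t => f1 t - g t)); last by move=> t _; rewrite mulN1r addrC.
  move: Ng; rewrite ltr_pdivlMr// => Ng; apply/negP; rewrite -ltNge.
  apply: le_lt_trans Ng; rewrite mulrC ler_wpM2l ?N2_ge0//.
  by rewrite lerDl.
- by move=> n; rewrite /D Hmap_ell// -/(moments z n) momentsE// subrr.
Qed.

End Operator.

Lemma hardy2_ext (R : realType) (F G : R[i] -> R[i]) :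
  (forall z, disk z -> F z = G z) -> hardy2 F -> hardy2 G.
Proof.
move=> FG [a [ha hF]]; exists a; split; first exact: ha.
by move=> z zd; rewrite -(FG z zd); exact: hF.
Qed.

Theorem theorem3 (R : realType) (A : (R -> R[i]) -> (R -> R[i]))
    (hA : bounded_linear_L2 A)
    (hM : A @` (@shifted_min_phase R) `<=` @shifted_min_phase R) :
  exists psi phi : R[i] -> R[i],
    [/\ hardy2 psi,
        forall z, disk z -> psi z != 0,
        analytic_on_disk phi,
        forall z, disk z -> disk (phi z) &
        forall f, L2 f ->
          hardy2 (mul_op psi (comp_op phi (Hmap f))) /\
          L2eq (A f) (Hinv (mul_op psi (comp_op phi (Hmap f))))].
Proof.
exists (psi A), (phi A); split.
- by apply: Hmap_hardy2; apply: operator_L2 => //; exact: L2_ell.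
- by move=> z; exact: psi_neq0.
- exact: phi_analytic.
- by move=> z; exact: phi_disk.
move=> f Lf; have LA := operator_L2 hA Lf.
have E z : disk z -> Hmap (A f) z = mul_op (psi A) (comp_op (phi A) (Hmap f)) z.
  by move=> zd; exact: value_weighted.
split; first exact: hardy2_ext E (Hmap_hardy2 LA).
have [Lg hg] := @xgetPex _ (fun=> 0)
  [set g | L2 g /\ forall z, disk z -> Hmap g z = mul_op (psi A) (comp_op (phi A) (Hmap f)) z]
  (ex_intro _ (A f) (conj LA E)).
by apply: Hmap_inj => // z zd; rewrite E// hg.
Qed.
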